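(* Consider the planar polynomial differential system $$\dot x=P(x,y),\qquad \dot y=Q(x,y),$$ where $P$ and $Q$ are real polynomials of degree $n$ satisfying $P(0,0)=Q(0,0)=0$. In polar coordinates $x=r\cos\theta$, $y=r\sin\theta$ it is written as $\dot r=R(r,\theta)$, $\dot\theta=\Theta(r,\theta)$, where $$R(r,\theta):=P(r\cos\theta,r\sin\theta)\cos\theta+Q(r\cos\theta,r\sin\theta)\sin\theta,$$ $$\Theta(r,\theta):=\frac1r\Big(Q(r\cos\theta,r\sin\theta)\cos\theta-P(r\cos\theta,r\sin\theta)\sin\theta\Big).$$ Define the polynomial $p$ by $$p(r^2):=\frac{1}{2\pi r}\int_0^{2\pi}R(r,\theta)\,d\theta,$$ and assume that $p(s)$ has the Dulac pair $(k,w(r))$, where $w$ is a polynomial of degree $d$. For these $k$ and $w$ consider the function $$M(r,\theta,k,w):=R(r,\theta)w'(r)-k\left(\frac{\partial R(r,\theta)}{\partial r}+\frac{\partial\Theta(r,\theta)}{\partial\theta}+\frac{R(r,\theta)}{r}\right)w(r)=:\sum_{i=0}^{n+d-1}M_i(\theta,k,w)\,r^i,$$ and, for each $i\ge 0$, let $m_i(k,w)\in\mathbb{R}$ be such that $\max_{\theta\in[0,2\pi]}M_i(\theta,k,w)\le m_i(k,w)$. Let $m^+$ be the number of non-negative real roots of $w$. If the polynomial $$\Phi_{k,w}(r):=\sum_{i=0}^{n+d-1}m_i(k,w)\,r^i$$ is negative for all $r\in(0,\infty)$, then the system $\dot x=P(x,y)$, $\dot y=Q(x,y)$ has at most $m^+$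 limit cycles, and all of them are hyperbolic.
   Context: Dulac pair: given a polynomial $p(s)\in\mathbb{R}[s]$, a couple $(k,w(r))$ with $k>0$ a real number and $w\in\mathbb{R}[r]$ is called a Dulac pair of $p(s)$ if $$p_{k,w}(r):=r\,p(r^2)\,w'(r)-2k\left(p(r^2)+r^2p'(r^2)\right)w(r)<0\quad\text{for all } r>0.$$ Here $p'$ denotes the derivative of $p$ with respect to its argument $s$, evaluated at $s=r^2$. The average $\frac{1}{2\pi r}\int_0^{2\pi}R(r,\theta)\,d\theta$ is a polynomial in $r^2$, so $p$ is well defined. Roots of $w$ are counted without multiplicity (i.e. $m^+$ is the number of distinct real roots of $w$ in $[0,\infty)$). A limit cycle is an isolated periodic orbit. A periodic orbit $\{(x(t),y(t)):t\in[0,T]\}$ of period $T$ is hyperbolic if $\int_0^T\left(\frac{\partial P}{\partial x}+\frac{\partial Q}{\partial y}\right)(x(t),y(t))\,dt\neq0$. *)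

(* Defs.v *)
From mathcomp Require Import all_boot all_order all_algebra.
From mathcomp Require Import all_classical all_reals all_analysis.
(* Not imported: the notations of mpoly clash with those of MathComp-Analysis. *)
From mathcomp Require mpoly.

Set Implicit Arguments.
Unset Strict Implicit.
Unset Printing Implicit Defensive.

Import Order.TTheory GRing.Theory Num.Theory.
Import numFieldNormedType.Exports.

Local Open Scope classical_set_scope.
Local Open Scope ring_scope.

Notation bipoly R := (mpoly.mpoly 2 R).

Section PlanarSystem.
Variable R : realType.
Implicit Types (F P Q : bipoly R) (p w : {poly R}) (k r theta T : R).
Implicit Types (x y : R -> R) (C : set (R * R)).

Definition eval2 F (a b : R) : R := mpoly.meval (tnth [tuple a; b]) F.

Definition degree2 F : nat := \max_(m <- mpoly.msupp F) mpoly.mdeg m.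

(* The degree of a planar system is the larger of the degrees of its two
   components. *)
Definition system_degree P Q : nat := maxn (degree2 P) (degree2 Q).

Definition divergence P Q : bipoly R :=
  mpoly.mderiv ord0 P + mpoly.mderiv ord_max Q.

Definition polarR P Q r theta : R :=
  eval2 P (r * cos theta) (r * sin theta) * cos theta +
  eval2 Q (r * cos theta) (r * sin theta) * sin theta.

Definition polarTheta P Q r theta : R :=
  r^-1 * (eval2 Q (r * cos theta) (r * sin theta) * cos theta -
          eval2 P (r * cos theta) (r * sin theta) * sin theta).

(* A polynomial is determined by its values on (0, +oo), so there is at most
   one such p. *)
Definition is_radial_average P Q p : Prop :=
  forall r, 0 < r ->
    p.[r ^+ 2] = (2 * pi * r)^-1 *
      Rintegral lebesgue_measure `[0, 2 * pi] (fun theta => polarR P Q r theta).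

Definition dulac_pair p k w : Prop :=
  0 < k /\
  forall r, 0 < r ->
    r * p.[r ^+ 2] * (deriv w).[r]
    - 2 * k * (p.[r ^+ 2] + r ^+ 2 * (deriv p).[r ^+ 2]) * w.[r] < 0.

Definition dulac_M P Q k w r theta : R :=
  polarR P Q r theta * (deriv w).[r]
  - k * (derive1 (fun r' => polarR P Q r' theta) r
         + derive1 (fun theta' => polarTheta P Q r theta') theta
         + polarR P Q r theta / r) * w.[r].

Definition is_solution P Q x y : Prop :=
  forall t : R, is_derive t (1 : R) x (eval2 P (x t) (y t)) /\
                is_derive t (1 : R) y (eval2 Q (x t) (y t)).

Definition is_time_period x y T : Prop :=
  0 < T /\ forall t, x (t + T) = x t /\ y (t + T) = y t.

(* T is the least positive period; a constant solution has none, so equilibria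
   are not periodic. *)
Definition periodic_solution P Q x y T : Prop :=
  [/\ is_solution P Q x y, is_time_period x y T &
      forall T', is_time_period x y T' -> T <= T'].

Definition orbit_of x y T : set (R * R) :=
  [set (x t, y t) | t in `[0, T]].

Definition periodic_orbit P Q C : Prop :=
  exists x y T, periodic_solution P Q x y T /\ C = orbit_of x y T.

(* Isolated: some neighbourhood of C contains no other periodic orbit. *)
Definition limit_cycle P Q C : Prop :=
  periodic_orbit P Q C /\
  exists U : set (R * R),
    [/\ open U, C `<=` U &
        forall C', periodic_orbit P Q C' -> C' `<=` U -> C' = C].

(* The integral does not depend on the parametrization of C, as two of them
   differ by a time shift. *)
Definition hyperbolic P Q C : Prop :=
  forall x y T, periodic_solution P Q x y T -> C = orbit_of x y T ->
    Rintegral lebesgue_measure `[0, T]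
      (fun t => eval2 (divergence P Q) (x t) (y t)) <> 0.

End PlanarSystem.

(* Main.v *)
Require Import Defs.
From mathcomp Require Import all_boot all_order all_algebra.
From mathcomp Require Import all_classical all_reals all_analysis.
From mathcomp Require mpoly.
From mathcomp Require Import ring lra.
Import Order.TTheory GRing.Theory Num.Theory.
Import numFieldNormedType.Exports.
Local Open Scope classical_set_scope.
Local Open Scope card_scope.
Local Open Scope ring_scope.
Set Implicit Arguments.
Unset Strict Implicit.

(** The idea.  In Cartesian terms M = R w' - k div w, where R is the radial
    component of the field and div its divergence ([dulac_ME]), and a negative
    Phi makes M negative on the punctured plane.

    Along a periodic orbit g = w(r) satisfies g' = M + k div g, so
    g exp (- k int div) strictly decreases ([weight_decr]).  After one period g
    returns to its value: it cannot vanish on the orbit ([orbit_no_root]), and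
    the integral of the divergence is not 0 ([orbit_hyperbolic]).  Hence no
    orbit meets a circle whose radius is a root of w.  Sending an orbit to the
    largest nonnegative root below it is a map into the nonnegative roots of w,
    provided that no orbit lies in a disc without roots ([inner_root_exists]),
    and it is injective provided that no annulus without roots contains two
    orbits ([inner_root_inj]).

    Both provisos are Bendixson-Dulac arguments with the Dulac function
    |w|^(-1/k): in a region bounded by orbits the integral of a quantity of
    constant sign would be 0.  Speaking of the region between two orbits requires
    the Jordan curve theorem and Green's formula for curved domains.  Instead the
    region is described by a function: the winding number around a point is
    constant off the orbit, 0 outside a large circle, and it jumps across the
    orbit.  A combination beta = c1 N1 + N2 of the winding numbers of two orbits
    that vanishes in the hole of the annulus (for a single orbit in a disc,
    c1 = 0) is a compactly supported weight, transported by the flow, so that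
    the divergence theorem is needed only on circles.

    To differentiate, the winding number is regularized to
    N_e(a, b) = int ((x - a) dy - (y - b) dx) / (|(x, y) - (a, b)|^2 + e),
    a smooth function on the plane ([wind_chain]).  Its derivative along the
    field is 2 e times the integral over the orbit of the cross product of the
    values of the field at two points, divided by the square of the denominator;
    as the cross product vanishes on the diagonal, this derivative is small in
    the mean as e tends to 0 ([cross_pointwise], [triple_kernel],
    [owind_along]).  With h(s) = s^2 / (1 + s^2) and
    J(r) = int r R h(beta) dtheta, the function |w|^(-1/k) J has a derivative
    equal to a positive multiple of the integral of - M h(beta), up to that error
    and the sign of w ([J_derive], [J_ode]).  J is small on both boundary circles
    ([owind_outer], [owind_inner]), so M h(beta) is small in the mean; but
    beta stays away from 0 near a point next to the orbit, because N_e jumps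
    across it ([wind_jump]).  This is the contradiction [dulac_core], applied to
    orbits in [annulus_contra]. *)

(** * Continuity and derivatives of compound expressions *)

Section Continuity.
Context {R : realType} {U : topologicalType}.
Implicit Types f g : U -> R.

Lemma contD f g : continuous f -> continuous g -> continuous (fun u => f u + g u).
Proof. by move=> cf cg u; apply: cvgD; [exact: cf|exact: cg]. Qed.

Lemma contN f : continuous f -> continuous (fun u => - f u).
Proof. by move=> cf u; apply: cvgN; exact: cf. Qed.

Lemma contM f g : continuous f -> continuous g -> continuous (fun u => f u * g u).
Proof. by move=> cf cg u; apply: cvgM; [exact: cf|exact: cg]. Qed.

Lemma contX n f : continuous f -> continuous (fun u => f u ^+ n).
Proof.
move=> cf; elim: n => [|n IH].
  by under eq_fun do rewrite expr0; move=> u; exact: cvg_cst.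
by under eq_fun do rewrite exprS; apply: contM.
Qed.

Lemma contV f : (forall u, f u != 0) -> continuous f -> continuous (fun u => (f u)^-1).
Proof. by move=> f0 cf u; apply: cvgV; [exact: f0|exact: cf]. Qed.

Lemma contC (c : R) : continuous (fun _ : U => c).
Proof. by move=> u; exact: cvg_cst. Qed.

Lemma cont_norm f : continuous f -> continuous (fun u => `|f u|).
Proof. by move=> cf u; apply: cvg_norm; exact: cf. Qed.

Lemma cont_comp (V : topologicalType) (F : V -> R) (a : U -> V) :
  continuous F -> continuous a -> continuous (fun u => F (a u)).
Proof. by move=> cF ca u; apply: continuous_comp; [exact: ca|exact: cF]. Qed.

Lemma cont_pair (V W : topologicalType) (a : U -> V) (b : U -> W) :
  continuous a -> continuous b -> continuous (fun u => (a u, b u)).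
Proof. by move=> ca cb u; apply: cvg_pair; [exact: ca|exact: cb]. Qed.

Lemma cont_comp2 (V W : topologicalType) (F : V -> W -> R) (a : U -> V) (b : U -> W) :
  continuous (fun z : V * W => F z.1 z.2) -> continuous a -> continuous b ->
  continuous (fun u => F (a u) (b u)).
Proof.
move=> cF ca cb.
exact: (cont_comp cF (cont_pair ca cb)).
Qed.

Lemma cont_id : continuous (fun u : U => u).
Proof. by move=> u; exact: cvg_id. Qed.

Lemma cont_curry (V : topologicalType) (F : V -> U -> R) v :
  continuous (fun z : V * U => F z.1 z.2) -> continuous (F v).
Proof.
move=> cF.
by apply: (cont_comp2 (a := fun _ => v) (b := id) cF) => u; [exact: cvg_cst|exact: cvg_id].
Qed.

Lemma cont_curry_r (V : topologicalType) (F : U -> V -> R) v :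
  continuous (fun z : U * V => F z.1 z.2) -> continuous (fun u => F u v).
Proof.
move=> cF.
by apply: (cont_comp2 (a := id) (b := fun _ => v) cF) => u; [exact: cvg_id|exact: cvg_cst].
Qed.
End Continuity.

Lemma cont_fst0 {U V : topologicalType} : continuous (fun z : U * V => z.1).
Proof. by move=> u; exact: cvg_fst. Qed.

Lemma cont_snd0 {U V : topologicalType} : continuous (fun z : U * V => z.2).
Proof. by move=> u; exact: cvg_snd. Qed.

Lemma cont_fst1 {U V W: topologicalType} : continuous (fun z : (U * V) * W => z.1.1).
Proof.
move=> u; apply: (cvg_comp fst fst); exact: cvg_fst.
Qed.

Lemma cont_snd1 {U V W: topologicalType} : continuous (fun z : (U * V) * W => z.1.2).
Proof.
move=> u; apply: (cvg_comp fst snd); [exact: cvg_fst|exact: cvg_snd].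
Qed.

Section ContinuityReal.
Context {R : realType} {U : topologicalType}.
Implicit Types f : U -> R.

Lemma cont_sin f : continuous f -> continuous (fun u => sin (f u)).
Proof. exact: (cont_comp (@continuous_sin R)). Qed.

Lemma cont_cos f : continuous f -> continuous (fun u => cos (f u)).
Proof. exact: (cont_comp (@continuous_cos R)). Qed.

Lemma cont_horner (p : {poly R}) f : continuous f -> continuous (fun u => p.[f u]).
Proof. by apply: (@cont_comp R U R (fun x => p.[x])) => x; exact: continuous_horner. Qed.
End ContinuityReal.

Ltac cont_step :=
  lazymatch goal with
  | |- continuous (fun _ => ?c) => exact: contC
  | |- continuous (fun z => z) => exact: cont_id
  | |- continuous fst => exact: cont_fst0
  | |- continuous snd => exact: cont_snd0
  | |- continuous (fun z => z.1) => exact: cont_fst0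
  | |- continuous (fun z => z.2) => exact: cont_snd0
  | |- continuous (fun z => z.1.1) => exact: cont_fst1
  | |- continuous (fun z => z.1.2) => exact: cont_snd1
  | |- continuous (fun z => @?f z + @?g z) => refine (@contD _ _ f g _ _)
  | |- continuous (fun z => - @?f z) => refine (@contN _ _ f _)
  | |- continuous (fun z => @?f z * @?g z) => refine (@contM _ _ f g _ _)
  | |- continuous (fun z => @?f z ^+ ?n) => refine (@contX _ _ n f _)
  | |- continuous (fun z => (@?f z)^-1) => refine (@contV _ _ f _ _)
  | |- continuous (fun z => `|@?f z|) => refine (@cont_norm _ _ f _)
  | |- continuous (fun z => sin (@?f z)) => refine (@cont_sin _ _ f _)
  | |- continuous (fun z => cos (@?f z)) => refine (@cont_cos _ _ f _)
  | |- continuous (fun z => (?p).[@?f z]) => refine (@cont_horner _ _ p f _)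
  | |- _ => match goal with
      | H : continuous (fun z => ?F z.1 z.2) |- continuous (fun u => ?F (@?a u) (@?b u)) =>
        refine (@cont_comp2 _ _ _ _ F a b H _ _)
      | H : continuous ?F |- continuous (fun u => ?F (@?a u)) =>
        refine (@cont_comp _ _ _ F a H _)
      end
  end.
(* [cont] tries hypotheses first, so that they may cover compound expressions;
   [cont_rec] follows the structure of the expression first, as unifying every
   subterm with every hypothesis is slow on large expressions. *)
Ltac cont := repeat (first [assumption | cont_step]).
Ltac cont_leaf := match goal with H : continuous ?F |- continuous ?G => constr_eq F G; exact: H end.
Ltac cont_rec := repeat (first [cont_step | cont_leaf | assumption]).

Notation isd x f l := (is_derive x 1 f l).

Section Derivatives.
Context {R : realType}.
Implicit Types (f g : R -> R) (x : R).

Lemma isd_eq f x l l' : isd x f l -> l = l' -> isd x f l'.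
Proof. by move=> h <-. Qed.

Lemma isdD f g x l l' : isd x f l -> isd x g l' -> isd x (fun s => f s + g s) (l + l').
Proof. by move=> h h'; exact: (is_deriveD h h'). Qed.

Lemma isdN f x l : isd x f l -> isd x (fun s => - f s) (- l).
Proof. by move=> h; exact: (is_deriveN h). Qed.

Lemma isdM f g x l l' : isd x f l -> isd x g l' ->
  isd x (fun s => f s * g s) (l * g x + f x * l').
Proof.
move=> h h'; apply: (isd_eq (is_deriveM h h')).
by rewrite /GRing.scale /= mulrC addrC (mulrC (g x)); ring.
Qed.

Lemma isdC (c : R) x : isd x (fun _ => c) 0.
Proof. exact: is_derive_cst. Qed.

Lemma isd_id x : isd x (fun s => s) 1.
Proof. exact: is_derive_id. Qed.

Lemma isdX n f x l : isd x f l -> isd x (fun s => f s ^+ n) (n%:R * f x ^+ n.-1 * l).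
Proof.
move=> h; elim: n => [|n IH].
  by rewrite !mul0r; under eq_fun do rewrite expr0; exact: isdC.
under eq_fun do rewrite exprS.
apply: (isd_eq (isdM h IH)); rewrite /= -natr1.
by case: n {IH} => [|n]; rewrite /= ?expr0 ?exprS; ring.
Qed.

Lemma isd_comp f g x l l' : isd (g x) f l -> isd x g l' -> isd x (fun s => f (g s)) (l * l').
Proof. by move=> h h'; exact: (is_derive1_comp h h'). Qed.

Lemma isdV f x l : f x != 0 -> isd x f l -> isd x (fun s => (f s)^-1) (- l / f x ^+ 2).
Proof.
move=> f0 h; apply: (isd_eq (is_deriveV f0 h)).
by rewrite /GRing.scale /=; field.
Qed.

Lemma isd_sin f x l : isd x f l -> isd x (fun s => sin (f s)) (cos (f x) * l).
Proof. by move=> h; apply: isd_comp. Qed.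

Lemma isd_cos f x l : isd x f l -> isd x (fun s => cos (f s)) (- sin (f x) * l).
Proof. by move=> h; apply: isd_comp. Qed.

Lemma isd_horner (p : {poly R}) f x l :
  isd x f l -> isd x (fun s => p.[f s]) ((deriv p).[f x] * l).
Proof. by move=> h; apply: (@isd_comp (horner p)) => //; exact: is_derive_poly. Qed.

Lemma isd_cont f : (forall x, exists l, isd x f l) -> continuous f.
Proof.
move=> h x; have [l [/derivable1_diffP d _]] := h x.
exact: differentiable_continuous.
Qed.
End Derivatives.

Ltac isd1 := first [eassumption |
  lazymatch goal with
  | |- is_derive _ _ (fun _ => ?c) _ => notypeclasses refine (isdC _ _)
  | |- is_derive _ _ (fun s => s) _ => notypeclasses refine (isd_id _)
  | |- is_derive _ _ sin _ => notypeclasses refine (is_derive_sin _)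
  | |- is_derive _ _ cos _ => notypeclasses refine (is_derive_cos _)
  | |- is_derive _ _ (fun s => _ + _) _ => notypeclasses refine (isdD _ _)
  | |- is_derive _ _ (fun s => - _) _ => notypeclasses refine (isdN _)
  | |- is_derive _ _ (fun s => _ ^+ _) _ => notypeclasses refine (isdX _ _)
  | |- is_derive _ _ (fun s => _ * _) _ => notypeclasses refine (isdM _ _)
  | |- is_derive _ _ (fun s => _^-1) _ => notypeclasses refine (isdV _ _)
  | |- is_derive _ _ (fun s => sin _) _ => notypeclasses refine (isd_sin _)
  | |- is_derive _ _ (fun s => cos _) _ => notypeclasses refine (isd_cos _)
  | |- is_derive _ _ (fun s => _.[_]) _ => notypeclasses refine (isd_horner _ _)
  | |- _ => match goal with
    | H : context [is_derive _ _ ?F _] |- is_derive _ _ (fun u => ?F (@?a u)) _ =>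
      notypeclasses refine (isd_comp (H _) _)
    | H : context [is_derive _ _ ?F _] |- is_derive _ _ ?F _ => notypeclasses refine (H _)
    end
  end ].
(* Differentiates an expression; the value of the derivative is left to check. *)
Ltac isd := notypeclasses refine (isd_eq _ _); [repeat isd1 | try rewrite /id; rewrite /=].

(** * Integrals of continuous functions over a segment *)

Section Integral.
Context {R : realType}.
Implicit Types (f g : R -> R) (a b c x C : R).

(** All the integrands are continuous and all the domains are segments, so
    integrability never has to be carried along. *)
Definition RI a b f : R := Rintegral lebesgue_measure `[a, b] f.

Lemma RI_integrable a b f : continuous f ->
  lebesgue_measure.-integrable `[a, b] (EFin \o f).
Proof.
move=> cf; apply: continuous_compact_integrable; first exact: segment_compact.
exact: continuous_subspaceT.
Qed.

Let mI a b : measurable (`[a, b] : set R).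
Proof. exact: measurable_itv. Qed.

Lemma RI_eq a b f g : (forall t, a <= t <= b -> f t = g t) -> RI a b f = RI a b g.
Proof.
move=> h; apply: eq_Rintegral => t; rewrite inE /= in_itv /=; exact: h.
Qed.

Lemma RID a b f g : continuous f -> continuous g ->
  RI a b (fun t => f t + g t) = RI a b f + RI a b g.
Proof. by move=> cf cg; rewrite /RI RintegralD //; exact: RI_integrable. Qed.

Lemma RIB a b f g : continuous f -> continuous g ->
  RI a b (fun t => f t - g t) = RI a b f - RI a b g.
Proof. by move=> cf cg; rewrite /RI RintegralB //; exact: RI_integrable. Qed.

Lemma RIZ a b c f : continuous f -> RI a b (fun t => c * f t) = c * RI a b f.
Proof. by move=> cf; rewrite /RI RintegralZl //; exact: RI_integrable. Qed.

Lemma RIC a b c : a <= b -> RI a b (fun _ => c) = c * (b - a).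
Proof.
rewrite le_eqVlt => /predU1P[->|ab].
  by rewrite /RI set_itv1 Rintegral_set1 subrr mulr0.
rewrite /RI Rintegral_cst //.
by rewrite /= lebesgue_measure_itv /= lte_fin ab -EFinD.
Qed.

Lemma RI_le a b f g : continuous f -> continuous g ->
  (forall t, a <= t <= b -> f t <= g t) -> RI a b f <= RI a b g.
Proof.
move=> cf cg h; apply: le_Rintegral; [exact: mI|exact: RI_integrable|exact: RI_integrable|].
by move=> t; rewrite /= in_itv /=; exact: h.
Qed.

Lemma RI_ge0 a b f : (forall t, a <= t <= b -> 0 <= f t) -> 0 <= RI a b f.
Proof. by move=> h; apply: Rintegral_ge0 => t; rewrite /= in_itv /=; exact: h. Qed.

Lemma RI_norm a b f : continuous f -> `|RI a b f| <= RI a b (fun t => `|f t|).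
Proof. by move=> cf; apply: le_normr_Rintegral => //; exact: RI_integrable. Qed.

Lemma RI_bound a b C f : a <= b -> continuous f ->
  (forall t, a <= t <= b -> `|f t| <= C) -> `|RI a b f| <= C * (b - a).
Proof.
move=> ab cf h; apply: (le_trans (RI_norm a b cf)); rewrite -RIC //.
by apply: RI_le => //; cont.
Qed.

Lemma RI_split a b c f : continuous f -> a <= b -> b <= c ->
  RI a c f = RI a b f + RI b c f.
Proof.
move=> cf ab bc; rewrite /RI -(Rintegral_itv_obnd_cbnd (r := b)); last first.
  apply: integrableS (RI_integrable b c cf) => //.
  exact: subset_itv_oc_cc.
rewrite -(@Rintegral_itvB _ f (BLeft a) (BRight c) b) ?bnd_simp //.
  by rewrite addrC subrK.
exact: RI_integrable.
Qed.

(** The primitive starts at [a], strictly below the points where it is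
    differentiated, so that it is differentiable at the ends of [b, c] too. *)
Lemma RI_primitive f a : continuous f -> exists F,
  (forall x, a < x -> isd x F (f x)) /\ forall b c, a < b -> b <= c -> RI b c f = F c - F b.
Proof.
move=> cf; exists (fun x => RI a x f); split.
  move=> x ax; have xx1 : x < x + 1 by rewrite ltrDl.
  have [d e] := continuous_FTC1_closed xx1 (RI_integrable a (x + 1) cf) ax (cf x).
  by apply: (DeriveDef d); rewrite -derive1E; exact: e.
by move=> b c ab bc; rewrite (RI_split (b := b) cf (ltW ab) bc) addrAC subrr add0r.
Qed.

Lemma RI_derive f a x : continuous f -> a < x -> isd x (fun y => RI a y f) (f x).
Proof.
move=> cf ax; have xx1 : x < x + 1 by rewrite ltrDl.
have [d e] := continuous_FTC1_closed xx1 (RI_integrable a (x + 1) cf) ax (cf x).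
by apply: (DeriveDef d); rewrite -derive1E; exact: e.
Qed.

Lemma constant_diff (f g h : R -> R) a b : a <= b ->
  (forall x, a <= x <= b -> isd x f (h x)) ->
  (forall x, a <= x <= b -> isd x g (h x)) -> f b - f a = g b - g a.
Proof.
move=> ab df dg.
have d x : a <= x <= b -> isd x (fun y => f y - g y) 0.
  by move=> xab; isd; [exact: df|exact: dg|rewrite subrr].
have [||c _] := @MVT_segment R (fun y => f y - g y) (fun _ => 0) a b ab.
- by move=> x /[!in_itv] /= /andP[ax xb]; apply: d; rewrite !ltW.
- apply: derivable_within_continuous => x; rewrite in_itv /= => /d [].
  by [].
by rewrite mul0r => /eqP; rewrite subr_eq0 => /eqP e; lra.
Qed.

Lemma RI_FTC f F a b : a <= b -> continuous f ->
  (forall x, a <= x <= b -> isd x F (f x)) -> RI a b f = F b - F a.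
Proof.
move=> ab cf dF.
have [G [dG ->]] := RI_primitive (a - 1) cf; [|lra|by []].
by apply: (constant_diff (h := f)) => // x /andP[ax xb]; apply: dG; lra.
Qed.
End Integral.

(** * Integrals depending on a parameter *)

Section ParameterIntegral.
Context {R : realType}.
Implicit Types (a b c d s x : R).

Lemma near_uniform (U : topologicalType) (f : U -> R -> R) (u0 : U) a b (e : R) :
  continuous (fun z : U * R => f z.1 z.2) -> 0 < e ->
  \forall u \near u0, forall t, a <= t <= b -> `|f u0 t - f u t| < e.
Proof.
move=> cf e0.
have e2 : 0 < e / 2 by rewrite divr_gt0.
have H : forall t, `[a, b]%classic t ->
    \forall t' \near t & u \near u0, `|f u0 t' - f u t'| < e.
  move=> t _.
  have /cvgrPdist_lt/(_ _ e2) := cf (u0, t); case=> -[A B] /= [nA nB] AB.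
  exists (B, A) => // -[t' u] /= [Bt' Au].
  have := AB (u, t') (conj Au Bt').
  have := AB (u0, t') (conj (nbhs_singleton nA) Bt').
  move=> /= h1 h2; rewrite (splitr e).
  rewrite (_ : _ - _ = (f u0 t - f u t') - (f u0 t - f u0 t')); last by ring.
  by rewrite (le_lt_trans (ler_normB _ _)) // ltrD.
have /compact_near_coveringP cab := @segment_compact R a b.
have := cab U (nbhs u0) (fun u t => `|f u0 t - f u t| < e) (nbhs_filter u0) H.
apply: filterS => u h t tab.
by apply: h; rewrite /= in_itv.
Qed.

Lemma RI_cont (U : topologicalType) (f : U -> R -> R) a b :
  continuous (fun z : U * R => f z.1 z.2) -> a <= b ->
  continuous (fun u => RI a b (f u)).
Proof.
move=> cf ab u0; apply/cvgrPdist_le => e e0.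
have cfu u : continuous (f u).
  exact: cont_curry cf.
have ba : 0 < b - a + 1 by lra.
have e1 : 0 < e / (b - a + 1) by rewrite divr_gt0.
have := near_uniform u0 a b cf e1; apply: filterS => u h.
rewrite -RIB; [|exact: cfu|exact: cfu].
apply: (le_trans (RI_bound (C := e / (b - a + 1)) ab _ _)).
- by apply: contD; [exact: cfu|apply: contN; exact: cfu].
- by move=> t /h /ltW.
- by rewrite mulrAC ler_pdivrMr // ler_pM2l //; lra.
Qed.

(** By the mean value theorem the difference quotient at a time t is a value of
    D at a nearby parameter, and [near_uniform] makes nearby uniform in t.  The
    integrand is regular only for parameters in ]lo, hi[, as is the case for
    an integral over a moving segment, to which [RI_swap] applies this. *)
Lemma RI_diff (F D : R -> R -> R) a b lo hi s : a <= b -> lo < s < hi ->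
  (forall s, lo < s < hi -> continuous (F s)) ->
  continuous (fun z : R * R => D z.1 z.2) ->
  (forall s t, lo < s < hi -> isd s (fun s => F s t) (D s t)) ->
  isd s (fun s => RI a b (F s)) (RI a b (D s)).
Proof.
move=> ab /andP[ls sh] cF cD dF.
have cDs u : continuous (D u) by exact: cont_curry cD.
suff h : h^-1 *: (RI a b (F (h *: 1 + s)) - RI a b (F s)) @[h --> 0^'] --> RI a b (D s).
  by split; [apply/cvg_ex; exists (RI a b (D s))|exact/cvg_lim].
apply/cvgrPdist_le => e e0.
have ba : 0 < b - a + 1 by lra.
have e1 : 0 < e / (b - a + 1) by rewrite divr_gt0.
have /nbhs_ballP[r /= r0 hr] := near_uniform s a b cD e1.
near=> h.
have h0 : h != 0 by near: h; exact: nbhs_dnbhs_neq.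
have hr' : `|h| < r by near: h; apply: dnbhs0_lt.
have hlo : `|h| < s - lo by near: h; apply: dnbhs0_lt; rewrite subr_gt0.
have hhi : `|h| < hi - s by near: h; apply: dnbhs0_lt; rewrite subr_gt0.
have cFs : continuous (F s) by apply: cF; rewrite ls.
have cFh : continuous (F (h + s)).
  by apply: cF; move: hlo hhi; rewrite !ltr_norml; lra.
rewrite /GRing.scale /= mulr1.
have hn : 0 < `|h| by rewrite normr_gt0.
rewrite -(ler_pM2l hn) -normrM mulrBr mulrA divff // mul1r -RIZ // -RIB //.
rewrite -RIB; last 2 first.
- by cont.
- by apply: contD => //; apply: contN.
apply: (le_trans (RI_bound (C := `|h| * (e / (b - a + 1))) ab _ _)).
- by cont.
- move=> t tab; rewrite distrC.
  have key u v : lo < u -> v < hi -> s - r < u -> v < s + r -> u <= s <= v -> u < v ->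
      `|F v t - F u t - (v - u) * D s t| <= (v - u) * (e / (b - a + 1)).
    move=> lu vh ru vr /andP[us sv] uv.
    have [||c] := @MVT R (fun s => F s t) (fun s => D s t) u v uv.
    + by move=> x /[!in_itv] /= /andP[ux xv]; apply: dF; lra.
    + apply: derivable_within_continuous => x /[!in_itv] /= /andP[ux xv].
      by have [|] := dF x t; first lra.
    rewrite in_itv /= => /andP[uc cv] ->.
    rewrite mulrC -mulrBr normrM ger0_norm ?subr_ge0 ?(ltW uv) //.
    rewrite ler_pM2l ?subr_gt0 // distrC ltW // hr // /ball /= ltr_norml.
    by apply/andP; split; lra.
  have [hp|hp|h1] := ltgtP h 0; last by rewrite h1 eqxx in h0.
  + move: hr' hlo hhi; rewrite ltr0_norm // => hr' hlo hhi.
    rewrite (_ : F (h + s) t - F s t - h * D s t =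
      - (F s t - F (h + s) t - (s - (h + s)) * D s t)); last by ring.
    rewrite normrN (_ : - h = s - (h + s)); last by ring.
    by apply: key; lra.
  + move: hr' hlo hhi; rewrite gtr0_norm // => hr' hlo hhi.
    rewrite (_ : F (h + s) t - F s t - h * D s t =
      F (h + s) t - F s t - (h + s - s) * D s t); last by ring.
    rewrite {3}(_ : h = h + s - s); last by ring.
    by apply: key; lra.
- rewrite -mulrA ler_pM2l // mulrAC ler_pdivrMr // ler_pM2l //; lra.
Unshelve. all: by end_near. Qed.

Lemma RI_swap (f : R -> R -> R) a b c d : a <= b -> c <= d ->
  continuous (fun z : R * R => f z.1 z.2) ->
  RI a b (fun s => RI c d (f s)) = RI c d (fun t => RI a b (fun s => f s t)).
Proof.
move=> ab cd cf.
have cfs s : continuous (f s) by exact: cont_curry cf.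
have cft t : continuous (fun s => f s t) by exact: cont_curry_r cf.
(* Both sides are functions of the upper bound [b] with the same derivative. *)
have [F [dF eF]] := RI_primitive (a - 1) (RI_cont cf cd).
pose g x t := RI (a - 1) x (fun s => f s t).
have cg x : a - 1 < x -> continuous (g x).
  move=> ax; apply: (@RI_cont _ (fun t s => f s t)); last exact: ltW.
  by apply: (cont_comp2 cf); cont.
have dg x : a <= x <= b -> isd x (fun x => RI c d (g x)) (RI c d (f x)).
  move=> /andP[ax xb]; apply: (@RI_diff _ _ _ _ (a - 1) (b + 1)) => //; first lra.
  - by move=> s /andP[? _]; exact: cg.
  - by move=> s t /andP[? _]; exact: RI_derive.
rewrite eF ?gtrBl //.
rewrite (constant_diff (h := fun x => RI c d (f x)) ab _ dg); last first.
  by move=> x /andP[ax _]; apply: dF; lra.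
rewrite -RIB; [|by apply: cg; lra|by apply: cg; lra].
apply: RI_eq => t _; rewrite /g (RI_split (b := a) (c := b)) //; try lra.
Qed.

Lemma RI_gt0 (f : R -> R) a b c : a < b -> continuous f ->
  (forall t, a <= t <= b -> 0 <= f t) -> a <= c <= b -> 0 < f c -> 0 < RI a b f.
Proof.
move=> ab cf f0 /andP[ac cb] fc.
have /cvgrPdist_lt/(_ (f c / 2)) := cf c; rewrite divr_gt0 // => /(_ isT).
move=> /nbhs_ballP[r /= r0 hr].
have [u [v [au uv vb uvP]]] : exists u v, [/\ a <= u, u < v, v <= b &
    forall t, u <= t <= v -> f c / 2 <= f t].
  have H u v : c - r < u -> v < c + r -> forall t, u <= t <= v -> f c / 2 <= f t.
    move=> h1 h2 t /andP[ut tv].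
    have := hr t; rewrite /ball /= !ltr_norml => /(_ _); lra.
  have [cb'|bc'] := ltP c b.
    exists c, (Num.min b (c + r / 2)); split => //.
    - by rewrite lt_min cb' /=; lra.
    - by rewrite ge_min lexx.
    - apply: H; first lra.
      by rewrite gt_min; apply/orP; right; lra.
  exists (Num.max a (c - r / 2)), c; split => //.
  - by rewrite le_max lexx.
  - by rewrite gt_max; apply/andP; split; lra.
  - apply: H; last lra.
    by rewrite lt_max; apply/orP; right; lra.
rewrite (RI_split (b := u) cf) //; try lra.
rewrite (RI_split (b := v) (a := u) cf) //; try lra.
have h1 : 0 <= RI a u f by apply: RI_ge0 => t ?; apply: f0; lra.
have h2 : 0 <= RI v b f by apply: RI_ge0 => t ?; apply: f0; lra.
have h3 : f c / 2 * (v - u) <= RI u v f.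
  by rewrite -RIC ?(ltW uv) //; apply: RI_le => //; cont.
have h4 : 0 < f c / 2 * (v - u) by rewrite mulr_gt0 ?divr_gt0 ?subr_gt0.
lra.
Qed.
End ParameterIntegral.

(** * Bounds on compact sets and the mean value inequality *)

Section Bounds.
Context {R : realType}.
Implicit Types (a b c : R) (f : R -> R).

Lemma segment_bounded f a b : continuous f ->
  exists2 B, 0 < B & forall t, a <= t <= b -> `|f t| <= B.
Proof.
move=> cf; have [ab|ba] := leP a b; last by exists 1 => // t; lra.
have [|c _ h] := @EVT_max R (fun t => `|f t|) a b ab.
  by apply: continuous_subspaceT; cont.
exists (`|f c| + 1) => [|t tab]; first by rewrite ltr_wpDl.
by rewrite (le_trans (h t _)) ?in_itv // lerDl.
Qed.

Lemma segment_min f a b : a <= b -> continuous f -> (forall t, a <= t <= b -> 0 < f t) ->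
  exists2 c, 0 < c & forall t, a <= t <= b -> c <= f t.
Proof.
move=> ab cf f0.
have [|c cab h] := @EVT_min R f a b ab; first exact: continuous_subspaceT.
by exists (f c) => [|t tab]; [apply: f0; rewrite in_itv in cab|apply: h; rewrite in_itv].
Qed.

Lemma square_bounded (f : R -> R -> R) c : continuous (fun z : R * R => f z.1 z.2) ->
  exists2 B, 0 < B & forall a b, `|a| <= c -> `|b| <= c -> `|f a b| <= B.
Proof.
move=> cf.
have cI := @segment_compact R (- c) c.
have cK : compact ([set z : R * R | `[- c, c]%classic z.1 /\ `[- c, c]%classic z.2]).
  exact: compact_setX.
have cg : {within [set z : R * R | `[- c, c]%classic z.1 /\ `[- c, c]%classic z.2],
    continuous (fun z : R * R => f z.1 z.2)} by exact: continuous_subspaceT.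
have [M [Mr hM]] := compact_bounded (continuous_compact cg cK).
exists (`|M| + 1) => [|a b ha hb]; first by rewrite ltr_wpDl.
apply: (hM (`|M| + 1)); first by rewrite (le_lt_trans (ler_norm _)) // ltrDl.
by exists (a, b) => //=; rewrite !in_itv /= -!ler_norml.
Qed.

Lemma mvt_bound f (df : R -> R) a b C : a <= b -> (forall t : R, isd t f (df t)) ->
  (forall t, a <= t <= b -> `|df t| <= C) -> `|f b - f a| <= C * (b - a).
Proof.
move=> ab hd hC.
have [|c cab ->] := @MVT_segment R f df a b ab (fun x _ => hd x).
  by apply: continuous_subspaceT; apply: isd_cont => x; exists (df x).
by rewrite normrM [X in _ * X]ger0_norm ?subr_ge0 // ler_wpM2r ?subr_ge0 // hC.
Qed.

Lemma mvt_lower f (df : R -> R) a b C : a <= b -> (forall t : R, isd t f (df t)) ->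
  (forall t, a <= t <= b -> C <= df t) -> C * (b - a) <= f b - f a.
Proof.
move=> ab hd hC.
have [|c cab ->] := @MVT_segment R f df a b ab (fun x _ => hd x).
  by apply: continuous_subspaceT; apply: isd_cont => x; exists (df x).
by rewrite ler_wpM2r ?subr_ge0 // hC.
Qed.
End Bounds.

(** * The regularized winding number of a closed curve *)

Section Winding.
Context {R : realType}.
Variables (x y u v : R -> R) (T B : R).
Hypotheses (T0 : 0 < T) (B0 : 0 < B).
Hypotheses (dx : forall t : R, isd t x (u t)) (dy : forall t : R, isd t y (v t)).
Hypotheses (cu : continuous u) (cv : continuous v).
Hypotheses (xT : x T = x 0) (yT : y T = y 0).
Hypothesis Bu : forall t : R, 0 <= t <= T -> `|u t| <= B /\ `|v t| <= B.
Implicit Types (e a b eta t : R).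

Definition dist2 a b t : R := (x t - a) ^+ 2 + (y t - b) ^+ 2.

(** For [e = 0] this is 2 pi times the winding number of the curve around
    (a, b); a positive [e] makes it a smooth function of (a, b) on the whole
    plane, with gradient (wind_x, wind_y) by [wind_chain]. *)
Definition wind e a b : R :=
  RI 0 T (fun t => ((x t - a) * v t - (y t - b) * u t) / (dist2 a b t + e)).

Definition wind_x e a b : R := - (2 * e) * RI 0 T (fun t => v t / (dist2 a b t + e) ^+ 2).
Definition wind_y e a b : R := 2 * e * RI 0 T (fun t => u t / (dist2 a b t + e) ^+ 2).

Let cx : continuous x. Proof. by apply: isd_cont => t; exists (u t). Qed.
Let cy : continuous y. Proof. by apply: isd_cont => t; exists (v t). Qed.

Lemma dist2_ge0 a b t : 0 <= dist2 a b t.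
Proof. by rewrite addr_ge0 ?sqr_ge0. Qed.

Lemma dist2_cont : continuous (fun z : (R * R) * R => dist2 z.1.1 z.1.2 z.2).
Proof. by rewrite /dist2; cont. Qed.

Lemma dist2_cont_t a b : continuous (dist2 a b).
Proof. by rewrite /dist2; cont. Qed.

Let den_neq0 e a b t : 0 < e -> dist2 a b t + e != 0.
Proof. by move=> e0; rewrite gt_eqF // ltr_wpDl // dist2_ge0. Qed.

Lemma wind_x_cont e : 0 < e -> continuous (fun z : R * R => wind_x e z.1 z.2).
Proof.
move=> e0; apply: contM; first by cont.
apply: (@RI_cont R _ (fun z t => v t / (dist2 z.1 z.2 t + e) ^+ 2)); last exact: ltW.
apply: contM; first by cont.
apply: contV => [z|]; first by rewrite expf_neq0 // den_neq0.
by cont; exact: dist2_cont.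
Qed.

Lemma wind_y_cont e : 0 < e -> continuous (fun z : R * R => wind_y e z.1 z.2).
Proof.
move=> e0; apply: contM; first by cont.
apply: (@RI_cont R _ (fun z t => u t / (dist2 z.1 z.2 t + e) ^+ 2)); last exact: ltW.
apply: contM; first by cont.
apply: contV => [z|]; first by rewrite expf_neq0 // den_neq0.
by cont; exact: dist2_cont.
Qed.

Lemma wind_cont e : 0 < e -> continuous (fun z : R * R => wind e z.1 z.2).
Proof.
move=> e0.
apply: (@RI_cont R _ (fun z t => ((x t - z.1) * v t - (y t - z.2) * u t) /
   (dist2 z.1 z.2 t + e))); last exact: ltW.
apply: contM; first by cont.
apply: contV => [z|]; first exact: den_neq0.
by cont; exact: dist2_cont.
Qed.

(** Differentiating under the integral gives, up to the time derivative of
    (a' (y - b) - b' (x - a)) / (dist2 + e), which integrates to 0 over the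
    closed curve, an integrand that carries the factor [e].  So the winding
    number is constant off the curve, and its regularization varies only near
    the curve. *)
Lemma wind_chain e (a b a' b' : R -> R) (s : R) : 0 < e ->
  (forall s : R, isd s a (a' s)) -> (forall s : R, isd s b (b' s)) ->
  continuous a' -> continuous b' ->
  isd s (fun s => wind e (a s) (b s))
    (wind_x e (a s) (b s) * a' s + wind_y e (a s) (b s) * b' s).
Proof.
move=> e0 da db ca' cb'.
have ca : continuous a by apply: isd_cont => t; exists (a' t).
have cb : continuous b by apply: isd_cont => t; exists (b' t).
have cd : continuous (fun z : R * R => dist2 (a z.1) (b z.1) z.2) by rewrite /dist2; cont.
pose D s t := ((- a' s * v t + b' s * u t) * (dist2 (a s) (b s) t + e) +
  ((x t - a s) * v t - (y t - b s) * u t) *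
    (2 * ((x t - a s) * a' s + (y t - b s) * b' s))) / (dist2 (a s) (b s) t + e) ^+ 2.
have cD : continuous (fun z : R * R => D z.1 z.2).
  apply: contM; first by cont.
  apply: contV => [z|]; first by rewrite expf_neq0 // den_neq0.
  by cont.
have dD (s' t : R) : isd s' (fun s => ((x t - a s) * v t - (y t - b s) * u t) /
    (dist2 (a s) (b s) t + e)) (D s' t).
  have := den_neq0 (a s') (b s') t e0; rewrite /D /dist2 => d0.
  by isd; field.
have sI : s - 1 < s < s + 1 by lra.
apply: isd_eq.
  apply: (@RI_diff R _ D 0 T (s - 1) (s + 1) s (ltW T0) sI _ cD) => // s' _.
  apply: contM; first by cont.
  by apply: contV => [z|]; [exact: den_neq0|cont; exact: dist2_cont_t].
pose E t := (a' s * (y t - b s) - b' s * (x t - a s)) / (dist2 (a s) (b s) t + e).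
pose dE t := ((a' s * v t - b' s * u t) * (dist2 (a s) (b s) t + e) -
  (a' s * (y t - b s) - b' s * (x t - a s)) *
   (2 * ((x t - a s) * u t + (y t - b s) * v t))) / (dist2 (a s) (b s) t + e) ^+ 2.
have hE (t : R) : isd t E (dE t).
  have := den_neq0 (a s) (b s) t e0; rewrite /E /dE /dist2 => d0.
  by isd; field.
have ci (f : R -> R) : continuous f ->
    continuous (fun t => f t / (dist2 (a s) (b s) t + e) ^+ 2).
  move=> cf; apply: contM => //.
  apply: contV => [z|]; first by rewrite expf_neq0 // den_neq0.
  by cont; exact: dist2_cont_t.
have cdE : continuous dE by apply: ci; cont; exact: dist2_cont_t.
have iE : RI 0 T dE = 0.
  by rewrite (RI_FTC (F := E)) ?(ltW T0) // /E /dist2 xT yT subrr.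
rewrite /wind_x /wind_y.
have -> : - (2 * e) * RI 0 T (fun t => v t / (dist2 (a s) (b s) t + e) ^+ 2) * a' s +
   2 * e * RI 0 T (fun t => u t / (dist2 (a s) (b s) t + e) ^+ 2) * b' s =
  (- (2 * e) * a' s) * RI 0 T (fun t => v t / (dist2 (a s) (b s) t + e) ^+ 2) +
  (2 * e * b' s) * RI 0 T (fun t => u t / (dist2 (a s) (b s) t + e) ^+ 2) + RI 0 T dE.
  by rewrite iE; ring.
have cuu := ci _ cu; have cvv := ci _ cv.
rewrite -!RIZ // -!RID //; try by cont.
apply: RI_eq => t _; rewrite /D /dE.
have := den_neq0 (a s) (b s) t e0; rewrite /dist2 => d0.
by field.
Qed.

Lemma wind_grad_bound e a b eta : 0 < e -> 0 < eta ->
  (forall t, 0 <= t <= T -> eta <= dist2 a b t) ->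
  `|wind_x e a b| <= 2 * e * B * T / eta ^+ 2 /\ `|wind_y e a b| <= 2 * e * B * T / eta ^+ 2.
Proof.
move=> e0 eta0 h.
have key (f : R -> R) : continuous f -> (forall t, 0 <= t <= T -> `|f t| <= B) ->
    `|2 * e * RI 0 T (fun t => f t / (dist2 a b t + e) ^+ 2)| <= 2 * e * B * T / eta ^+ 2.
  move=> cf fB; rewrite normrM ger0_norm; last by lra.
  have -> : 2 * e * B * T / eta ^+ 2 = 2 * e * (B / eta ^+ 2 * (T - 0)).
    by field; rewrite gt_eqF.
  rewrite ler_pM2l; last by lra.
  apply: RI_bound; first exact: ltW.
    apply: contM => //; apply: contV => [z|]; first by rewrite expf_neq0 // den_neq0.
    by cont; exact: dist2_cont_t.
  move=> t tT; rewrite normrM normfV [X in _ / X]ger0_norm ?sqr_ge0 //.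
  apply: ler_pM; rewrite ?fB ?invr_ge0 ?sqr_ge0 //.
  rewrite lef_pV2 ?posrE ?exprn_gt0 ?ltr_wpDl ?dist2_ge0 //.
  have le_eta : eta <= dist2 a b t + e by have := h t tT; lra.
  by rewrite ler_pXn2r // nnegrE ltW // (lt_le_trans eta0).
rewrite /wind_x mulNr normrN; split; apply: key => // t /Bu; by case.
Qed.

Lemma wind_segment e a b a1 b1 eta : 0 < e -> 0 < eta ->
  (forall s t, 0 <= s <= 1 -> 0 <= t <= T ->
     eta <= dist2 (a + s * (a1 - a)) (b + s * (b1 - b)) t) ->
  `|wind e a1 b1 - wind e a b| <= 2 * e * B * T / eta ^+ 2 * (`|a1 - a| + `|b1 - b|).
Proof.
move=> e0 eta0 h.
have hd (s : R) : isd s (fun s => wind e (a + s * (a1 - a)) (b + s * (b1 - b)))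
   (wind_x e (a + s * (a1 - a)) (b + s * (b1 - b)) * (a1 - a) +
    wind_y e (a + s * (a1 - a)) (b + s * (b1 - b)) * (b1 - b)).
  by apply: (@wind_chain e _ _ (fun _ => a1 - a) (fun _ => b1 - b) s) => // => [s'|s'||];
    [isd; ring|isd; ring|cont|cont].
have := mvt_bound (C := 2 * e * B * T / eta ^+ 2 * (`|a1 - a| + `|b1 - b|)) ler01 hd.
rewrite !mul1r !mul0r !addr0 subr0 mulr1 [a + _]addrC [b + _]addrC !subrK; apply => s s01.
have [h1 h2] := wind_grad_bound e0 eta0 (fun t => h s t s01).
apply: (le_trans (ler_normD _ _)); rewrite [leRHS]mulrDr.
by apply: lerD; rewrite normrM ler_wpM2r.
Qed.

Lemma wind_limit e a b eta : 0 <= e -> 0 < eta -> (forall t, eta <= dist2 a b t) ->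
  `|wind e a b - wind 0 a b| <=
     e * (RI 0 T (fun t => `|(x t - a) * v t - (y t - b) * u t|) / eta ^+ 2).
Proof.
move=> e0 eta0 h.
have hp e' t : 0 <= e' -> 0 < dist2 a b t + e' by move=> ?; have := h t; lra.
have cN : continuous (fun t => (x t - a) * v t - (y t - b) * u t) by cont.
have cW e' : 0 <= e' ->
    continuous (fun t => ((x t - a) * v t - (y t - b) * u t) / (dist2 a b t + e')).
  move=> e'0; apply: contM => //; apply: contV => [t|]; first by rewrite gt_eqF // hp.
  by cont; exact: dist2_cont_t.
rewrite /wind -RIB; [|exact: cW|exact: cW].
apply: (le_trans (RI_norm _ _ _)).
  by apply: contD; [|apply: contN]; exact: cW.
rewrite mulrCA mulrC -RIZ; last by cont.
apply: RI_le.
- by apply: cont_norm; apply: contD; [|apply: contN]; exact: cW.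
- by cont.
move=> t _; have h0 := hp 0 t (lexx _); have h1 := hp e t e0; rewrite addr0 in h0.
have -> : ((x t - a) * v t - (y t - b) * u t) / (dist2 a b t + e) -
    ((x t - a) * v t - (y t - b) * u t) / (dist2 a b t + 0) =
   - (e / ((dist2 a b t + e) * dist2 a b t)) * ((x t - a) * v t - (y t - b) * u t).
  by rewrite addr0; field; rewrite !gt_eqF.
rewrite normrM normrN [`|e / _|]ger0_norm; last by rewrite divr_ge0 ?mulr_ge0 // ltW.
rewrite ler_wpM2r // ler_wpM2l // lef_pV2 ?posrE ?exprn_gt0 ?mulr_gt0 //.
by rewrite expr2; apply: ler_pM; rewrite ?(ltW eta0) ?h // ler_wpDr // h.
Qed.

Lemma wind_far e a b L : 0 < e -> 0 < L -> (forall t, 0 <= t <= T -> L ^+ 2 <= dist2 a b t) ->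
  `|wind e a b| <= 2 * B * T / L.
Proof.
move=> e0 L0 h.
have -> : 2 * B * T / L = 2 * B / L * (T - 0) by rewrite subr0; field; rewrite gt_eqF.
apply: RI_bound; first exact: ltW.
  apply: contM; first by cont.
  by apply: contV => [t|]; [exact: den_neq0|cont; exact: dist2_cont_t].
move=> t tT; have [hu hv] := Bu tT; have := h t tT; rewrite /dist2.
set p := x t - a; set q := y t - b => hL.
have d0 : 0 < p ^+ 2 + q ^+ 2 + e by rewrite ltr_wpDl // addr_ge0 ?sqr_ge0.
rewrite normrM normfV [`|_ + e|]gtr0_norm // ler_pdivrMr //.
apply: (le_trans (ler_normB _ _)); rewrite !normrM.
have hp : `|p| * L <= p ^+ 2 + q ^+ 2.
  rewrite -(@ler_pXn2r _ 2) ?nnegrE ?mulr_ge0 ?addr_ge0 ?sqr_ge0 ?(ltW L0) //.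
  rewrite exprMn real_normK ?num_real //.
  have := sqr_ge0 q; have := sqr_ge0 p; nra.
have hq : `|q| * L <= p ^+ 2 + q ^+ 2.
  rewrite -(@ler_pXn2r _ 2) ?nnegrE ?mulr_ge0 ?addr_ge0 ?sqr_ge0 ?(ltW L0) //.
  rewrite exprMn real_normK ?num_real //.
  have := sqr_ge0 q; have := sqr_ge0 p; nra.
rewrite mulrAC ler_pdivlMr // mulrDl.
have e1 : `|p| * `|v t| * L <= B * (p ^+ 2 + q ^+ 2).
  by rewrite mulrAC mulrC; apply: ler_pM; rewrite ?mulr_ge0 ?(ltW L0).
have e2 : `|q| * `|u t| * L <= B * (p ^+ 2 + q ^+ 2).
  by rewrite mulrAC mulrC; apply: ler_pM; rewrite ?mulr_ge0 ?(ltW L0).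
have : 0 < B * e by rewrite mulr_gt0.
nra.
Qed.
End Winding.

(** * The jump of the winding number across the curve *)

Section RIlower.
Context {R : realType}.

Lemma RI_lower (f : R -> R) a b c d K C : a <= c -> c <= d -> d <= b -> 0 <= K ->
  continuous f -> (forall t, a <= t <= b -> - K <= f t) ->
  (forall t, c <= t <= d -> C <= f t) -> C * (d - c) - K * (b - a) <= RI a b f.
Proof.
move=> ac cd db K0 cf hK hC.
rewrite (RI_split (b := c) cf) //; try lra.
rewrite (RI_split (b := d) (a := c) cf) //; try lra.
have h1 : - K * (c - a) <= RI a c f.
  by rewrite -RIC //; apply: RI_le; [cont|by []|move=> t ?; apply: hK; lra].
have h2 : C * (d - c) <= RI c d f by rewrite -RIC //; apply: RI_le; [cont|by []|].
have h3 : - K * (b - d) <= RI d b f.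
  by rewrite -RIC //; apply: RI_le; [cont|by []|move=> t ?; apply: hK; lra].
have : 0 <= K * (d - c) by rewrite mulr_ge0 // subr_ge0.
nra.
Qed.
End RIlower.

Lemma sum_sqr_le0 {R : realType} (a b : R) : a ^+ 2 + b ^+ 2 <= 0 -> a = 0 /\ b = 0.
Proof.
have := sqr_ge0 a; have := sqr_ge0 b => hb ha h.
by split; apply/eqP; rewrite -sqrf_eq0; apply/eqP; lra.
Qed.

Section Jump.
Context {R : realType}.
Variables (x y u v : R -> R) (T B : R).
Hypotheses (T0 : 0 < T) (B0 : 0 < B).
Hypotheses (dx : forall t : R, isd t x (u t)) (dy : forall t : R, isd t y (v t)).
Hypotheses (cu : continuous u) (cv : continuous v).
Hypotheses (xT : x T = x 0) (yT : y T = y 0).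
Hypothesis Bu : forall t : R, 0 <= t <= T -> `|u t| <= B /\ `|v t| <= B.
Variable t0 : R.
Hypothesis t0T : 0 < t0 < T.
Hypothesis speed0 : 0 < u t0 ^+ 2 + v t0 ^+ 2.
Hypothesis simple : forall t, 0 <= t <= T -> x t = x t0 -> y t = y t0 -> t = t0.

Let cx : continuous x. Proof. by apply: isd_cont => t; exists (u t). Qed.
Let cy : continuous y. Proof. by apply: isd_cont => t; exists (v t). Qed.

Let q := u t0 ^+ 2 + v t0 ^+ 2.
Let g t := u t * u t0 + v t * v t0.

Lemma forward_near : exists tau, [/\ 0 < tau, 0 <= t0 - tau, t0 + tau <= T &
  forall t, t0 - tau <= t <= t0 + tau -> q / 2 <= g t].
Proof.
have cg : continuous g by rewrite /g; cont.
have gt0 : g t0 = q by rewrite /g /q; ring.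
have q0 : 0 < q := speed0.
have /cvgrPdist_lt/(_ (q / 2)) := cg t0; rewrite divr_gt0 // => /(_ isT).
move=> /nbhs_ballP[r /= r0 hr].
exists (Num.min (r / 2) (Num.min t0 (T - t0))); set tau := Num.min _ _.
have h1 : tau <= r / 2 by rewrite ge_min lexx.
have h2 : tau <= t0 by rewrite !ge_min lexx !orbT.
have h3 : tau <= T - t0 by rewrite !ge_min lexx !orbT.
split; [|lra|lra|].
  by case/andP: t0T => a b; rewrite !lt_min divr_gt0 //= a subr_gt0.
move=> t ht; have := hr t; rewrite /ball /= gt0 !ltr_norml => /(_ _); lra.
Qed.

(* The point at signed distance proportional to [s] along the normal at [t0]. *)
Let p_x s := x t0 - s * v t0.
Let p_y s := y t0 + s * u t0.

Let q0 : 0 < q := speed0.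

Let cdist s : continuous (dist2 x y (p_x s) (p_y s)).
Proof. exact: dist2_cont_t. Qed.

(** Near [t0] the component of the curve along its velocity at [t0] is strictly
    increasing, so the curve meets its normal only at [t0]. *)
Lemma tangential_inj tau t :
  (forall t, t0 - tau <= t <= t0 + tau -> q / 2 <= g t) -> t0 - tau <= t <= t0 + tau ->
  (x t - x t0) * u t0 + (y t - y t0) * v t0 = 0 -> t = t0.
Proof.
move=> hg /andP[h1 h2]; pose phi z := (x z - x t0) * u t0 + (y z - y t0) * v t0.
rewrite -/(phi t) => pt.
have dphi (z : R) : isd z phi (g z) by rewrite /phi /g; isd; ring.
have p0 : phi t0 = 0 by rewrite /phi; ring.
have pos a b : t0 - tau <= a -> a <= b -> b <= t0 + tau -> q / 2 * (b - a) <= phi b - phi a.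
  by move=> ? ab ?; apply: (mvt_lower (df := g)) => // t1 ?; apply: hg; lra.
have qq := q0; have [tt|tt] := leP t t0.
- have t0tau : t0 <= t0 + tau by lra.
  by have := pos t t0 h1 tt t0tau; rewrite p0 pt; nra.
- have t0tau : t0 - tau <= t0 by lra.
  by have := pos t0 t t0tau (ltW tt) h2; rewrite p0 pt; nra.
Qed.

Lemma away_from_t0 tau : 0 < tau -> exists2 mu, 0 < mu &
  forall t, 0 <= t <= T -> ~~ (t0 - tau <= t <= t0 + tau) -> mu <= dist2 x y (x t0) (y t0) t.
Proof.
move=> tau0; have cd0 := dist2_cont_t dx dy (a := x t0) (b := y t0).
have far_pos t : 0 <= t <= T -> t != t0 -> 0 < dist2 x y (x t0) (y t0) t.
  move=> tT; apply: contra_neqP => /negP; rewrite -leNgt /dist2 => h.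
  have [/eqP + /eqP] := sum_sqr_le0 h; rewrite !subr_eq0 => /eqP e1 /eqP e2.
  exact: simple.
have seg_min a b : 0 <= a -> b <= T -> ~~ (a <= t0 <= b) ->
    exists2 c, 0 < c & forall t, a <= t <= b -> c <= dist2 x y (x t0) (y t0) t.
  move=> a0 bT nt; have [ab|ba] := leP a b; last first.
    by exists 1 => // t /andP[h1 h2]; have := le_trans h1 h2; rewrite leNgt ba.
  apply: segment_min => // t /andP[h1 h2]; apply: far_pos.
    by rewrite (le_trans a0 h1) (le_trans h2 bT).
  by apply: contraNneq nt => <-; rewrite h1.
have [m1 m10 hm1] : exists2 c, 0 < c & forall t, 0 <= t <= t0 - tau ->
    c <= dist2 x y (x t0) (y t0) t.
  case/andP: t0T => _ /ltW h; apply: seg_min => //; last by rewrite negb_and -!ltNge; apply/orP; right; lra.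
  by rewrite (le_trans _ h) // gerBl ltW.
have [m2 m20 hm2] : exists2 c, 0 < c & forall t, t0 + tau <= t <= T ->
    c <= dist2 x y (x t0) (y t0) t.
  case/andP: t0T => /ltW h _; apply: seg_min => //; last by rewrite negb_and -!ltNge; apply/orP; left; lra.
  by rewrite addr_ge0 // ltW.
exists (Num.min m1 m2) => [|t /andP[h1 h2]]; first by rewrite lt_min m10.
rewrite negb_and -!ltNge => /orP[h|h].
- by rewrite ge_min hm1 // h1 ltW.
- by rewrite ge_min hm2 ?orbT // h2 ltW.
Qed.

(** Times close to [t0] are covered by [tangential_inj].  At the other times the
    curve stays away from the crossing point by [away_from_t0], hence from a
    piece of the normal that is short compared with that distance. *)
Lemma normal_geometry s1 tau : 0 < s1 -> 0 < tau ->
  (forall t, t0 - tau <= t <= t0 + tau -> q / 2 <= g t) ->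
  exists s mu, [/\ 0 < s <= s1, 0 < mu,
    (forall sg t, - s <= sg <= s -> 0 <= t <= T -> ~~ (t0 - tau <= t <= t0 + tau) ->
       mu <= dist2 x y (p_x sg) (p_y sg) t) &
    (forall sg t, - s <= sg <= s -> sg != 0 -> 0 <= t <= T ->
       0 < dist2 x y (p_x sg) (p_y sg) t)].
Proof.
move=> s10 tau0 hg; have qq := q0; have [mu mu0 hmu] := away_from_t0 tau0.
have [s [s0 ss1 sq]] : exists s, [/\ 0 < s, s <= s1 & s ^+ 2 * q <= mu / 4].
  pose s := Num.min s1 (Num.min 1 (mu / (4 * q))).
  have s0 : 0 < s by rewrite !lt_min s10 ltr01 divr_gt0 // mulr_gt0.
  exists s; split => //; first by rewrite ge_min lexx.
  have sle1 : s <= 1 by rewrite !ge_min lexx orbT.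
  have h : s * q <= mu / 4.
    rewrite (_ : mu / 4 = mu / (4 * q) * q); last by field; rewrite gt_eqF.
    by rewrite ler_wpM2r ?(ltW q0) // !ge_min lexx !orbT.
  have : s * (s * q) <= 1 * (s * q) by rewrite ler_wpM2r // mulr_ge0 // ltW.
  by rewrite expr2; lra.
have far sg t : - s <= sg <= s -> 0 <= t <= T -> ~~ (t0 - tau <= t <= t0 + tau) ->
    mu / 4 <= dist2 x y (p_x sg) (p_y sg) t.
  move=> /andP[sg1 sg2] tT /(hmu _ tT); rewrite /dist2 /p_x /p_y.
  have : sg ^+ 2 <= s ^+ 2 by nra.
  move=> /(ler_wpM2r (ltW qq)) => h.
  have : sg ^+ 2 * q <= mu / 4 by apply: le_trans sq.
  rewrite /q => h'.
  have := sqr_ge0 (x t - x t0 + 2 * (sg * v t0)).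
  have := sqr_ge0 (y t - y t0 - 2 * (sg * u t0)).
  nra.
have mu4 : 0 < mu / 4 by rewrite divr_gt0.
exists s, (mu / 4); split; [by rewrite s0|exact: mu4|exact: far|].
move=> sg t sgs sg0 tT; case: (boolP (t0 - tau <= t <= t0 + tau)) => tt; last first.
  by apply: (lt_le_trans mu4); exact: far.
rewrite ltNge; apply/negP => /sum_sqr_le0[e1' e2'].
have e1 : x t = p_x sg by lra.
have e2 : y t = p_y sg by lra.
have tt0 : t = t0 by apply: (tangential_inj hg tt); rewrite e1 e2 /p_x /p_y; ring.
move: e1 e2; rewrite tt0 /p_x /p_y => e1 e2.
have e3 : sg * v t0 = 0 by lra.
have e4 : sg * u t0 = 0 by lra.
have : sg ^+ 2 * q = 0.
  rewrite (_ : _ * q = (sg * v t0) ^+ 2 + (sg * u t0) ^+ 2); last by rewrite /q; ring.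
  by rewrite e3 e4 expr0n addr0.
by move/eqP; rewrite mulf_eq0 sqrf_eq0 (negbTE sg0) gt_eqF.
Qed.

(* Up to the factor [2 * e], the integrand of the derivative of the regularized
   winding number along the normal; positive near [t0]. *)
Let density e sg t := g t / (dist2 x y (p_x sg) (p_y sg) t + e) ^+ 2.

Let cg : continuous g. Proof. by rewrite /g; cont. Qed.

Let den_gt0 e sg t : 0 < e -> 0 < dist2 x y (p_x sg) (p_y sg) t + e.
Proof. by move=> e0; rewrite ltr_wpDl // dist2_ge0. Qed.

Let over_den_cont e sg (f : R -> R) : 0 < e -> continuous f ->
  continuous (fun t => f t / (dist2 x y (p_x sg) (p_y sg) t + e) ^+ 2).
Proof.
move=> e0 cf; have cd := cdist (s := sg); apply: contM => //.
by apply: contV => [z|]; [rewrite expf_neq0 // gt_eqF // den_gt0|cont].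
Qed.

Lemma wind_normal_derive e (sg : R) : 0 < e ->
  isd sg (fun sg => wind x y u v T e (p_x sg) (p_y sg)) (2 * e * RI 0 T (density e sg)).
Proof.
move=> e0; have dpx (s : R) : isd s p_x (- v t0) by rewrite /p_x; isd; ring.
have dpy (s : R) : isd s p_y (u t0) by rewrite /p_y; isd; ring.
have h := wind_chain T0 dx dy cu cv xT yT sg e0 dpx dpy (@contC R R (- v t0)) (@contC R R (u t0)).
apply: (isd_eq h); rewrite /wind_x /wind_y.
have -> (a b : R) : - (2 * e) * a * - v t0 + 2 * e * b * u t0 = 2 * e * (u t0 * b + v t0 * a).
  by ring.
have c1 := over_den_cont (sg := sg) e0 cu; have c2 := over_den_cont (sg := sg) e0 cv.
congr (_ * _); rewrite -!RIZ // -RID; [|by cont|by cont].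
apply: RI_eq => t _; rewrite /density /g; field.
by rewrite gt_eqF // den_gt0.
Qed.

Lemma density_lower tau mu G e sg t : 0 < e -> 0 < mu -> 0 < G -> `|g t| <= G ->
  (forall t, t0 - tau <= t <= t0 + tau -> q / 2 <= g t) ->
  (~~ (t0 - tau <= t <= t0 + tau) -> mu <= dist2 x y (p_x sg) (p_y sg) t) ->
  - (G / mu ^+ 2) <= density e sg t.
Proof.
move=> e0 mu0 G0 hG hg far; rewrite /density; have dp := den_gt0 sg t e0.
case: (boolP (t0 - tau <= t <= t0 + tau)) => [tt|/far h1].
  apply: (@le_trans _ _ 0); first by rewrite oppr_le0 divr_ge0 ?sqr_ge0 // ltW.
  by rewrite divr_ge0 ?sqr_ge0 // (le_trans _ (hg t tt)) // divr_ge0 // ltW // q0.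
move: hG; rewrite ler_norml => /andP[h2 _].
rewrite ler_pdivlMr ?exprn_gt0 // (le_trans _ h2) // mulNr lerN2.
rewrite mulrAC ler_pdivlMr ?exprn_gt0 // ler_pM2l // ler_pXn2r // ?nnegrE; try exact: ltW.
by rewrite (le_trans h1) // lerDl ltW.
Qed.

(* In units of [eps ^+ 2], a bound for the squared distance plus the
   regularization when the time and the position on the normal are within [eps]
   of the crossing. *)
Let A := 4 * B ^+ 2 + 2 * q + 1.

Lemma density_peak eps sg t : 0 < eps -> - eps <= sg <= eps -> t0 - eps <= t <= t0 + eps ->
  0 <= t0 - eps -> t0 + eps <= T -> q / 2 <= g t ->
  q / (2 * (A * eps ^+ 2) ^+ 2) <= density (eps ^+ 2) sg t.
Proof.
move=> eps0 /andP[sg1 sg2] /andP[tt1 tt2] e1 e2 hg; have qq := q0.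
have dB (f df : R -> R) : (forall t : R, isd t f (df t)) ->
    (forall t, 0 <= t <= T -> `|df t| <= B) -> (f t - f t0) ^+ 2 <= B ^+ 2 * eps ^+ 2.
  move=> hd hB; rewrite -exprMn -[leLHS]real_normK ?num_real //.
  rewrite ler_pXn2r ?nnegrE ?mulr_ge0 ?(ltW B0) ?(ltW eps0) //.
  have BB := B0; have [tt|/ltW tt] := leP t0 t; [|rewrite distrC];
    apply: (le_trans (mvt_bound (C := B) tt hd _)).
  - by move=> t1 /andP[? ?]; apply: hB; lra.
  - by rewrite ler_pM2l //; lra.
  - by move=> t1 /andP[? ?]; apply: hB; lra.
  - by rewrite ler_pM2l //; lra.
have hx := dB _ _ dx (fun t h => (Bu h).1).
have hy := dB _ _ dy (fun t h => (Bu h).2).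
have sg2' : sg ^+ 2 <= eps ^+ 2 by nra.
have hs : sg ^+ 2 * q <= eps ^+ 2 * q by apply: ler_wpM2r => //; exact: ltW.
have hA : dist2 x y (p_x sg) (p_y sg) t + eps ^+ 2 <= A * eps ^+ 2.
  rewrite /dist2 /p_x /p_y /A; move: hs; rewrite /q => hs.
  have := sqr_ge0 (x t - x t0 - sg * v t0).
  have := sqr_ge0 (y t - y t0 + sg * u t0).
  nra.
have eps20 : 0 < eps ^+ 2 by rewrite exprn_gt0.
have dp := den_gt0 sg t eps20.
rewrite invfM mulrA; apply: ler_pM.
- by rewrite divr_ge0 // ltW.
- by rewrite invr_ge0 sqr_ge0.
- exact: hg.
have Ae := lt_le_trans dp hA.
by rewrite lef_pV2 ?posrE ?exprn_gt0 // ler_pXn2r // nnegrE ltW.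
Qed.

(** Adds up the lower bounds for the increments of F = wind over the pieces
    [- s, - eps], [- eps, eps] and [eps, s] of the normal; the middle one
    dominates once [eps] is small compared with [q1 / (a ^+ 2 * s * K)]. *)
Lemma jump_arith (a K s eps q1 Fs Fe Fm Fn : R) : 0 < eps -> eps < 1 -> 0 < a -> 0 < s ->
  0 <= K -> eps * (2 * a ^+ 2 * s * K) <= q1 ->
  - (2 * eps ^+ 2 * K) * (- eps - - s) <= Fm - Fn ->
  2 * eps ^+ 2 * (q1 / (2 * (a * eps ^+ 2) ^+ 2) * (2 * eps) - K) * (eps - - eps) <= Fe - Fm ->
  - (2 * eps ^+ 2 * K) * (s - eps) <= Fs - Fe ->
  2 * q1 / a ^+ 2 <= Fs - Fn.
Proof.
move=> eps0 eps1 a0 s0 K0 h2 st1 st2 st3.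
have eq2 : 2 * eps ^+ 2 * (q1 / (2 * (a * eps ^+ 2) ^+ 2) * (2 * eps) - K) * (eps - - eps) =
    4 * q1 / a ^+ 2 - 2 * eps ^+ 2 * K * (2 * eps).
  by field; rewrite !gt_eqF.
rewrite eq2 in st2.
have tot : 4 * q1 / a ^+ 2 - 4 * s * K * eps ^+ 2 <= Fs - Fn by lra.
suff : 4 * s * K * eps ^+ 2 <= 2 * q1 / a ^+ 2 by rewrite -!mulrA in tot *; lra.
have h1 : eps ^+ 2 <= eps by rewrite expr2 ger_pMl // ltW.
rewrite ler_pdivlMr ?exprn_gt0 //.
have s4 : 0 <= 4 * s by rewrite mulr_ge0 // ltW.
have h3 := mulr_ge0 (mulr_ge0 s4 K0) (sqr_ge0 a).
have := ler_wpM2l h3 h1; lra.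
Qed.

(** The derivative along the normal is [2 * eps ^+ 2] times the integral of a
    density that is at least of order [eps ^- 4] on the times and positions
    within [eps] of the crossing.  Integrated over this square of area of order
    [eps ^+ 2] it gives a contribution bounded below, while the rest of the
    density is bounded below and contributes at least [- O(eps ^+ 2)]. *)
Lemma wind_jump s1 : 0 < s1 -> exists s c eta eps0,
  [/\ 0 < s <= s1, 0 < c, 0 < eta, 0 < eps0 <= 1 &
   (forall t, 0 <= t <= T ->
      eta <= dist2 x y (p_x s) (p_y s) t /\ eta <= dist2 x y (p_x (- s)) (p_y (- s)) t) /\
   forall eps, 0 < eps < eps0 ->
     c <= wind x y u v T (eps ^+ 2) (p_x s) (p_y s) -
          wind x y u v T (eps ^+ 2) (p_x (- s)) (p_y (- s))].
Proof.
move=> s10; have qq := q0; have [tau [tau0 ht1 ht2 hg]] := forward_near.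
have [s [mu [/andP[s0 ss1] mu0 far off]]] := normal_geometry s10 tau0 hg.
have cp := cdist (s := s); have cm := cdist (s := - s).
have [n1 n10 hn1] : exists2 c, 0 < c & forall t, 0 <= t <= T ->
    c <= dist2 x y (p_x s) (p_y s) t.
  apply: segment_min => [||t tT]; [exact: ltW|exact: cp|apply: off => //; last by rewrite gt_eqF].
  by lra.
have [n2 n20 hn2] : exists2 c, 0 < c & forall t, 0 <= t <= T ->
    c <= dist2 x y (p_x (- s)) (p_y (- s)) t.
  apply: segment_min => [||t tT]; [exact: ltW|exact: cm|apply: off => //].
    by lra.
  by rewrite oppr_eq0 gt_eqF.
have [G G0 hG] := segment_bounded 0 T cg.
pose K := G / mu ^+ 2 * T.
have GK0 : 0 < G / mu ^+ 2 by rewrite divr_gt0 // exprn_gt0.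
have K0 : 0 < K by rewrite mulr_gt0.
have A0 : 0 < A by rewrite /A; have := sqr_ge0 B; lra.
have D0 : 0 < 2 * A ^+ 2 * s * K.
  by do 2 (rewrite mulr_gt0 //); rewrite mulr_gt0 // exprn_gt0.
pose e0 := Num.min (Num.min 1 tau) (Num.min s (q / (2 * A ^+ 2 * s * K))).
exists s, (2 * q / A ^+ 2), (Num.min n1 n2), e0; split.
- by rewrite s0.
- by rewrite divr_gt0 ?mulr_gt0 ?exprn_gt0.
- by rewrite lt_min n10.
- by rewrite /e0 3!lt_min ltr01 tau0 s0 divr_gt0 // !ge_min lexx.
split=> [t tT|eps /andP[eps0]]; first by split; rewrite ge_min ?hn1 ?hn2 ?orbT.
rewrite 3!lt_min => /andP[/andP[eps1 epstau] /andP[epss epsK]].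
have e20 : 0 < eps ^+ 2 by rewrite exprn_gt0.
have e2p : 0 < 2 * eps ^+ 2 by rewrite mulr_gt0.
have cI sg := over_den_cont (sg := sg) e20 cg.
have low sg t : - s <= sg <= s -> 0 <= t <= T -> - (G / mu ^+ 2) <= density (eps ^+ 2) sg t.
  move=> sgs tT; apply: (density_lower e20 mu0 G0 (hG t tT) hg) => nt; exact: far.
have lowI sg : - s <= sg <= s -> - K <= RI 0 T (density (eps ^+ 2) sg).
  move=> sgs; have -> : - K = RI 0 T (fun _ => - (G / mu ^+ 2)).
    by rewrite RIC ?ltW // subr0 mulNr.
  apply: RI_le => [||t tT]; [exact: contC|exact: cI|exact: low].
have peakI sg : - eps <= sg <= eps ->
    q / (2 * (A * eps ^+ 2) ^+ 2) * (2 * eps) - K <= RI 0 T (density (eps ^+ 2) sg).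
  move=> sge; have tt : t0 - eps <= t0 + eps by lra.
  have te1 : 0 <= t0 - eps by lra.
  have te2 : t0 + eps <= T by lra.
  have := RI_lower (C := q / (2 * (A * eps ^+ 2) ^+ 2)) te1 tt te2 (ltW GK0) (cI sg).
  rewrite subr0 (_ : t0 + eps - (t0 - eps) = 2 * eps) -/K; last by ring.
  apply=> [t tT|t tt']; first by apply: low => //; lra.
  apply: density_peak => //; apply: hg.
  by lra.
have dF (sg : R) := wind_normal_derive sg e20.
apply: (jump_arith eps0 eps1 A0 s0 (ltW K0) _ (mvt_lower _ dF _) (mvt_lower _ dF _) (mvt_lower _ dF _)).
- by rewrite -ler_pdivlMr // ltW.
- by lra.
- move=> sg h; rewrite -mulrN ler_pM2l // lowI //; lra.
- by lra.
- by move=> sg h; rewrite ler_pM2l // peakI.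
- by lra.
- move=> sg h; rewrite -mulrN ler_pM2l // lowI //; lra.
Qed.
End Jump.

(** * The derivative of the regularized winding number along the field *)

Section CrossEstimate.
Context {R : realType}.
Implicit Types (e r th : R).

Lemma atan_div_derive (f : R -> R) (s l e : R) : 0 < e -> isd s f l ->
  isd s (fun s => atan (f s / e)) (l * (e / (f s ^+ 2 + e ^+ 2))).
Proof.
move=> e0 h.
have h0 : isd s (fun s => f s / e) (l / e) by isd; ring.
have h1 := isd_comp (g := fun s => f s / e) (is_derive1_atan _) h0.
apply: (isd_eq h1).
have h4 : f s ^+ 2 + e ^+ 2 != 0 by rewrite gt_eqF // ltr_wpDl ?sqr_ge0 // exprn_gt0.
have h2 : e != 0 by rewrite gt_eqF.
by field; rewrite h4 h2.
Qed.

Let cont_k (f : R -> R) e : 0 < e -> continuous f -> continuous (fun r => e / (f r ^+ 2 + e ^+ 2)).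
Proof.
move=> e0 cf; apply: contM; first by cont.
by apply: contV => [r|]; [rewrite gt_eqF // ltr_wpDl ?sqr_ge0 // exprn_gt0|cont].
Qed.

Lemma radial_integral (e a b c : R) : 0 < e -> a <= b ->
  RI a b (fun r => e / ((r - c) ^+ 2 + e ^+ 2)) <= pi.
Proof.
move=> e0 ab.
have cf : continuous (fun r => e / ((r - c) ^+ 2 + e ^+ 2)) by apply: (cont_k e0); cont.
have dF (r : R) : isd r (fun r => atan ((r - c) / e)) (e / ((r - c) ^+ 2 + e ^+ 2)).
  have h : isd r (fun r => r - c) 1 by isd; ring.
  by apply: (isd_eq (atan_div_derive e0 h)); rewrite mul1r.
rewrite (RI_FTC ab cf (fun r _ => dF r)).
by have := atan_ltpi2 ((b - c) / e); have := atan_gtNpi2 ((a - c) / e); lra.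
Qed.

(** Integrating the derivative of b' atan(b / e) over a period, where
    b = x sin - y cos, turns the weight b'^2 into a bounded quantity, and
    b^2 + b'^2 is the constant x^2 + y^2. *)
Lemma angular_integral (e x y M s0 : R) : 0 < e -> e <= 1 -> 0 < s0 -> s0 <= x ^+ 2 + y ^+ 2 ->
  `|x| + `|y| <= M ->
  RI 0 (2 * pi) (fun th => e / ((x * sin th - y * cos th) ^+ 2 + e ^+ 2)) <=
    (1 + M * pi / 2) * (2 * pi) / s0.
Proof.
move=> e0 e1 s00 hs hM; have p0 : 0 < pi :> R := pi_gt0 R.
pose b th := x * sin th - y * cos th; pose b' th := x * cos th + y * sin th.
have cb : continuous b by rewrite /b; cont.
have cb' : continuous b' by rewrite /b'; cont.
have cat : continuous (fun th => atan (b th / e)).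
  by apply: (@cont_comp _ _ _ (@atan R)); [exact: continuous_atan|cont].
have db (th : R) : isd th b (b' th) by rewrite /b /b'; isd; ring.
have db' (th : R) : isd th b' (- b th) by rewrite /b /b'; isd; ring.
pose k th := e / (b th ^+ 2 + e ^+ 2).
have ck : continuous k by exact: cont_k.
have dF (th : R) : isd th (fun th => b' th * atan (b th / e))
    (- b th * atan (b th / e) + b' th ^+ 2 * k th).
  by apply: (isd_eq (isdM (db' th) (atan_div_derive e0 (db th)))); rewrite /k; ring.
have cdF : continuous (fun th => - b th * atan (b th / e) + b' th ^+ 2 * k th) by cont.
have p2 : 0 <= 2 * pi :> R by rewrite mulr_ge0 // ltW.
have sin2 : sin (2 * pi) = 0 :> R by rewrite mulr_natl sin2pi.
have cos2 : cos (2 * pi) = 1 :> R by rewrite mulr_natl cos2pi.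
have c1 : continuous (fun th => b th * atan (b th / e)) by cont.
have c2 : continuous (fun th => b' th ^+ 2 * k th) by cont.
have I0 : RI 0 (2 * pi) (fun th => b' th ^+ 2 * k th) =
    RI 0 (2 * pi) (fun th => b th * atan (b th / e)).
  have := RI_FTC p2 cdF (fun th _ => dF th).
  rewrite /b' /b sin0 cos0 sin2 cos2 subrr.
  under eq_fun do rewrite mulNr addrC.
  by rewrite RIB // => /eqP; rewrite subr_eq0 => /eqP.
have kb th : 0 <= k th.
  by rewrite divr_ge0 ?(ltW e0) // addr_ge0 ?sqr_ge0.
have kb2 th : b th ^+ 2 * k th <= 1.
  rewrite /k mulrA ler_pdivrMr; last by rewrite ltr_wpDl ?sqr_ge0 // exprn_gt0.
  rewrite mul1r; have := sqr_ge0 (b th - e); have := sqr_ge0 (b th).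
  by have := sqr_ge0 e; nra.
have bM th : `|b th| <= M.
  rewrite (le_trans _ hM) // /b (le_trans (ler_normB _ _)) // !normrM lerD //.
  - by rewrite ler_piMr // ler_norml sin_geN1 sin_le1.
  - by rewrite ler_piMr // ler_norml cos_geN1 cos_le1.
have batan th : b th * atan (b th / e) <= M * pi / 2.
  apply: (le_trans (ler_norm _)); rewrite normrM -mulrA.
  apply: ler_pM => //; rewrite ler_norml.
  have := atan_ltpi2 (b th / e); have := atan_gtNpi2 (b th / e); lra.
rewrite ler_pdivlMr // mulrC -RIZ //.
apply: (@le_trans _ _ (RI 0 (2 * pi) (fun th => 1 + b' th ^+ 2 * k th))).
  apply: RI_le; [by cont|by cont|move=> th _].
  apply: (@le_trans _ _ ((x ^+ 2 + y ^+ 2) * k th)); first exact: (ler_wpM2r (kb th) hs).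
  rewrite (_ : x ^+ 2 + y ^+ 2 = b th ^+ 2 + b' th ^+ 2).
    by rewrite mulrDl lerD2r.
  rewrite -[LHS]mulr1 -(cos2Dsin2 th) /b /b'; ring.
rewrite RID //; last by cont.
have -> : (1 + M * pi / 2) * (2 * pi) = 1 * (2 * pi - 0) + M * pi / 2 * (2 * pi - 0) by ring.
rewrite I0 RIC // lerD2l -RIC //.
by apply: RI_le => //; cont.
Qed.

Section Field.
Variables (x y : R -> R) (T ra rb M s0 : R).
Hypotheses (T0 : 0 < T) (cx : continuous x) (cy : continuous y).
Hypotheses (rab : ra <= rb) (s00 : 0 < s0).
Hypothesis xy_far : forall t, 0 <= t <= T -> s0 <= x t ^+ 2 + y t ^+ 2.
Hypothesis xyM : forall t, 0 <= t <= T -> `|x t| + `|y t| <= M.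

(* The coordinates of the point (x t, y t) along and across the ray of angle
   [th], the radius [r] being the coordinate of the other point. *)
Let along r th t := r - (x t * cos th + y t * sin th).
Let across th t := x t * sin th - y t * cos th.

(** With rho the squared distance of the two points plus [e ^+ 2], this bounds
    [e / rho * (1 + e / rho)]: each rho is replaced by the part of it due to one
    coordinate, so that the integrals over [r] and over [th] separate. *)
Definition ray_kernel e r th t :=
  e / (along r th t ^+ 2 + e ^+ 2) * (1 + e / (across th t ^+ 2 + e ^+ 2)).

Let den_pos e (z : R) : 0 < e -> z ^+ 2 + e ^+ 2 != 0.
Proof. by move=> e0; rewrite gt_eqF // ltr_wpDl ?sqr_ge0 // exprn_gt0. Qed.

Lemma ray_kernel_cont e : 0 < e ->
  continuous (fun z : (R * R) * R => ray_kernel e z.1.1 z.1.2 z.2).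
Proof.
move=> e0; rewrite /ray_kernel /along /across.
by cont; move=> z; exact: den_pos.
Qed.

(** The bound does not depend on [e]: the radial integral of the first factor
    is at most pi, and [angular_integral] applies to what is left because the
    curve stays away from the origin. *)
Lemma triple_kernel e : 0 < e -> e <= 1 ->
  RI ra rb (fun r => RI 0 (2 * pi) (fun th => RI 0 T (ray_kernel e r th))) <=
  pi * ((2 * pi + (1 + M * pi / 2) * (2 * pi) / s0) * T).
Proof.
move=> e0 e1; have p0 : 0 < pi :> R := pi_gt0 R.
have p2 : 0 <= 2 * pi :> R by rewrite mulr_ge0 // ltW.
have ck := ray_kernel_cont e0.
have T1 := ltW T0.
rewrite (RI_swap rab p2); last first.
  by apply: (@RI_cont _ _ (fun z t => ray_kernel e z.1 z.2 t)).
pose g th t := pi * (1 + e / (across th t ^+ 2 + e ^+ 2)).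
have cg : continuous (fun z : R * R => g z.1 z.2).
  by rewrite /g /across; cont; move=> z; exact: den_pos.
have c3 : continuous (fun z : (R * R) * R => ray_kernel e z.2 z.1.1 z.1.2).
  rewrite /ray_kernel /along /across.
  by cont; move=> z; exact: den_pos.
have c4 : continuous (fun z : (R * R) * R => ray_kernel e z.2 z.1.2 z.1.1).
  rewrite /ray_kernel /along /across.
  by cont; move=> z; exact: den_pos.
have c5 : continuous (fun z : (R * R) * R => ray_kernel e z.1.2 z.1.1 z.2).
  rewrite /ray_kernel /along /across.
  by cont; move=> z; exact: den_pos.
apply: (@le_trans _ _ (RI 0 (2 * pi) (fun th => RI 0 T (g th)))).
  apply: RI_le.
  - apply: (@RI_cont _ _ (fun th r => RI 0 T (ray_kernel e r th))) => //.
    by apply: (@RI_cont _ _ (fun z t => ray_kernel e z.2 z.1 t)).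
  - exact: RI_cont.
  move=> th _; rewrite (RI_swap rab T1); last first.
    rewrite /ray_kernel /along /across.
    by cont; move=> z; exact: den_pos.
  apply: RI_le.
  - apply: (@RI_cont _ _ (fun t r => ray_kernel e r th t)) => //.
    rewrite /ray_kernel /along /across.
    by cont; move=> z; exact: den_pos.
  - exact: cont_curry cg.
  move=> t _; rewrite /g.
  have cr : continuous (fun r => e / (along r th t ^+ 2 + e ^+ 2)).
    by rewrite /along; cont; move=> z; exact: den_pos.
  have -> : RI ra rb (fun r => ray_kernel e r th t) = (1 + e / (across th t ^+ 2 + e ^+ 2)) *
      RI ra rb (fun r => e / (along r th t ^+ 2 + e ^+ 2)).
    by rewrite -RIZ //; apply: RI_eq => r _; rewrite /ray_kernel mulrC.
  rewrite mulrC; apply: ler_wpM2r; last exact: radial_integral.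
  by rewrite addr_ge0 // divr_ge0 ?(ltW e0) // addr_ge0 ?sqr_ge0.
rewrite (RI_swap p2 T1 cg).
have -> : pi * ((2 * pi + (1 + M * pi / 2) * (2 * pi) / s0) * T) =
    RI 0 T (fun _ => pi * (2 * pi + (1 + M * pi / 2) * (2 * pi) / s0)).
  by rewrite RIC // subr0 mulrA.
apply: RI_le => [||t tT].
- by apply: (@RI_cont _ _ (fun t th => g th t)) => //; rewrite /g /across; cont; move=> z; exact: den_pos.
- by cont.
rewrite /g RIZ; last by rewrite /across; cont; move=> z; exact: den_pos.
rewrite ler_pM2l // RID; [|by cont|by rewrite /across; cont; move=> z; exact: den_pos].
rewrite RIC // subr0 mul1r lerD2l.
by apply: angular_integral => //; [exact: xy_far|exact: xyM].
Qed.
End Field.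

(** Here C stands for the cross product of the values of a Lipschitz field at
    two points that differ by (d1, d2): it vanishes on the diagonal, so it is of
    the order of their distance, which is at most lam + distance^2 / lam.  The
    first term contributes lam^5 / rho^2 and the second one lam^3 / rho; their
    sum is at most lam times the kernel [ray_kernel] with parameter lam ^+ 2. *)
Lemma cross_pointwise (lam C K A1 B1 d1 d2 rho : R) : 0 < lam -> 0 <= K ->
  `|C| <= K * (`|d1| + `|d2|) ->
  rho = d1 ^+ 2 + d2 ^+ 2 + lam ^+ 4 -> d1 ^+ 2 + d2 ^+ 2 = A1 ^+ 2 + B1 ^+ 2 ->
  `|2 * lam ^+ 4 * (C / rho ^+ 2)| <= 2 * K * lam *
    (lam ^+ 2 / (A1 ^+ 2 + (lam ^+ 2) ^+ 2) * (1 + lam ^+ 2 / (B1 ^+ 2 + (lam ^+ 2) ^+ 2))).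
Proof.
move=> l0 K0 hC hrho hd.
have l4 : 0 < lam ^+ 4 by rewrite exprn_gt0.
have sA := sqr_ge0 A1; have sB := sqr_ge0 B1.
have r0 : 0 < rho by rewrite hrho hd; lra.
have -> : (lam ^+ 2) ^+ 2 = lam ^+ 4 by rewrite -exprM.
set A := A1 ^+ 2 + lam ^+ 4; set B := B1 ^+ 2 + lam ^+ 4.
have A0 : 0 < A by rewrite /A; lra.
have B0 : 0 < B by rewrite /B; lra.
have rA : A <= rho by rewrite hrho hd /A; lra.
have rB : B <= rho by rewrite hrho hd /B; lra.
have e24 : 0 < 2 * lam ^+ 4 by rewrite mulr_gt0.
rewrite normrM (gtr0_norm e24) normrM normfV (ger0_norm (sqr_ge0 rho)).
have hd12 : `|d1| + `|d2| <= lam + (d1 ^+ 2 + d2 ^+ 2) / lam.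
  rewrite -(ler_pM2r l0) [leRHS]mulrDl divfK ?gt_eqF //.
  have := sqr_ge0 (lam - 2 * `|d1|); have := sqr_ge0 (lam - 2 * `|d2|).
  rewrite -[d1 ^+ 2]real_normK ?num_real // -[d2 ^+ 2]real_normK ?num_real //.
  nra.
have h1 : `|C| <= K * (lam + rho / lam).
  apply: (le_trans hC); rewrite ler_wpM2l // (le_trans hd12) // lerD2l.
  by rewrite ler_pM2r ?invr_gt0 // hrho lerDl ltW.
apply: (@le_trans _ _ (2 * lam ^+ 4 * (K * (lam + rho / lam) / rho ^+ 2))).
  by rewrite ler_pM2l ?mulr_gt0 // ler_pM2r // invr_gt0 exprn_gt0.
have -> : 2 * lam ^+ 4 * (K * (lam + rho / lam) / rho ^+ 2) =
   2 * K * lam * (lam ^+ 2 * rho^-1 * (1 + lam ^+ 2 / rho)).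
  by field; rewrite !gt_eqF.
rewrite ler_wpM2l ?mulr_ge0 ?(ltW l0) //.
have l2 : 0 < lam ^+ 2 by rewrite exprn_gt0.
have iA : rho^-1 <= A^-1 by rewrite lef_pV2 ?posrE.
have iB : rho^-1 <= B^-1 by rewrite lef_pV2 ?posrE.
have ir : 0 < rho^-1 by rewrite invr_gt0.
have lr : 0 < lam ^+ 2 * rho^-1 by rewrite mulr_gt0.
apply: ler_pM.
- exact: ltW.
- by rewrite addr_ge0 // ltW.
- by rewrite ler_pM2l.
- by rewrite lerD2l ler_pM2l.
Qed.
End CrossEstimate.

(** * Polynomials in two variables *)

(* From here on polynomials are added and scaled. *)
Import (canonicals) mpoly.

Section Eval2.
Context {R : realType}.
Implicit Types (F P Q : bipoly R) (a b : R).

Definition d1 F := mpoly.mderiv ord0 F.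
Definition d2 F := mpoly.mderiv ord_max F.

Lemma eval2_monomial m a b :
  eval2 (mpoly.mpolyX R m) a b = a ^+ mpoly.fun_of_multinom m ord0 * b ^+ mpoly.fun_of_multinom m ord_max.
Proof.
rewrite /eval2 mpoly.mevalX big_ord_recl big_ord1 /= /tnth /=.
by congr (_ * _ ^+ mpoly.fun_of_multinom m _); apply: val_inj.
Qed.

Lemma eval2D F G a b : eval2 (F + G) a b = eval2 F a b + eval2 G a b.
Proof. exact: mpoly.mevalD. Qed.

Lemma eval2Z c F a b : eval2 (c *: F) a b = c * eval2 F a b.
Proof. exact: mpoly.mevalZ. Qed.

Lemma eval20 a b : eval2 0 a b = 0 :> R.
Proof. exact: mpoly.meval0. Qed.

Lemma eval2_cont F : continuous (fun z : R * R => eval2 F z.1 z.2).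
Proof.
elim/mpoly.mpolyind: F => [|c m F _ _ IH].
  have -> : (fun z : R * R => eval2 0 z.1 z.2) = (fun _ => 0).
    by apply/funext => z; rewrite eval20.
  by cont.
set e1 := mpoly.fun_of_multinom m ord0; set e2 := mpoly.fun_of_multinom m ord_max.
have -> : (fun z : R * R => eval2 (c *: mpoly.mpolyX R m + F) z.1 z.2) =
    (fun z => c * (z.1 ^+ e1 * z.2 ^+ e2) + eval2 F z.1 z.2).
  by apply/funext => z; rewrite eval2D eval2Z eval2_monomial.
by cont.
Qed.

Lemma eval2_chain F (f g : R -> R) (s f' g' : R) : isd s f f' -> isd s g g' ->
  isd s (fun s => eval2 F (f s) (g s))
    (eval2 (d1 F) (f s) (g s) * f' + eval2 (d2 F) (f s) (g s) * g').
Proof.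
move=> df dg; elim/mpoly.mpolyind: F => [|c m F _ _ IH].
  have -> : (fun s => eval2 0 (f s) (g s)) = (fun _ => 0).
    by apply/funext => z; rewrite eval20.
  by rewrite /d1 /d2 !mpoly.mderiv0 !eval20; isd; ring.
set e1 := mpoly.fun_of_multinom m ord0; set e2 := mpoly.fun_of_multinom m ord_max.
have -> : (fun s => eval2 (c *: mpoly.mpolyX R m + F) (f s) (g s)) =
    (fun s => c * (f s ^+ e1 * g s ^+ e2) + eval2 F (f s) (g s)).
  by apply/funext => z; rewrite eval2D eval2Z eval2_monomial.
isd.
rewrite /d1 /d2 !mpoly.mderivD !eval2D !mpoly.mderivZ !eval2Z !mpoly.mderivX !eval2Z.
rewrite !eval2_monomial !mpoly.mnmBE !mpoly.mnm1E /= subn0 !subn1.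
by rewrite subn0 -/e1 -/e2; ring.
Qed.

(** Mean value inequality along the segment between the two points, which stays
    in the square. *)
Lemma eval2_lip F c : exists2 L, 0 < L & forall a b a1 b1,
  `|a| <= c -> `|b| <= c -> `|a1| <= c -> `|b1| <= c ->
  `|eval2 F a1 b1 - eval2 F a b| <= L * (`|a1 - a| + `|b1 - b|).
Proof.
have [L1 L10 h1] := square_bounded c (eval2_cont (F := d1 F)).
have [L2 L20 h2] := square_bounded c (eval2_cont (F := d2 F)).
exists (L1 + L2) => [|a b a1 b1 ha hb ha1 hb1]; first exact: addr_gt0.
have seg (z z1 : R) s : 0 <= s <= 1 -> `|z| <= c -> `|z1| <= c -> `|z + s * (z1 - z)| <= c.
  by move=> /andP[s0 s1]; rewrite !ler_norml => /andP[? ?] /andP[? ?]; apply/andP; split; nra.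
pose f s := eval2 F (a + s * (a1 - a)) (b + s * (b1 - b)).
have df (s : R) : isd s f
    (eval2 (d1 F) (a + s * (a1 - a)) (b + s * (b1 - b)) * (a1 - a) +
     eval2 (d2 F) (a + s * (a1 - a)) (b + s * (b1 - b)) * (b1 - b)).
  by apply: eval2_chain; isd; ring.
have := mvt_bound (C := (L1 + L2) * (`|a1 - a| + `|b1 - b|)) ler01 df.
rewrite /f !mul1r !mul0r !addr0 subr0 mulr1 [a + _]addrC [b + _]addrC !subrK; apply => s s01.
apply: (le_trans (ler_normD _ _)); rewrite !normrM.
have k1 := h1 _ _ (seg _ _ _ s01 ha ha1) (seg _ _ _ s01 hb hb1).
have k2 := h2 _ _ (seg _ _ _ s01 ha ha1) (seg _ _ _ s01 hb hb1).
have n1 := normr_ge0 (a1 - a); have n2 := normr_ge0 (b1 - b).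
have := ler_wpM2r n1 k1; have := ler_wpM2r n2 k2.
nra.
Qed.
End Eval2.

(** * The divergence in polar coordinates *)

Section Polar.
Context {R : realType}.
Implicit Types (P Q : bipoly R) (w : {poly R}) (r th k : R).

Definition div2 P Q a b : R := eval2 (d1 P) a b + eval2 (d2 Q) a b.

Lemma eval2_divergence P Q a b : eval2 (divergence P Q) a b = div2 P Q a b.
Proof. exact: eval2D. Qed.

(* The function M of the criterion, extended continuously to [r = 0]. *)
Definition dulacM P Q k w r th : R :=
  polarR P Q r th * (deriv w).[r] -
  k * div2 P Q (r * cos th) (r * sin th) * w.[r].

(** dR/dr + dTheta/dtheta + R/r is the divergence of the field, by
    cos^2 + sin^2 = 1. *)
Lemma dulac_ME P Q k w r th : 0 < r -> dulac_M P Q k w r th = dulacM P Q k w r th.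
Proof.
move=> r0; rewrite /dulac_M /dulacM; congr (_ - _ * _ * _).
have dc (s : R) : isd s (fun s => s * cos th) (cos th) by isd; ring.
have ds (s : R) : isd s (fun s => s * sin th) (sin th) by isd; ring.
have tc (s : R) : isd s (fun s => r * cos s) (- (r * sin s)) by isd; ring.
have ts (s : R) : isd s (fun s => r * sin s) (r * cos s) by isd; ring.
have E1 (F : bipoly R) := eval2_chain F (dc r) (ds r).
have E2 (F : bipoly R) := eval2_chain F (tc th) (ts th).
have h1 : isd r (fun r' => polarR P Q r' th)
  ((eval2 (d1 P) (r * cos th) (r * sin th) * cos th +
    eval2 (d2 P) (r * cos th) (r * sin th) * sin th) * cos th +
   (eval2 (d1 Q) (r * cos th) (r * sin th) * cos th +
    eval2 (d2 Q) (r * cos th) (r * sin th) * sin th) * sin th).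
  by rewrite /polarR; isd; [exact: E1|exact: E1|ring].
have h2 : isd th (fun th' => polarTheta P Q r th')
  (r^-1 * ((eval2 (d1 Q) (r * cos th) (r * sin th) * (- (r * sin th)) +
    eval2 (d2 Q) (r * cos th) (r * sin th) * (r * cos th)) * cos th
    - eval2 Q (r * cos th) (r * sin th) * sin th -
   (eval2 (d1 P) (r * cos th) (r * sin th) * (- (r * sin th)) +
    eval2 (d2 P) (r * cos th) (r * sin th) * (r * cos th)) * sin th
    - eval2 P (r * cos th) (r * sin th) * cos th)).
  by rewrite /polarTheta; isd; [exact: E2|exact: E2|ring].
rewrite !derive1E (derive_val (is_derive := h1)) (derive_val (is_derive := h2)).
rewrite /polarR /div2.
have -> (A B : R) : A + B = A * (cos th ^+ 2 + sin th ^+ 2) + B * (cos th ^+ 2 + sin th ^+ 2).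
  by rewrite cos2Dsin2 !mulr1.
by field; rewrite gt_eqF.
Qed.

Lemma polarR_cont P Q : continuous (fun z : R * R => polarR P Q z.1 z.2).
Proof.
have cP := eval2_cont (F := P); have cQ := eval2_cont (F := Q).
by rewrite /polarR; cont.
Qed.

Lemma div2_cont P Q : continuous (fun z : R * R => div2 P Q z.1 z.2).
Proof. by apply: contD; exact: eval2_cont. Qed.

Lemma dulacM_cont P Q k w : continuous (fun z : R * R => dulacM P Q k w z.1 z.2).
Proof.
have cR := polarR_cont (P := P) (Q := Q); have cd := div2_cont (P := P) (Q := Q).
by rewrite /dulacM; cont.
Qed.

Lemma polar_repr (a b : R) : exists r th, [/\ 0 <= r, 0 <= th <= 2 * pi,
  a = r * cos th, b = r * sin th & r ^+ 2 = a ^+ 2 + b ^+ 2].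
Proof.
have p0 : 0 < pi :> R := pi_gt0 R.
have sa := sqr_ge0 a; have sb := sqr_ge0 b.
pose r := Num.sqrt (a ^+ 2 + b ^+ 2).
have r2 : r ^+ 2 = a ^+ 2 + b ^+ 2 by rewrite sqr_sqrtr // addr_ge0.
have [r0|r0] := eqVneq r 0.
  exists 0, 0; split; rewrite ?lexx ?mulr_ge0 ?(ltW p0) ?mul0r //.
  - by apply/eqP; rewrite -sqrf_eq0; apply/eqP; move: r2; rewrite r0 expr0n /=; lra.
  - by apply/eqP; rewrite -sqrf_eq0; apply/eqP; move: r2; rewrite r0 expr0n /=; lra.
  - by rewrite -r0.
have rp : 0 < r by rewrite lt_neqAle eq_sym r0 sqrtr_ge0.
have har : `|a| <= r by rewrite -(@ler_pXn2r _ 2) ?nnegrE ?(ltW rp) // real_normK ?num_real // r2; lra.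
have c1 : -1 <= a / r <= 1.
  by rewrite -ler_norml normrM normfV (gtr0_norm rp) ler_pdivrMr // mul1r.
have cK : cos (acos (a / r)) = a / r by rewrite acosK // in_itv.
have sK : sin (acos (a / r)) = `|b| / r.
  rewrite sin_acos // (_ : 1 - (a / r) ^+ 2 = (b / r) ^+ 2).
    by rewrite sqrtr_sqr normrM normfV (gtr0_norm rp).
  by rewrite !expr_div_n r2; field; rewrite -r2 expf_neq0.
have t0 := acos_ge0 c1; have t1 := acos_lepi c1.
have [b0|b0] := leP 0 b.
  exists r, (acos (a / r)); split; rewrite ?(ltW rp) //; first by rewrite t0 /=; lra.
  - by rewrite cK mulrC divfK.
  - by rewrite sK ger0_norm // mulrC divfK.
exists r, (2 * pi - acos (a / r)); split; rewrite ?(ltW rp) //; first by apply/andP; split; lra.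
- by rewrite addrC mulr_natl cosD2pi cosN cK mulrC divfK.
- by rewrite addrC mulr_natl sinD2pi sinN sK ltr0_norm // mulNr opprK mulrC divfK.
Qed.
End Polar.

(** * The Bendixson-Dulac argument with a regularized weight *)

Section Eventually.
Context {R : realType}.
(** Convergence as the regularization parameter decreases to 0. *)
Definition for_small (A : R -> Prop) := exists2 l0 : R, 0 < l0 & forall l, 0 < l < l0 -> A l.

Lemma for_smallI A B : for_small A -> for_small B -> for_small (fun l => A l /\ B l).
Proof.
move=> [l1 l10 h1] [l2 l20 h2]; exists (Num.min l1 l2); first by rewrite lt_min l10.
by move=> l; rewrite lt_min => /and3P[l0 a b]; split; [apply: h1|apply: h2]; rewrite l0.
Qed.

Lemma for_small_sub (A B : R -> Prop) : (forall l, 0 < l <= 1 -> A l -> B l) -> for_small A -> for_small B.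
Proof.
move=> AB [l1 l10 h1]; exists (Num.min 1 l1); first by rewrite lt_min ltr01.
move=> l; rewrite lt_min => /and3P[l0 a b]; apply: AB; first by rewrite l0 ltW.
by apply: h1; rewrite l0.
Qed.

Lemma for_small_linear (C d : R) : 0 <= C -> 0 < d -> for_small (fun l => C * l <= d).
Proof.
move=> C0 d0; exists (d / (C + 1)) => [|l /andP[l0 ll]]; first by apply: divr_gt0; lra.
have C1 : 0 < C + 1 by lra.
have : l * (C + 1) <= d by rewrite -ler_pdivlMr // ltW.
nra.
Qed.

Lemma for_small_witness A : for_small A -> exists l, 0 < l <= 1 /\ A l.
Proof.
move=> [l0 l00 h]; exists (Num.min 1 (l0 / 2)).
have h1 : 0 < Num.min 1 (l0 / 2) by rewrite lt_min ltr01 divr_gt0.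
split; first by rewrite h1 ge_min lexx.
by apply: h; rewrite h1 gt_min; apply/orP; right; lra.
Qed.
End Eventually.

Lemma nonneg_derive_le {R : realType} (f df : R -> R) (a b : R) : a <= b ->
  (forall t : R, a <= t <= b -> isd t f (df t)) ->
  (forall t, a <= t <= b -> 0 <= df t) -> f a <= f b.
Proof.
move=> ab hd hC; rewrite -subr_ge0.
have [||c cab ->] := @MVT_segment R f df a b ab.
- by move=> x /[!in_itv] /= /andP[? ?]; apply: hd; rewrite !ltW.
- by apply: derivable_within_continuous => x /[!in_itv] /= h; case: (hd x h).
by rewrite mulr_ge0 ?subr_ge0 // hC //; rewrite in_itv in cab.
Qed.

Lemma nonneg_derive_le_ex {R : realType} (f : R -> R) (a b : R) : a <= b ->
  (forall t : R, a <= t <= b -> exists2 D, isd t f D & 0 <= D) -> f a <= f b.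
Proof.
move=> ab h.
have /choice[g hg] : forall t : R, exists D : R, a <= t <= b -> isd t f D /\ 0 <= D.
  move=> t; have [/h[D h1 h2]|nt] := boolP (a <= t <= b); first by exists D.
  by exists 0.
by apply: (nonneg_derive_le (df := g)) => // t /hg[].
Qed.

(* The closing inequalities of [dulac_core], with [d] the size of the error. *)
Lemma core_arith {R : realFieldType} (m C1 C2 d g B pa pb g0 b0 c : R) :
  0 < m -> 0 < C1 -> 0 < C2 -> 0 < c -> d = c * m / (2 * (2 * C1 + C2)) ->
  m <= g -> B <= d -> pb <= C1 * d -> - (C1 * d) <= pa ->
  pa - c * g0 + C2 * b0 <= pb - c * (g0 + g) + C2 * (b0 + B) -> False.
Proof.
move=> m0 C10 C20 c0 dE mg Bd hb ha mono.
have Cs : 0 < 2 * (2 * C1 + C2) by lra.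
have half : d * (2 * (2 * C1 + C2)) = c * m by rewrite dE divfK // gt_eqF.
have cm : 0 < c * m by rewrite mulr_gt0.
have h1 : c * m <= c * g by rewrite ler_pM2l.
have h2 : C2 * B <= C2 * d by rewrite ler_pM2l.
lra.
Qed.

Section DulacCore.
Context {R : realType}.
Variables (P Q : bipoly R) (w : {poly R}) (k ra rb : R).
Hypotheses (k0 : 0 < k) (ra0 : 0 <= ra) (rab : ra < rb).
Hypothesis w_neq0 : forall r, ra <= r <= rb -> w.[r] != 0.
Hypothesis M_neg : forall r th, 0 < r -> 0 <= th <= 2 * pi -> dulacM P Q k w r th < 0.
(* [beta l] is a smooth function on the plane with gradient [(bx l, by_ l)];
   it regularizes a function that is constant along the flow. *)
Variables beta bx by_ : R -> R -> R -> R.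
Hypothesis beta_cont : forall l, 0 < l -> continuous (fun z : R * R => beta l z.1 z.2).
Hypothesis bx_cont : forall l, 0 < l -> continuous (fun z : R * R => bx l z.1 z.2).
Hypothesis by_cont : forall l, 0 < l -> continuous (fun z : R * R => by_ l z.1 z.2).
Hypothesis beta_chain : forall l (a b a' b' : R -> R) (s : R), 0 < l ->
  (forall s : R, isd s a (a' s)) -> (forall s : R, isd s b (b' s)) ->
  continuous a' -> continuous b' ->
  isd s (fun s => beta l (a s) (b s)) (bx l (a s) (b s) * a' s + by_ l (a s) (b s) * b' s).

(* [h] vanishes with its argument and is positive elsewhere, so that [h beta] is
   a nonnegative weight; its derivative is bounded, so that the weight varies
   along the flow as little as [beta]. *)
Let h (s : R) : R := s ^+ 2 / (1 + s ^+ 2).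
Let dh (s : R) : R := 2 * s / (1 + s ^+ 2) ^+ 2.

Let h_den (s : R) : 0 < 1 + s ^+ 2.
Proof. by rewrite ltr_wpDr // sqr_ge0. Qed.

Let h_cont : continuous h.
Proof. by rewrite /h; cont; move=> u; rewrite gt_eqF. Qed.

Let dh_cont : continuous dh.
Proof. by rewrite /dh; cont; move=> u; rewrite expf_neq0 // gt_eqF. Qed.

Let h_ge0 s : 0 <= h s.
Proof. by rewrite divr_ge0 ?sqr_ge0 // ltW. Qed.

Let dh_le1 s : `|dh s| <= 1.
Proof.
rewrite normrM normfV [`|_ ^+ 2|]ger0_norm ?sqr_ge0 // ler_pdivrMr ?exprn_gt0 // mul1r.
have := sqr_ge0 (s - 1); have := sqr_ge0 (s + 1); have := sqr_ge0 s; have := sqr_ge0 (s ^+ 2).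
by rewrite ler_norml => *; apply/andP; split; nra.
Qed.

Let h_le s : h s <= `|s|.
Proof.
rewrite ler_pdivrMr // -[s ^+ 2]real_normK ?num_real //.
have := normr_ge0 s; set n := `|s| => n0; have := sqr_ge0 (n - 1); nra.
Qed.

Let h_mono (c s : R) : 0 <= c -> c <= `|s| -> h c <= h s.
Proof.
move=> c0 cs; rewrite ler_pdivrMr // mulrAC ler_pdivlMr //.
have : c ^+ 2 <= s ^+ 2 by rewrite -[s ^+ 2]real_normK ?num_real // ler_pXn2r ?nnegrE.
nra.
Qed.

Let isd_h (f : R -> R) (s l : R) : isd s f l -> isd s (fun s => h (f s)) (dh (f s) * l).
Proof.
move=> df; rewrite /h /dh.
have d0 : 1 + f s ^+ 2 != 0 by rewrite gt_eqF.
by isd; field.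
Qed.

Let Pp r th := eval2 P (r * cos th) (r * sin th).
Let Qp r th := eval2 Q (r * cos th) (r * sin th).

(* The derivative of [beta l] along the vector field, in polar coordinates. *)
Definition along_field l r th : R :=
  Pp r th * bx l (r * cos th) (r * sin th) + Qp r th * by_ l (r * cos th) (r * sin th).

Let cP := eval2_cont (F := P).
Let cQ := eval2_cont (F := Q).
Let cR := polarR_cont (P := P) (Q := Q).
Let cM := dulacM_cont (P := P) (Q := Q) (k := k) (w := w).
Let cdiv := div2_cont (P := P) (Q := Q).

Let along_cont l : 0 < l -> continuous (fun z : R * R => along_field l z.1 z.2).
Proof.
move=> l0; have c1 := bx_cont l0; have c2 := by_cont l0.
by rewrite /along_field /Pp /Qp; cont.
Qed.

Let H l r th := h (beta l (r * cos th) (r * sin th)).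
Let dH l r th := dh (beta l (r * cos th) (r * sin th)).

Let H_cont l : 0 < l -> continuous (fun z : R * R => H l z.1 z.2).
Proof. by move=> l0; have c1 := beta_cont l0; rewrite /H; cont. Qed.

Let dH_cont l : 0 < l -> continuous (fun z : R * R => dH l z.1 z.2).
Proof. by move=> l0; have c1 := beta_cont l0; rewrite /dH; cont. Qed.

Let J l r := RI 0 (2 * pi) (fun th => r * polarR P Q r th * H l r th).
Let G l r := RI 0 (2 * pi) (fun th => r * H l r th * - dulacM P Q k w r th).
Let E l r := RI 0 (2 * pi) (fun th => r * dH l r th * along_field l r th).

Let p2 : 0 <= 2 * pi :> R.
Proof. by rewrite mulr_ge0 // pi_ge0. Qed.

(** The divergence theorem on discs, differentiated in the radius: the angular
    part of the divergence of h(beta) times the field integrates to 0 over a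
    period, so the derivative of the flux [J] is the integral over the circle of
    the whole divergence. *)
Let J_derive l (r : R) : 0 < l -> isd r (J l)
  (RI 0 (2 * pi) (fun th => r * div2 P Q (r * cos th) (r * sin th) * H l r th +
     r * dH l r th * along_field l r th)).
Proof.
move=> l0.
have cb := beta_cont l0; have cbx := bx_cont l0; have cby := by_cont l0.
have cH := H_cont l0; have cdH := dH_cont l0; have ca := along_cont l0.
have cd1P := eval2_cont (F := d1 P); have cd2P := eval2_cont (F := d2 P).
have cd1Q := eval2_cont (F := d1 Q); have cd2Q := eval2_cont (F := d2 Q).
have dc th (s : R) : isd s (fun s => s * cos th) (cos th) by isd; ring.
have ds th (s : R) : isd s (fun s => s * sin th) (sin th) by isd; ring.
have tc q (s : R) : isd s (fun s => q * cos s) (- (q * sin s)) by isd; ring.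
have ts q (s : R) : isd s (fun s => q * sin s) (q * cos s) by isd; ring.
have dHr th (s : R) : isd s (fun s => H l s th) (dH l s th *
    (bx l (s * cos th) (s * sin th) * cos th + by_ l (s * cos th) (s * sin th) * sin th)).
  apply: isd_h; apply: (beta_chain (a' := fun _ => cos th) (b' := fun _ => sin th)) => //.
  - exact: contC.
  - exact: contC.
have dHt s (th : R) : isd th (fun th => H l s th) (dH l s th *
    (bx l (s * cos th) (s * sin th) * - (s * sin th) +
     by_ l (s * cos th) (s * sin th) * (s * cos th))).
  apply: isd_h; apply: (beta_chain (a' := fun th => - (s * sin th)) (b' := fun th => s * cos th)) => //.
  - by cont.
  - by cont.
have E1 (F : bipoly R) th (s : R) := eval2_chain F (dc th s) (ds th s).
have E2 (F : bipoly R) s (th : R) := eval2_chain F (tc s th) (ts s th).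
pose x_ r th : R := r * cos th; pose y_ r th : R := r * sin th.
(* The radial derivative of the integrand of [J]. *)
pose D s th :=
  (Pp s th * cos th + Qp s th * sin th +
   s * ((eval2 (d1 P) (x_ s th) (y_ s th) * cos th +
         eval2 (d2 P) (x_ s th) (y_ s th) * sin th) * cos th +
        (eval2 (d1 Q) (x_ s th) (y_ s th) * cos th +
         eval2 (d2 Q) (x_ s th) (y_ s th) * sin th) * sin th)) * H l s th +
  s * (Pp s th * cos th + Qp s th * sin th) * (dH l s th *
    (bx l (s * cos th) (s * sin th) * cos th + by_ l (s * cos th) (s * sin th) * sin th)).
have cD : continuous (fun z : R * R => D z.1 z.2) by rewrite /D /Pp /Qp /x_ /y_; cont_rec.
have dJ : isd r (J l) (RI 0 (2 * pi) (D r)).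
  apply: (@RI_diff _ _ _ _ _ (r - 1) (r + 1)) => //; first lra.
  - by move=> s _; rewrite /polarR; have cHs := cont_curry (v := s) cH; cont.
  - move=> s th _; rewrite /polarR.
    by isd; [exact: E1|exact: E1|exact: dHr|rewrite /D /Pp /Qp /x_ /y_; ring].
apply: (isd_eq dJ).
(* The angular derivative of r * Theta * h(beta). *)
pose L th := (Qp r th * cos th - Pp r th * sin th) * H l r th.
pose dL th :=
  ((eval2 (d1 Q) (x_ r th) (y_ r th) * - (r * sin th) +
    eval2 (d2 Q) (x_ r th) (y_ r th) * (r * cos th)) * cos th - Qp r th * sin th -
   (eval2 (d1 P) (x_ r th) (y_ r th) * - (r * sin th) +
    eval2 (d2 P) (x_ r th) (y_ r th) * (r * cos th)) * sin th - Pp r th * cos th) * H l r th +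
  (Qp r th * cos th - Pp r th * sin th) * (dH l r th *
    (bx l (r * cos th) (r * sin th) * - (r * sin th) +
     by_ l (r * cos th) (r * sin th) * (r * cos th))).
have hL (th : R) : isd th L (dL th).
  rewrite /L /Qp /Pp.
  by isd; [exact: E2|exact: E2|exact: dHt|rewrite /dL /Pp /Qp /x_ /y_; ring].
have cHr := cont_curry (v := r) cH; have cdHr := cont_curry (v := r) cdH.
have car := cont_curry (v := r) ca.
have cdL : continuous dL by rewrite /dL /Pp /Qp /x_ /y_; cont_rec.
have iL : RI 0 (2 * pi) dL = 0.
  rewrite (RI_FTC p2 cdL (fun th _ => hL th)) /L /Qp /Pp /H.
  by rewrite !mulr_natl sin2pi cos2pi sin0 cos0 subrr.
transitivity (RI 0 (2 * pi) (D r) + RI 0 (2 * pi) dL); first by rewrite iL addr0.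
rewrite -RID //; last exact: cont_curry cD.
apply: RI_eq => th _; rewrite /D /dL /div2 /along_field /x_ /y_.
have e1 := cos2Dsin2 th.
have -> : r * (eval2 (d1 P) (r * cos th) (r * sin th) + eval2 (d2 Q) (r * cos th) (r * sin th)) *
     H l r th = r * ((eval2 (d1 P) (r * cos th) (r * sin th) +
     eval2 (d2 Q) (r * cos th) (r * sin th)) * (cos th ^+ 2 + sin th ^+ 2)) * H l r th.
  by rewrite e1 mulr1.
have -> : r * dH l r th * (Pp r th * bx l (r * cos th) (r * sin th) +
    Qp r th * by_ l (r * cos th) (r * sin th)) =
   r * dH l r th * ((Pp r th * bx l (r * cos th) (r * sin th) +
    Qp r th * by_ l (r * cos th) (r * sin th)) * (cos th ^+ 2 + sin th ^+ 2)).
  by rewrite e1 mulr1.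
by ring.
Qed.

(** Multiplied by V = |w|^(-1/k), which satisfies k w V' = - w' V, the flux has
    derivative (V J)' = V (G / (k w) + E). *)
Let J_ode (l r : R) : 0 < l -> exists2 J', isd r (J l) J' &
  k * w.[r] * J' = (deriv w).[r] * J l r + G l r + k * w.[r] * E l r.
Proof.
move=> l0; eexists; first exact: J_derive.
have cH := H_cont l0; have cdH := dH_cont l0; have ca := along_cont l0.
have cHr := cont_curry (v := r) cH; have cdHr := cont_curry (v := r) cdH; have car := cont_curry (v := r) ca.
have cMr := cont_curry (v := r) cM; have cRr := cont_curry (v := r) cR.
rewrite /J /G /E -!RIZ; try by cont.
rewrite -!RID; try by cont.
by apply: RI_eq => th _; rewrite /dulacM; ring.
Qed.

Hypothesis beta_outer : forall d, 0 < d ->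
  for_small (fun l => forall th, `|beta l (rb * cos th) (rb * sin th)| <= d).
Hypothesis beta_inner : ra = 0 \/ forall d, 0 < d ->
  for_small (fun l => forall th, `|beta l (ra * cos th) (ra * sin th)| <= d).
Hypothesis along_small : forall d, 0 < d ->
  for_small (fun l => RI ra rb (fun r => RI 0 (2 * pi) (fun th => `|along_field l r th|)) <= d).
Variables (r0 th0 c eta : R).
Hypotheses (r0ab : ra < r0 < rb) (th0_2pi : 0 <= th0 <= 2 * pi) (c0 : 0 < c) (eta0 : 0 < eta).
Hypothesis beta_large : for_small (fun l => forall a b : R,
  (a - r0 * cos th0) ^+ 2 + (b - r0 * sin th0) ^+ 2 < eta -> c <= `|beta l a b|).

(* A continuous bump around the point where beta stays away from 0. *)
Let bump r th : R :=
  let z := 1 - ((r * cos th - r0 * cos th0) ^+ 2 + (r * sin th - r0 * sin th0) ^+ 2) / eta in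
  h c * ((z + `|z|) / 2).

Let bump_cont : continuous (fun z : R * R => bump z.1 z.2).
Proof. by rewrite /bump; cont. Qed.

Let hc_gt0 : 0 < h c.
Proof. by rewrite divr_gt0 // exprn_gt0. Qed.

Let bump_ge0 r th : 0 <= bump r th.
Proof.
rewrite /bump; set z := 1 - _; rewrite mulr_ge0 ?(ltW hc_gt0) // divr_ge0 //.
by have := ler_norm (- z); rewrite normrN; lra.
Qed.

Let bump_le l r th : (forall a b : R,
  (a - r0 * cos th0) ^+ 2 + (b - r0 * sin th0) ^+ 2 < eta -> c <= `|beta l a b|) ->
  bump r th <= H l r th.
Proof.
move=> hl; rewrite /bump /=; set q := _ + _ ^+ 2.
have q0 : 0 <= q by rewrite addr_ge0 ?sqr_ge0.
have [qe|qe] := ltP q eta.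
- apply: (@le_trans _ _ (h c)); last by apply: h_mono; [exact: ltW|exact: hl].
  rewrite ler_piMr ?(ltW hc_gt0) // ger0_norm; last first.
    by rewrite subr_ge0 ler_pdivrMr // mul1r ltW.
  have : 0 <= q / eta by rewrite divr_ge0 // ltW.
  lra.
- rewrite ler0_norm; last by rewrite subr_le0 ler_pdivlMr // mul1r.
  by rewrite subrr mul0r mulr0 h_ge0.
Qed.

Let weight r th := r * bump r th * - dulacM P Q k w r th.

Let weight_cont : continuous (fun z : R * R => weight z.1 z.2).
Proof. by rewrite /weight; cont. Qed.

Let negM r th : ra <= r -> 0 <= th <= 2 * pi -> 0 <= r * - dulacM P Q k w r th.
Proof.
move=> rar h2; have [r00|r00] := leP r 0; last first.
  by rewrite mulr_ge0 ?(ltW r00) // oppr_ge0 ltW // M_neg.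
have -> : r = 0 by apply/eqP; rewrite eq_le r00 (le_trans ra0).
by rewrite mul0r.
Qed.

Let weight_ge0 r th : ra <= r -> 0 <= th <= 2 * pi -> 0 <= weight r th.
Proof.
by move=> ? ?; rewrite /weight mulrAC mulr_ge0 // negM.
Qed.

Let G_cont l : 0 < l -> continuous (G l).
Proof.
move=> l0; have cH := H_cont l0.
have cF : continuous (fun z : R * R => z.1 * H l z.1 z.2 * - dulacM P Q k w z.1 z.2) by cont.
exact: (RI_cont (f := fun r th : R => r * H l r th * - dulacM P Q k w r th) cF p2).
Qed.

Let mass := RI ra rb (fun r => RI 0 (2 * pi) (weight r)).

Let mass_gt0 : 0 < mass.
Proof.
case/andP: r0ab => h1 h2.
have pp : 0 < pi :> R := pi_gt0 R.
apply: (@RI_gt0 _ _ ra rb r0) => //.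
- exact: RI_cont.
- move=> r /andP[rar _]; apply: RI_ge0 => th; exact: weight_ge0.
- by rewrite !ltW.
apply: (@RI_gt0 _ _ _ _ th0) => //.
- by rewrite mulr_gt0.
- exact: (cont_curry (v := r0) weight_cont).
- by move=> t; apply: weight_ge0; exact: ltW.
have rp : 0 < r0 by exact: le_lt_trans ra0 h1.
rewrite /weight /bump !subrr expr0n /= addr0 mul0r subr0 normr1.
rewrite mulr_gt0 ?oppr_gt0 ?M_neg // mulr_gt0 // mulr_gt0 // divr_gt0 //; lra.
Qed.

Let mass_le l : 0 < l -> (forall a b : R,
  (a - r0 * cos th0) ^+ 2 + (b - r0 * sin th0) ^+ 2 < eta -> c <= `|beta l a b|) ->
  mass <= RI ra rb (G l).
Proof.
move=> l0 hl; have cH := H_cont l0.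
apply: RI_le => [||r /andP[rar _]]; [exact: RI_cont|exact: G_cont|].
apply: RI_le => [||th h2].
- exact: (cont_curry (v := r) weight_cont).
- by have cHr := cont_curry (v := r) cH; have cMr := cont_curry (v := r) cM; cont.
have b1 := bump_le r th hl; have m1 := negM rar h2.
by rewrite /weight mulrAC [leRHS]mulrAC; apply: ler_wpM2l.
Qed.

(** V J is small at both ends of [ra, rb], and so is the integral of V E; hence
    the integral of G / |w| is small.  But G is a nonnegative function whose
    integral is at least [mass], as [beta] stays away from 0 near one point.
    Up to the sign of [w], the function [Phi] below is V J minus a multiple of a
    primitive of G plus a multiple of one of the bound for E; it increases.  [d]
    is an error small enough for the comparison of its values at [ra] and [rb] to
    contradict [mass_gt0]. *)
Lemma dulac_core : False.
Proof.
have rb0 : 0 < rb by exact: le_lt_trans ra0 rab.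
(* The sign of [w] is constant on the annulus. *)
have [sg [sg2 sgw]] : exists sg : R, sg ^+ 2 = 1 /\ forall r, ra <= r <= rb -> 0 < sg * w.[r].
  have cw : continuous (fun r => w.[r]) by cont.
  have ivt r : ra <= r <= rb -> 0 < w.[ra] * w.[r].
    move=> /andP[r1 r2]; rewrite ltNge; apply/negP => neg.
    have [||z] := @IVT R (fun r => w.[r]) ra r 0 r1.
    - exact: continuous_subspaceT.
    - rewrite ge_min le_max.
      have [h1|h1] := leP w.[ra] 0.
      + have h2 : w.[ra] < 0 by rewrite lt_neqAle h1 andbT; apply: w_neq0; rewrite lexx ltW.
        by have := nmulr_rle0 w.[r] h2; rewrite neg => /esym ->; rewrite orbT.
      + by have := pmulr_rle0 w.[r] h1; rewrite neg => /esym ->; rewrite (ltW h1) orbT.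
    rewrite in_itv /= => /andP[z1 z2] /eqP; apply/negP; apply: w_neq0.
    by rewrite z1 (le_trans z2).
  exists (Num.sg w.[ra]); split.
    by rewrite sqr_sg w_neq0 ?lexx ?ltW.
  move=> r hr; have h1 := ivt r hr.
  have wa : w.[ra] != 0 by rewrite w_neq0 ?lexx ?ltW.
  rewrite -(pmulr_rgt0 _ (_ : 0 < `|w.[ra]|)) ?normr_gt0 //.
  by rewrite mulrA [`|_| * _]mulrC -numEsg.
have cw : continuous (fun r => sg * w.[r]) by cont.
have [wm wm0 hwm] := segment_min (ltW rab) cw sgw.
have [wM wM0 hwM] := segment_bounded ra rb cw.
(* V = |w|^(-1/k), with [sg] the sign of [w]. *)
pose V r := expR (- k^-1 * ln (sg * w.[r])).
pose vlo := expR (- k^-1 * ln wM); pose vhi := expR (- k^-1 * ln wm).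
have vlo0 : 0 < vlo := expR_gt0 _; have vhi0 : 0 < vhi := expR_gt0 _.
have ki : 0 < k^-1 by rewrite invr_gt0.
have hVlo r : ra <= r <= rb -> vlo <= V r.
  move=> hr; rewrite ler_expR !mulNr lerN2 ler_pM2l // ler_ln ?posrE ?sgw //.
  by rewrite (le_trans (ler_norm _)) // hwM.
have hVhi r : ra <= r <= rb -> V r <= vhi.
  by move=> hr; rewrite ler_expR !mulNr lerN2 ler_pM2l // ler_ln ?posrE ?sgw // hwm.
have dV (r : R) : ra <= r <= rb ->
    isd r V (V r * (- k^-1 * ((sg * w.[r])^-1 * (sg * (deriv w).[r])))).
  move=> hr; have dw : isd r (fun r => w.[r]) (deriv w).[r] by exact: is_derive_poly.
  have dW : isd r (fun r => sg * w.[r]) (sg * (deriv w).[r]) by isd; ring.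
  have dl := isd_comp (g := fun r => sg * w.[r]) (is_derive1_ln (sgw r hr)) dW.
  have dkl : isd r (fun r => - k^-1 * ln (sg * w.[r]))
    (- k^-1 * ((sg * w.[r])^-1 * (sg * (deriv w).[r]))) by isd; ring.
  exact: (isd_comp (g := fun r => - k^-1 * ln (sg * w.[r])) (is_derive_expR _) dkl).
have pp : 0 < pi :> R := pi_gt0 R.
have [Rm Rm0 hRm] := square_bounded (rb + 2 * pi) cR.
pose C1 := vhi * (rb * Rm * (2 * pi)); pose C2 := vhi * rb; pose c1 := vlo / (k * wM).
have C10 : 0 < C1 by rewrite !mulr_gt0.
have C20 : 0 < C2 by rewrite mulr_gt0.
have c10 : 0 < c1 by rewrite divr_gt0 // mulr_gt0.
pose d := c1 * mass / (2 * (2 * C1 + C2)).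
have Cs : 0 < 2 * (2 * C1 + C2) by lra.
have d0 : 0 < d by rewrite divr_gt0 // mulr_gt0.
have inner : ra = 0 \/ for_small (fun l => forall th, `|beta l (ra * cos th) (ra * sin th)| <= d).
  by case: beta_inner => [->|hi]; [left|right; exact: hi].
have [l [l01 [hl [hout [hal hin]]]]] : exists l, 0 < l <= 1 /\
   ((forall a b : R, (a - r0 * cos th0) ^+ 2 + (b - r0 * sin th0) ^+ 2 < eta -> c <= `|beta l a b|) /\
    ((forall th, `|beta l (rb * cos th) (rb * sin th)| <= d) /\
     (RI ra rb (fun r => RI 0 (2 * pi) (fun th => `|along_field l r th|)) <= d /\
      (ra = 0 \/ forall th, `|beta l (ra * cos th) (ra * sin th)| <= d)))).
  apply: for_small_witness; apply: for_smallI => //; apply: for_smallI; first exact: beta_outer.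
  apply: for_smallI; first exact: along_small.
  case: inner => [e|e]; last by apply: for_small_sub e => l _; right.
  by exists 1 => // l _; left.
case/andP: l01 => l0 _.
have cH := H_cont l0; have cdH := dH_cont l0; have ca := along_cont l0.
pose B r := RI 0 (2 * pi) (fun th => `|along_field l r th|).
have cB : continuous B.
  have cF : continuous (fun z : R * R => `|along_field l z.1 z.2|) by cont.
  exact: (RI_cont (f := fun r th : R => `|along_field l r th|) cF p2).
have cG := G_cont l0.
have EB r : ra <= r <= rb -> `|E l r| <= rb * B r.
  move=> /andP[r1 r2]; have r00 : 0 <= r := le_trans ra0 r1.
  have cdHr := cont_curry (v := r) cdH; have car := cont_curry (v := r) ca.
  have ce : continuous (fun th => r * dH l r th * along_field l r th) by cont.
  apply: (le_trans (RI_norm _ _ ce)); rewrite -RIZ; last by cont.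
  apply: RI_le => [||th _]; [by cont|by cont|].
  rewrite normrM ler_wpM2r // normrM (ger0_norm r00) -[leRHS]mulr1.
  by apply: ler_pM => //; exact: dh_le1.
have G0 r : ra <= r -> 0 <= G l r.
  move=> r1; apply: RI_ge0 => th h2.
  by rewrite mulrAC mulr_ge0 ?negM // h_ge0.
have Jb r : 0 <= r <= rb -> (forall th, `|beta l (r * cos th) (r * sin th)| <= d) ->
    `|J l r| <= rb * Rm * (2 * pi) * d.
  move=> /andP[r1 r2] hb; have -> : rb * Rm * (2 * pi) * d = rb * Rm * d * (2 * pi - 0) by ring.
  have cHr := cont_curry (v := r) cH; have cRr := cont_curry (v := r) cR.
  apply: RI_bound => //; first by cont.
  move=> th /andP[t1 t2]; rewrite normrM (ger0_norm (h_ge0 _)) normrM (ger0_norm r1).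
  apply: ler_pM; [by rewrite mulr_ge0|exact: h_ge0| |exact: (le_trans (h_le _))].
  apply: ler_pM => //; apply: hRm; first by rewrite ger0_norm //; lra.
  by rewrite ger0_norm //; lra.
pose Psi r := sg * (V r * J l r).
have Psib r : ra <= r <= rb -> `|J l r| <= rb * Rm * (2 * pi) * d -> `|Psi r| <= C1 * d.
  move=> hr hJ; have sg1 : `|sg| = 1.
    by apply/eqP; rewrite -sqr_norm_eq1 sg2.
  rewrite /Psi !normrM sg1 mul1r /C1 -mulrA; apply: ler_pM => //.
  by rewrite ger0_norm ?expR_ge0 // hVhi.
have Jrb : `|Psi rb| <= C1 * d.
  by apply: Psib; [rewrite lexx ltW|apply: Jb => //; rewrite lexx ltW].
have Jra : `|Psi ra| <= C1 * d.
  apply: Psib; first by rewrite lexx ltW.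
  case: hin => [ra00|hin]; last by apply: Jb; rewrite ?ra0 ?ltW.
  have -> : J l ra = RI 0 (2 * pi) (fun _ => 0).
    by apply: RI_eq => th _; rewrite ra00 !mul0r.
  by rewrite RIC // mul0r normr0 (mulr_ge0 (mulr_ge0 (mulr_ge0 (ltW rb0) (ltW Rm0)) p2) (ltW d0)).
pose Phi r := Psi r - c1 * RI (ra - 1) r (G l) + C2 * RI (ra - 1) r B.
have mono : Phi ra <= Phi rb.
  have dPhi (r : R) : ra <= r <= rb -> exists2 D, isd r Phi D & 0 <= D.
    move=> hr; case/andP: (hr) => r1 r2.
    have [J' dJ eJ] := J_ode r l0.
    have V' := dV r hr.
    have gG : isd r (fun r => RI (ra - 1) r (G l)) (G l r) by apply: RI_derive => //; lra.
    have gB : isd r (fun r => RI (ra - 1) r B) (B r) by apply: RI_derive => //; lra.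
    exists (sg * (V r * (- k^-1 * ((sg * w.[r])^-1 * (sg * (deriv w).[r]))) * J l r + V r * J')
        - c1 * G l r + C2 * B r).
      by rewrite /Phi /Psi; isd; ring.
    have W0 := sgw r hr.
    have wr0 := w_neq0 hr.
    have k0' : k != 0 by rewrite gt_eqF.
    have -> : sg * (V r * (- k^-1 * ((sg * w.[r])^-1 * (sg * (deriv w).[r]))) * J l r + V r * J')
       = V r / (k * (sg * w.[r])) * G l r + V r * (sg * E l r).
      have -> : J' = ((deriv w).[r] * J l r + G l r + k * w.[r] * E l r) / (k * w.[r]).
        by rewrite -eJ mulrC mulKf // mulf_neq0.
      have /eqP := sg2; rewrite sqrf_eq1 => /orP[] /eqP ->; field; rewrite ?wr0 ?k0' //.
    have h1 : c1 * G l r <= V r / (k * (sg * w.[r])) * G l r.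
      apply: ler_wpM2r; first exact: G0.
      apply: ler_pM; [exact: ltW|by rewrite invr_ge0 mulr_ge0 ?ltW|exact: hVlo|].
      have kM := mulr_gt0 k0 wM0; have kW := mulr_gt0 k0 W0.
      rewrite lef_pV2 ?posrE // ler_pM2l //.
      by rewrite (le_trans (ler_norm _)) // hwM.
    have h2 : `|V r * (sg * E l r)| <= C2 * B r.
      have sg1 : `|sg| = 1 by apply/eqP; rewrite -sqr_norm_eq1 sg2.
      rewrite !normrM sg1 mul1r /C2 -mulrA; apply: ler_pM => //; last exact: EB.
      by rewrite ger0_norm ?expR_ge0 // hVhi.
    by move: h2; rewrite ler_norml => /andP[h2 _]; lra.
  exact: (nonneg_derive_le_ex (ltW rab) dPhi).
have lr1 : ra - 1 <= ra by lra.
have sG := RI_split cG lr1 (ltW rab).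
have sB := RI_split cB lr1 (ltW rab).
move: mono; rewrite /Phi sG sB => mono.
move: Jrb Jra; rewrite !ler_norml => /andP[_ jb] /andP[ja _].
exact: (core_arith mass_gt0 C10 C20 c10 erefl (mass_le l0 hl) hal jb ja mono).
Qed.
End DulacCore.

(** * Periodic orbits of a planar polynomial system *)

Section Orbits.
Context {R : realType}.
Variables (P Q : bipoly R).
Implicit Types (x y : R -> R) (t T : R).

Lemma solution_cont x y : is_solution P Q x y -> continuous x /\ continuous y.
Proof. by move=> h; split; apply: isd_cont => t; have [hx hy] := h t; eexists; eassumption. Qed.

Lemma solution_shift x y c : is_solution P Q x y ->
  is_solution P Q (fun t => x (t + c)) (fun t => y (t + c)).
Proof.
move=> h t; have [hx hy] := h (t + c).
have d : isd t (fun t => t + c) 1 by isd; ring.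
split.
- by apply: (isd_eq (isd_comp (g := fun t => t + c) hx d)); rewrite mulr1.
- by apply: (isd_eq (isd_comp (g := fun t => t + c) hy d)); rewrite mulr1.
Qed.

(** f exp (- K t) decreases and f exp (K t) increases, so a zero of the
    nonnegative f propagates both forwards and backwards. *)
Lemma gronwall_zero (f df : R -> R) (K a b : R) : a <= b ->
  (forall t : R, isd t f (df t)) -> (forall t, 0 <= f t) ->
  (forall t, a <= t <= b -> `|df t| <= K * f t) ->
  (f a = 0 -> f b = 0) /\ (f b = 0 -> f a = 0).
Proof.
move=> ab hd f0 hK.
have de (c t : R) : isd t (fun t => expR (c * t)) (expR (c * t) * c).
  have d : isd t (fun t => c * t) c by isd; ring.
  exact: (isd_comp (g := fun t => c * t) (is_derive_expR _) d).
have d1 (c t : R) : isd t (fun t => f t * expR (c * t)) ((df t + c * f t) * expR (c * t)).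
  by have h1 := de c t; have h2 := hd t; isd; ring.
have key z c : f z * expR (c * z) <= 0 -> f z = 0.
  move=> h; apply/eqP; rewrite eq_le f0 andbT.
  by move: h; rewrite pmulr_lle0 // expR_gt0.
split=> h.
- apply: (key _ (- K)); rewrite -oppr_ge0.
  have := @nonneg_derive_le R (fun t => - (f t * expR (- K * t)))
    (fun t => - ((df t + - K * f t) * expR (- K * t))) a b ab.
  rewrite h mul0r oppr0; apply=> t tab.
  rewrite oppr_ge0 pmulr_lle0 ?expR_gt0 //.
  by have := hK t tab; rewrite ler_norml => /andP[_]; lra.
- apply: (key _ K).
  have := @nonneg_derive_le R (fun t => f t * expR (K * t))
    (fun t => (df t + K * f t) * expR (K * t)) a b ab.
  rewrite h mul0r; apply=> // t tab.
  rewrite mulr_ge0 ?expR_ge0 //.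
  by have := hK t tab; rewrite ler_norml => /andP[+ _]; lra.
Qed.

(** The squared distance of the two solutions satisfies a Gronwall inequality,
    the field being Lipschitz on a square that contains both. *)
Lemma solution_unique x1 y1 x2 y2 t0 : is_solution P Q x1 y1 -> is_solution P Q x2 y2 ->
  x1 t0 = x2 t0 -> y1 t0 = y2 t0 -> forall t, x1 t = x2 t /\ y1 t = y2 t.
Proof.
move=> s1 s2 ex ey t.
have [cx1 cy1] := solution_cont s1; have [cx2 cy2] := solution_cont s2.
pose a := Num.min t0 t; pose b := Num.max t0 t.
have ab : a <= b by rewrite ge_min !le_max lexx.
have [B1 B10 h1] := segment_bounded a b cx1; have [B2 B20 h2] := segment_bounded a b cx2.
have [B3 B30 h3] := segment_bounded a b cy1; have [B4 B40 h4] := segment_bounded a b cy2.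
pose c := B1 + B2 + B3 + B4.
have [LP LP0 hP] := eval2_lip P c; have [LQ LQ0 hQ] := eval2_lip Q c.
pose f s := (x1 s - x2 s) ^+ 2 + (y1 s - y2 s) ^+ 2.
pose df s := 2 * ((x1 s - x2 s) * (eval2 P (x1 s) (y1 s) - eval2 P (x2 s) (y2 s)) +
                  (y1 s - y2 s) * (eval2 Q (x1 s) (y1 s) - eval2 Q (x2 s) (y2 s))).
have hd (s : R) : isd s f (df s).
  have [d1 d2] := s1 s; have [d3 d4] := s2 s.
  by rewrite /f /df; isd; ring.
have f0 s : 0 <= f s by rewrite addr_ge0 ?sqr_ge0.
have hK s : a <= s <= b -> `|df s| <= (4 * (LP + LQ)) * f s.
  move=> sab; have k1 := h1 _ sab; have k2 := h2 _ sab; have k3 := h3 _ sab; have k4 := h4 _ sab.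
  have [a1 a2 a3 a4] : [/\ `|x1 s| <= c, `|x2 s| <= c, `|y1 s| <= c & `|y2 s| <= c].
    by rewrite /c; split; lra.
  have := hQ _ _ _ _ a2 a4 a1 a3; have := hP _ _ _ _ a2 a4 a1 a3.
  rewrite /df /f normrM ger0_norm // => e1 e2.
  rewrite -[(x1 s - x2 s) ^+ 2]real_normK ?num_real // -[(y1 s - y2 s) ^+ 2]real_normK ?num_real //.
  have e3 := ler_normD ((x1 s - x2 s) * (eval2 P (x1 s) (y1 s) - eval2 P (x2 s) (y2 s)))
    ((y1 s - y2 s) * (eval2 Q (x1 s) (y1 s) - eval2 Q (x2 s) (y2 s))).
  rewrite !normrM in e3.
  have e4 := ler_wpM2l (normr_ge0 (x1 s - x2 s)) e1.
  have e5 := ler_wpM2l (normr_ge0 (y1 s - y2 s)) e2.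
  move: e3 e4 e5 (normr_ge0 (x1 s - x2 s)) (normr_ge0 (y1 s - y2 s)).
  set X := `|x1 s - x2 s|; set Y := `|y1 s - y2 s|; set Z := `|_ + _| => e3 e4 e5 X0 Y0.
  have := mulr_ge0 (ltW LP0) (sqr_ge0 (X - Y)); have := mulr_ge0 (ltW LQ0) (sqr_ge0 (X - Y)).
  have := mulr_ge0 (ltW LP0) (sqr_ge0 X); have := mulr_ge0 (ltW LP0) (sqr_ge0 Y).
  have := mulr_ge0 (ltW LQ0) (sqr_ge0 X); have := mulr_ge0 (ltW LQ0) (sqr_ge0 Y).
  lra.
have [g1 g2] := gronwall_zero ab hd f0 hK.
have ft0 : f t0 = 0 by rewrite /f ex ey !subrr expr0n addr0.
have ft : f t = 0.
  have [tt|tt] := leP t0 t.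
  - by move: g1; rewrite /a /b min_l // max_r // => /(_ ft0).
  - by move: g2; rewrite /a /b min_r ?ltW // max_l ?ltW // => /(_ ft0).
have [|] := @sum_sqr_le0 _ (x1 t - x2 t) (y1 t - y2 t); first by rewrite -/(f t) ft.
by move=> /eqP + /eqP; rewrite !subr_eq0 => /eqP ? /eqP ?.
Qed.

Section Periodic.
Variables (x y : R -> R) (T : R).
Hypothesis per : periodic_solution P Q x y T.

Let sol : is_solution P Q x y. Proof. by case: per. Qed.
Let T0 : 0 < T. Proof. by case: per => _ []. Qed.
Let period t : x (t + T) = x t /\ y (t + T) = y t. Proof. by case: per => _ []. Qed.
Let least S : 0 < S -> (forall t, x (t + S) = x t /\ y (t + S) = y t) -> T <= S.
Proof. by move=> S0 h; case: per => _ _; apply. Qed.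

Lemma period_reduce t : exists2 s, 0 <= s <= T & x s = x t /\ y s = y t.
Proof.
have pn (n : nat) s : x (s + n%:R * T) = x s /\ y (s + n%:R * T) = y s.
  elim: n => [|n [IHx IHy]]; first by rewrite mul0r addr0.
  rewrite -natr1 mulrDl mul1r addrA; have [-> ->] := period (s + n%:R * T).
  by rewrite IHx IHy.
pose m := Num.floor (t / T).
have m1 : m%:~R * T <= t by rewrite -ler_pdivlMr // floor_le.
have m2 : t < (m + 1)%:~R * T by rewrite -ltr_pdivrMr // floorD1_gt.
exists (t - m%:~R * T).
  by rewrite intrD mulrDl mul1r in m2; apply/andP; split; lra.
case: m {m1 m2} => n.
- have [hx hy] := pn n (t - n%:R * T).
  by move: hx hy; rewrite subrK => <- <-.
- have -> : t - (Negz n)%:~R * T = t + n.+1%:R * T by rewrite NegzE mulrNz mulNr opprK.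
  exact: pn.
Qed.

Lemma shift_period c : (forall t, x (t + c) = x t /\ y (t + c) = y t) -> `|c| < T -> c = 0.
Proof.
move=> h cT; apply/eqP/negPn/negP => c0.
have hn t : x (t + `|c|) = x t /\ y (t + `|c|) = y t.
  have [c1|c1] := leP 0 c; first by rewrite ger0_norm.
  by rewrite ltr0_norm //; have [e1 e2] := h (t - c); move: e1 e2; rewrite subrK => <- <-.
have := least (S := `|c|); rewrite normr_gt0 => /(_ c0 hn).
by rewrite leNgt cT.
Qed.

(** If the point at time T / 2 is taken at another time, then the difference of
    the two times is a period smaller than T.  The middle time is used because
    it is away from both ends of the period. *)
Lemma orbit_simple t : 0 <= t <= T -> x t = x (T / 2) -> y t = y (T / 2) -> t = T / 2.
Proof.
move=> tT ex ey; pose c := t - T / 2.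
have h s : x (s + c) = x s /\ y (s + c) = y s.
  apply: (@solution_unique _ _ _ _ (T / 2) (solution_shift c sol) sol).
  - by rewrite /c addrC subrK.
  - by rewrite /c addrC subrK.
have /(shift_period h) : `|c| < T.
  by have TT := T0; rewrite /c ltr_norml; apply/andP; split; lra.
by rewrite /c => ?; lra.
Qed.

(** At an equilibrium the solution would be constant, without least period. *)
Lemma orbit_speed t : 0 < eval2 P (x t) (y t) ^+ 2 + eval2 Q (x t) (y t) ^+ 2.
Proof.
rewrite ltNge; apply/negP => /sum_sqr_le0[eP eQ].
have cst : is_solution P Q (fun _ => x t) (fun _ => y t).
  by move=> s; rewrite eP eQ; split; exact: isdC.
have h := @solution_unique _ _ _ _ t sol cst erefl erefl.
have TT := T0.
have : T / 2 = 0.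
  apply: shift_period; last by rewrite gtr0_norm; lra.
  by move=> s; have [-> ->] := h (s + T / 2); have [-> ->] := h s.
by lra.
Qed.

Lemma orbit_neq0 t : eval2 P 0 0 = 0 -> eval2 Q 0 0 = 0 -> 0 < x t ^+ 2 + y t ^+ 2.
Proof.
move=> p0 q0; rewrite ltNge; apply/negP => /sum_sqr_le0[ex ey].
by have := orbit_speed t; rewrite ex ey p0 q0 expr0n addr0 ltxx.
Qed.

Lemma orbit_full : orbit_of x y T = [set (x t, y t) | t in [set: R]].
Proof.
apply/seteqP; split=> _ [t _ <-]; first by exists t.
have [s sT [ex ey]] := period_reduce t.
by exists s; [rewrite /= in_itv|rewrite ex ey].
Qed.
End Periodic.

Lemma orbits_meet x1 y1 T1 x2 y2 T2 t1 t2 :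
  periodic_solution P Q x1 y1 T1 -> periodic_solution P Q x2 y2 T2 ->
  x1 t1 = x2 t2 -> y1 t1 = y2 t2 -> orbit_of x1 y1 T1 = orbit_of x2 y2 T2.
Proof.
move=> p1 p2 ex ey; rewrite (orbit_full p1) (orbit_full p2).
have [s1 _ _] := p1; have [s2 _ _] := p2.
have h s : x1 (s + (t1 - t2)) = x2 s /\ y1 (s + (t1 - t2)) = y2 s.
  apply: (@solution_unique _ _ _ _ t2 (solution_shift (t1 - t2) s1) s2).
  - by rewrite addrC subrK.
  - by rewrite addrC subrK.
apply/seteqP; split=> _ [t _ <-].
- by exists (t - (t1 - t2)) => //; have [<- <-] := h (t - (t1 - t2)); rewrite subrK.
- by exists (t + (t1 - t2)) => //; have [-> ->] := h t.
Qed.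
End Orbits.

(** * The winding number of a periodic orbit *)

Section OneOrbit.
Context {R : realType}.
Variables (P Q : bipoly R) (x y : R -> R) (T : R).
Hypothesis per : periodic_solution P Q x y T.
Implicit Types (a b r th l : R).

Definition vel_x t := eval2 P (x t) (y t).
Definition vel_y t := eval2 Q (x t) (y t).
Definition owind e a b : R := wind x y vel_x vel_y T e a b.
Definition owind_x e a b : R := wind_x x y vel_y T e a b.
Definition owind_y e a b : R := wind_y x y vel_x T e a b.

Lemma orbit_T_gt0 : 0 < T. Proof. by case: per => _ []. Qed.
Lemma orbit_dx (t : R) : isd t x (vel_x t).
Proof. by case: per => h _ _; have [] := h t. Qed.
Lemma orbit_dy (t : R) : isd t y (vel_y t).
Proof. by case: per => h _ _; have [] := h t. Qed.
Lemma orbit_cx : continuous x.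
Proof. by case: per => h _ _; have [] := solution_cont h. Qed.
Lemma orbit_cy : continuous y.
Proof. by case: per => h _ _; have [] := solution_cont h. Qed.
Lemma vel_x_cont : continuous vel_x.
Proof.
have cP := eval2_cont (F := P); have cx := orbit_cx; have cy := orbit_cy.
by rewrite /vel_x; cont.
Qed.
Lemma vel_y_cont : continuous vel_y.
Proof.
have cQ := eval2_cont (F := Q); have cx := orbit_cx; have cy := orbit_cy.
by rewrite /vel_y; cont.
Qed.
Lemma orbit_closed : x T = x 0 /\ y T = y 0.
Proof. by case: per => _ [_ h] _; have := h 0; rewrite add0r. Qed.

Let T0 := orbit_T_gt0.
Let dx := orbit_dx.
Let dy := orbit_dy.
Let cx := orbit_cx.
Let cy := orbit_cy.
Let cu := vel_x_cont.
Let cv := vel_y_cont.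
Let xT := orbit_closed.1.
Let yT := orbit_closed.2.

Lemma vel_bound : exists2 B, 0 < B & forall t, 0 <= t <= T -> `|vel_x t| <= B /\ `|vel_y t| <= B.
Proof.
have [B1 B10 h1] := segment_bounded 0 T cu; have [B2 B20 h2] := segment_bounded 0 T cv.
exists (B1 + B2) => [|t tT]; first exact: addr_gt0.
by split; [apply: (le_trans (h1 t tT)); rewrite lerDl ltW|
           apply: (le_trans (h2 t tT)); rewrite lerDr ltW].
Qed.

Lemma owind_chain e (a b a' b' : R -> R) (s : R) : 0 < e ->
  (forall s : R, isd s a (a' s)) -> (forall s : R, isd s b (b' s)) ->
  continuous a' -> continuous b' ->
  isd s (fun s => owind e (a s) (b s))
    (owind_x e (a s) (b s) * a' s + owind_y e (a s) (b s) * b' s).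
Proof. exact: wind_chain. Qed.

(** Both the regularization error [wind_limit] at (a, b) and the variation
    between (a, b) and nearby points [wind_segment] carry the factor [e]; so the
    limit as [e] tends to 0 is constant near (a, b). *)
Lemma owind_local a b eta : 0 < eta -> (forall t, eta <= dist2 x y a b t) ->
  exists K d, [/\ 0 <= K, 0 < d & forall e a1 b1, 0 < e ->
    (a1 - a) ^+ 2 + (b1 - b) ^+ 2 < d -> `|owind e a1 b1 - owind 0 a b| <= K * e].
Proof.
move=> eta0 h; have [B B0 hB] := vel_bound.
pose I := RI 0 T (fun t => `|(x t - a) * vel_y t - (y t - b) * vel_x t|) / eta ^+ 2.
have I0 : 0 <= I by rewrite divr_ge0 ?sqr_ge0 // RI_ge0.
pose d := Num.min 1 (eta / 4); pose K := 2 * B * T / (eta / 4) ^+ 2 * 2.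
have d1 : d <= 1 by rewrite ge_min lexx.
have d4 : d <= eta / 4 by rewrite ge_min lexx orbT.
have e4 : 0 < eta / 4 by rewrite divr_gt0.
have K0 : 0 <= K.
  by rewrite mulr_ge0 // divr_ge0 ?sqr_ge0 // !mulr_ge0 // ltW.
exists (K + I), d; split=> [||e a1 b1 e0 hd]; first exact: addr_ge0.
  by rewrite lt_min ltr01.
have seg : `|owind e a1 b1 - owind e a b| <= 2 * e * B * T / (eta / 4) ^+ 2 * (`|a1 - a| + `|b1 - b|).
  apply: (wind_segment T0 dx dy cu cv xT yT hB e0 e4) => s t /andP[s0 s1] _.
  have := h t; rewrite /dist2 => ht.
  have := sqr_ge0 (x t - a - 2 * (s * (a1 - a))); have := sqr_ge0 (y t - b - 2 * (s * (b1 - b))).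
  have : s ^+ 2 * ((a1 - a) ^+ 2 + (b1 - b) ^+ 2) <= eta / 4.
    have s2 : s ^+ 2 <= 1 by rewrite expr2 mulr_ile1.
    apply: (le_trans (ler_wpM2r _ s2)); first by rewrite addr_ge0 ?sqr_ge0.
    by rewrite mul1r (le_trans (ltW hd)).
  by lra.
have lim := wind_limit T dx dy cu cv (ltW e0) eta0 h.
have ab (z : R) : z ^+ 2 <= 1 -> `|z| <= 1.
  by move=> hz; rewrite -(@ler_pXn2r _ 2) ?nnegrE // expr1n real_normK ?num_real.
have n1 : `|a1 - a| <= 1 by apply: ab; have := sqr_ge0 (b1 - b); lra.
have n2 : `|b1 - b| <= 1 by apply: ab; have := sqr_ge0 (a1 - a); lra.
have seg2 : `|owind e a1 b1 - owind e a b| <= K * e.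
  apply: (le_trans seg); rewrite /K.
  have -> : 2 * B * T / (eta / 4) ^+ 2 * 2 * e = 2 * e * B * T / (eta / 4) ^+ 2 * 2 by ring.
  rewrite ler_wpM2l //; last by lra.
  by rewrite divr_ge0 ?sqr_ge0 // !mulr_ge0 // ltW.
rewrite mulrDl (_ : owind e a1 b1 - owind 0 a b =
  (owind e a1 b1 - owind e a b) + (owind e a b - owind 0 a b)); last by ring.
by apply: (le_trans (ler_normD _ _)); rewrite lerD // mulrC.
Qed.

(** The distance of two points is at least the difference of their radii. *)
Lemma radius_dist rho s th t : 0 <= s ->
  (forall g : R, 0 <= g -> g ^+ 2 = x t ^+ 2 + y t ^+ 2 -> rho ^+ 2 <= (s - g) ^+ 2) ->
  rho ^+ 2 <= dist2 x y (s * cos th) (s * sin th) t.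
Proof.
move=> s0 hg; pose g := Num.sqrt (x t ^+ 2 + y t ^+ 2).
have g0 : 0 <= g by exact: sqrtr_ge0.
have g2 : g ^+ 2 = x t ^+ 2 + y t ^+ 2 by rewrite sqr_sqrtr // addr_ge0 ?sqr_ge0.
apply: (le_trans (hg g g0 g2)); pose n := x t * cos th + y t * sin th.
have n2 : n ^+ 2 <= g ^+ 2.
  have -> : g ^+ 2 = (x t ^+ 2 + y t ^+ 2) * (cos th ^+ 2 + sin th ^+ 2) by rewrite cos2Dsin2 mulr1.
  by rewrite /n; have := sqr_ge0 (x t * sin th - y t * cos th); lra.
have ng : n <= g.
  apply: (le_trans (ler_norm _)).
  by rewrite -(@ler_pXn2r _ 2) ?nnegrE // real_normK ?num_real.
have -> : dist2 x y (s * cos th) (s * sin th) t = g ^+ 2 - 2 * s * n + s ^+ 2.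
  have -> : s ^+ 2 = s ^+ 2 * (cos th ^+ 2 + sin th ^+ 2) by rewrite cos2Dsin2 mulr1.
  by rewrite g2 /dist2 /n; ring.
have := mulr_ge0 s0 (_ : 0 <= g - n); rewrite subr_ge0 => /(_ ng); lra.
Qed.

(** The point at radius [rb + 1 / l] on the same ray is far from the orbit, so
    the winding number is small there ([wind_far]); the way to it has length
    [1 / l], but the gradient is of order [l ^+ 4] off the orbit. *)
Lemma owind_outer rho rb : 0 <= rho -> rho < rb ->
  (forall t, 0 <= t <= T -> x t ^+ 2 + y t ^+ 2 <= rho ^+ 2) ->
  forall d, 0 < d -> for_small (fun l => forall th, `|owind (l ^+ 4) (rb * cos th) (rb * sin th)| <= d).
Proof.
move=> rho0 rr hin d d0; have [B B0 hB] := vel_bound.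
pose eta := (rb - rho) ^+ 2.
have eta0 : 0 < eta by rewrite exprn_gt0 // subr_gt0.
pose K := 2 * B * T + 2 * B * T / eta ^+ 2 * 2.
have BT : 0 <= 2 * B * T by rewrite !mulr_ge0 // ltW.
have K0 : 0 <= K by rewrite addr_ge0 // mulr_ge0 // divr_ge0 ?sqr_ge0.
apply: for_small_sub (for_small_linear K0 d0) => l /andP[l0 l1] hl th; apply: le_trans hl.
have gle t g : 0 <= t <= T -> 0 <= g -> g ^+ 2 = x t ^+ 2 + y t ^+ 2 -> g <= rho.
  by move=> tT g0 e; rewrite -(@ler_pXn2r _ 2) ?nnegrE // e hin.
have e0 : 0 < l ^+ 4 by rewrite exprn_gt0.
have il : 0 < l^-1 by rewrite invr_gt0.
pose L := rb + l^-1.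
have far : `|owind (l ^+ 4) (L * cos th) (L * sin th)| <= 2 * B * T * l.
  rewrite -[l in leRHS]invrK; apply: (wind_far T0 B0 dx dy cu cv hB e0 il) => t tT.
  apply: radius_dist => [|g g0 eg]; first by rewrite /L; lra.
  have := gle t g tT g0 eg; rewrite /L => ?.
  by rewrite ler_pXn2r ?nnegrE //; lra.
have seg : `|owind (l ^+ 4) (L * cos th) (L * sin th) -
    owind (l ^+ 4) (rb * cos th) (rb * sin th)| <=
    2 * l ^+ 4 * B * T / eta ^+ 2 * (`|L * cos th - rb * cos th| + `|L * sin th - rb * sin th|).
  apply: (wind_segment T0 dx dy cu cv xT yT hB e0 eta0) => s t /andP[s0 s1] tT.
  rewrite (_ : rb * cos th + _ = (rb + s * l^-1) * cos th); last by rewrite /L; ring.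
  rewrite (_ : rb * sin th + _ = (rb + s * l^-1) * sin th); last by rewrite /L; ring.
  have sl : 0 <= s * l^-1 by rewrite mulr_ge0 // ltW.
  apply: radius_dist => [|g g0 eg]; first by lra.
  have := gle t g tT g0 eg => ?.
  by rewrite ler_pXn2r ?nnegrE //; lra.
have c1 : `|L * cos th - rb * cos th| <= l^-1.
  rewrite -mulrBl /L addrAC subrr add0r normrM (gtr0_norm il) ler_piMr ?(ltW il) //.
  by rewrite ler_norml cos_geN1 cos_le1.
have c2 : `|L * sin th - rb * sin th| <= l^-1.
  rewrite -mulrBl /L addrAC subrr add0r normrM (gtr0_norm il) ler_piMr ?(ltW il) //.
  by rewrite ler_norml sin_geN1 sin_le1.
have seg2 : `|owind (l ^+ 4) (L * cos th) (L * sin th) -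
    owind (l ^+ 4) (rb * cos th) (rb * sin th)| <= 2 * B * T / eta ^+ 2 * 2 * l.
  apply: (le_trans seg).
  apply: (@le_trans _ _ (2 * l ^+ 4 * B * T / eta ^+ 2 * (2 * l^-1))).
    rewrite ler_wpM2l //; last by lra.
    by rewrite divr_ge0 ?sqr_ge0 // !mulr_ge0 // ltW.
  have -> : 2 * l ^+ 4 * B * T / eta ^+ 2 * (2 * l^-1) =
      2 * B * T / eta ^+ 2 * 2 * (l ^+ 2 * l).
    by field; rewrite !gt_eqF.
  rewrite ler_wpM2l //; first by rewrite mulr_ge0 // divr_ge0 ?sqr_ge0.
  by rewrite ler_piMl ?(ltW l0) // expr2 mulr_ile1 // ltW.
have := ler_normB (owind (l ^+ 4) (L * cos th) (L * sin th))
  (owind (l ^+ 4) (L * cos th) (L * sin th) - owind (l ^+ 4) (rb * cos th) (rb * sin th)).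
rewrite opprB addrC subrK /K => hn; rewrite mulrDl.
lra.
Qed.

(** The whole disc of radius [ra] is off the orbit, so the winding number stays
    close to its value at the origin. *)
Lemma owind_inner ra : 0 <= ra ->
  (forall t, ra ^+ 2 < x t ^+ 2 + y t ^+ 2) ->
  forall d, 0 < d -> for_small (fun l => forall th,
    `|owind (l ^+ 4) (ra * cos th) (ra * sin th) - owind 0 0 0| <= d).
Proof.
move=> ra0 hout d d0; have [B B0 hB] := vel_bound.
have T1 := ltW T0.
have [m m0 hm] : exists2 m, 0 < m & forall t, 0 <= t <= T -> m <= x t ^+ 2 + y t ^+ 2 - ra ^+ 2.
  apply: segment_min => //; first by have ccx := cx; have ccy := cy; cont.
  by move=> t _; rewrite subr_gt0.
have [rho [rho1 rho2]] : exists rho, ra < rho /\ rho ^+ 2 = m + ra ^+ 2.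
  exists (Num.sqrt (m + ra ^+ 2)); have s0 : 0 <= m + ra ^+ 2 by rewrite addr_ge0 ?sqr_ge0 ?ltW.
  split; last by rewrite sqr_sqrtr.
  by rewrite -(@ltr_pXn2r _ 2) ?nnegrE ?sqrtr_ge0 // sqr_sqrtr // ltrDr.
have gge t g : 0 <= g -> g ^+ 2 = x t ^+ 2 + y t ^+ 2 -> rho <= g.
  move=> g0 e; rewrite -(@ler_pXn2r _ 2) ?nnegrE // ?(le_trans ra0 (ltW rho1)) // e rho2.
  have [s sT [ex ey]] := period_reduce per t.
  by have := hm s sT; rewrite ex ey; lra.
pose eta := (rho - ra) ^+ 2.
have eta0 : 0 < eta by rewrite exprn_gt0 // subr_gt0.
have off0 t : eta <= dist2 x y 0 0 t.
  rewrite (_ : 0 = 0 * cos 0); last by rewrite mul0r.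
  rewrite {2}(_ : 0 * cos 0 = 0 * sin 0); last by rewrite !mul0r.
  apply: radius_dist => // g g0 eg; have := gge t g g0 eg => ?.
  rewrite (_ : (0 - g) ^+ 2 = g ^+ 2); last by ring.
  by rewrite /eta ler_pXn2r ?nnegrE //; lra.
pose I := RI 0 T (fun t => `|(x t - 0) * vel_y t - (y t - 0) * vel_x t|) / eta ^+ 2.
have I0 : 0 <= I by rewrite divr_ge0 ?sqr_ge0 // RI_ge0.
pose K := I + 2 * B * T / eta ^+ 2 * (2 * ra).
have BT : 0 <= 2 * B * T by rewrite !mulr_ge0 // ltW.
have K1 : 0 <= 2 * B * T / eta ^+ 2 * (2 * ra).
  by apply: mulr_ge0; [apply: divr_ge0 => //; exact: sqr_ge0|exact: mulr_ge0].
have K0 : 0 <= K by rewrite addr_ge0.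
apply: for_small_sub (for_small_linear K0 d0) => l /andP[l0 l1] hl th; apply: le_trans hl.
have e0 : 0 < l ^+ 4 by rewrite exprn_gt0.
have lim := wind_limit T dx dy cu cv (ltW e0) eta0 off0.
have seg : `|owind (l ^+ 4) (ra * cos th) (ra * sin th) - owind (l ^+ 4) 0 0| <=
    2 * l ^+ 4 * B * T / eta ^+ 2 * (`|ra * cos th - 0| + `|ra * sin th - 0|).
  apply: (wind_segment T0 dx dy cu cv xT yT hB e0 eta0) => s t /andP[s0 s1] tT.
  rewrite (_ : 0 + _ = (s * ra) * cos th); last by ring.
  rewrite (_ : 0 + _ = (s * ra) * sin th); last by ring.
  have sl : 0 <= s * ra by rewrite mulr_ge0.
  have sl1 : s * ra <= ra by rewrite ler_piMl.
  apply: radius_dist => [|g g0 eg] //.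
  have := gge t g g0 eg => ?.
  rewrite (_ : (s * ra - g) ^+ 2 = (g - s * ra) ^+ 2); last by ring.
  by rewrite /eta ler_pXn2r ?nnegrE //; lra.
have c1 : `|ra * cos th - 0| <= ra.
  by rewrite subr0 normrM (ger0_norm ra0) ler_piMr // ler_norml cos_geN1 cos_le1.
have c2 : `|ra * sin th - 0| <= ra.
  by rewrite subr0 normrM (ger0_norm ra0) ler_piMr // ler_norml sin_geN1 sin_le1.
have l4 : l ^+ 4 <= l.
  by rewrite exprS ler_piMr ?(ltW l0) // exprn_ile1 ?(ltW l0).
have seg2 : `|owind (l ^+ 4) (ra * cos th) (ra * sin th) - owind (l ^+ 4) 0 0| <=
    2 * B * T / eta ^+ 2 * (2 * ra) * l.
  apply: (le_trans seg).
  apply: (@le_trans _ _ (2 * l ^+ 4 * B * T / eta ^+ 2 * (2 * ra))).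
    rewrite ler_wpM2l //; last by lra.
    by rewrite divr_ge0 ?sqr_ge0 // !mulr_ge0 // ltW.
  have -> : 2 * l ^+ 4 * B * T / eta ^+ 2 * (2 * ra) =
      2 * B * T / eta ^+ 2 * (2 * ra) * l ^+ 4 by ring.
  by rewrite ler_wpM2l.
have lim2 : `|owind (l ^+ 4) 0 0 - owind 0 0 0| <= I * l.
  by apply: (le_trans lim); rewrite mulrC ler_wpM2l.
rewrite /K mulrDl (_ : owind (l ^+ 4) (ra * cos th) (ra * sin th) - owind 0 0 0 =
  (owind (l ^+ 4) 0 0 - owind 0 0 0) +
  (owind (l ^+ 4) (ra * cos th) (ra * sin th) - owind (l ^+ 4) 0 0)); last by ring.
by apply: (le_trans (ler_normD _ _)); rewrite lerD.
Qed.

(** By the formulas for the gradient, the derivative along the field at a point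
    is an integral over the orbit of the cross product of the field at the two
    points; [cross_pointwise] bounds it by [l] times the kernel of
    [triple_kernel].  It is small in the mean only: close to the orbit it is
    not small. *)
Lemma owind_along ra rb : 0 <= ra -> ra < rb ->
  (forall t, 0 < x t ^+ 2 + y t ^+ 2 <= rb ^+ 2) ->
  forall d, 0 < d -> for_small (fun l => RI ra rb (fun r => RI 0 (2 * pi) (fun th =>
     `|along_field P Q (fun l => owind_x (l ^+ 4)) (fun l => owind_y (l ^+ 4)) l r th|)) <= d).
Proof.
move=> ra0 rab hin d d0; have T1 := ltW T0.
have rb0 : 0 < rb := le_lt_trans ra0 rab.
have [s0 s00 hs] : exists2 m, 0 < m & forall t, 0 <= t <= T -> m <= x t ^+ 2 + y t ^+ 2.
  apply: segment_min => //; first by have ccx := cx; have ccy := cy; cont.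
  by move=> t _; case/andP: (hin t).
have xyb t : `|x t| <= rb /\ `|y t| <= rb.
  have /andP[_ h] := hin t; have hx := sqr_ge0 (x t); have hy := sqr_ge0 (y t).
  split; rewrite -(@ler_pXn2r _ 2) ?nnegrE ?(ltW rb0) // real_normK ?num_real //; lra.
have [LP LP0 hP] := eval2_lip P rb; have [LQ LQ0 hQ] := eval2_lip Q rb.
have [BP BP0 bP] := square_bounded rb (eval2_cont (F := P)).
have [BQ BQ0 bQ] := square_bounded rb (eval2_cont (F := Q)).
pose K := BQ * LP + BP * LQ.
have K0 : 0 <= K by rewrite addr_ge0 // mulr_ge0 // ltW.
have xyM t : 0 <= t <= T -> `|x t| + `|y t| <= 2 * rb.
  by move=> _; have [] := xyb t; lra.
pose Ci := pi * ((2 * pi + (1 + 2 * rb * pi / 2) * (2 * pi) / s0) * T).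
have pp : 0 < pi :> R := pi_gt0 R.
have p2 : 0 <= 2 * pi :> R by rewrite mulr_ge0 // ltW.
have Ci0 : 0 <= Ci.
  have h1 : 0 <= 1 + 2 * rb * pi / 2.
    by rewrite addr_ge0 // divr_ge0 // mulr_ge0 ?(ltW pp) // mulr_ge0 // ltW.
  have h2 := divr_ge0 (mulr_ge0 h1 p2) (ltW s00).
  exact: (mulr_ge0 (ltW pp) (mulr_ge0 (addr_ge0 p2 h2) T1)).
have KC : 0 <= 2 * K * Ci by exact: (mulr_ge0 (mulr_ge0 (ler0n _ 2) K0) Ci0).
apply: for_small_sub (for_small_linear KC d0) => l /andP[l0 l1] hl; apply: le_trans hl.
have e0 : 0 < l ^+ 4 by rewrite exprn_gt0.
have l2 : 0 < l ^+ 2 by rewrite exprn_gt0.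
have l21 : l ^+ 2 <= 1 by rewrite expr2 mulr_ile1 // ltW.
have cx1 := wind_x_cont T0 dx dy cv e0; have cy1 := wind_y_cont T0 dx dy cu e0.
have cP := eval2_cont (F := P); have cQ := eval2_cont (F := Q).
have ca : continuous (fun z : R * R =>
   along_field P Q (fun l => owind_x (l ^+ 4)) (fun l => owind_y (l ^+ 4)) l z.1 z.2).
  by rewrite /along_field /owind_x /owind_y; cont.
have ck := ray_kernel_cont cx cy l2.
have ck2 : continuous (fun z : R * R => RI 0 T (ray_kernel x y (l ^+ 2) z.1 z.2)).
  by apply: (@RI_cont _ _ (fun (z : R * R) t => ray_kernel x y (l ^+ 2) z.1 z.2 t)).
have pt r th : ra <= r <= rb ->
    `|along_field P Q (fun l => owind_x (l ^+ 4)) (fun l => owind_y (l ^+ 4)) l r th| <=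
    2 * K * l * RI 0 T (ray_kernel x y (l ^+ 2) r th).
  move=> /andP[r1 r2]; have r0 := le_trans ra0 r1.
  set a := r * cos th; set b := r * sin th.
  have ha : `|a| <= rb.
    by rewrite /a normrM (ger0_norm r0) (le_trans _ r2) // ler_piMr // ler_norml cos_geN1 cos_le1.
  have hb : `|b| <= rb.
    by rewrite /b normrM (ger0_norm r0) (le_trans _ r2) // ler_piMr // ler_norml sin_geN1 sin_le1.
  have cd : continuous (fun t => (dist2 x y a b t + l ^+ 4) ^- 2).
    apply: contV => [t|]; first by rewrite expf_neq0 // gt_eqF // ltr_wpDl // dist2_ge0.
    by have h := dist2_cont_t dx dy (a := a) (b := b); cont.
  have ci (f : R -> R) : continuous f -> continuous (fun t => f t / (dist2 x y a b t + l ^+ 4) ^+ 2).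
    by move=> cf; exact: (contM cf cd).
  have ccu := cu; have ccv := cv; have h1 := ci _ ccu; have h2 := ci _ ccv.
  pose C t := eval2 Q a b * vel_x t - eval2 P a b * vel_y t.
  have cC : continuous C by rewrite /C; cont.
  have h3 := ci _ cC.
  have -> : along_field P Q (fun l => owind_x (l ^+ 4)) (fun l => owind_y (l ^+ 4)) l r th =
      RI 0 T (fun t => 2 * l ^+ 4 * (C t / (dist2 x y a b t + l ^+ 4) ^+ 2)).
    rewrite /along_field /owind_x /owind_y /wind_x /wind_y -/a -/b.
    set I1 := RI 0 T _; set I2 := RI 0 T _.
    have -> : eval2 P a b * (- (2 * l ^+ 4) * I1) + eval2 Q a b * (2 * l ^+ 4 * I2) =
       2 * l ^+ 4 * (eval2 Q a b * I2) + - (2 * l ^+ 4) * (eval2 P a b * I1) by ring.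
    rewrite /I1 /I2 -!RIZ; try by cont.
    rewrite -RID; try by cont.
    by apply: RI_eq => t _; rewrite /C; ring.
  have ckr : continuous (ray_kernel x y (l ^+ 2) r th).
    exact: (cont_curry (V := (R * R)%type) (F := fun z t => ray_kernel x y (l ^+ 2) z.1 z.2 t) (v := (r, th)) ck).
  rewrite -RIZ //; apply: (le_trans (RI_norm _ _ _)); first by cont.
  apply: RI_le; [by cont|by cont|move=> t tT].
  have [hx hy] := xyb t.
  apply: cross_pointwise => //.
  + rewrite /C (_ : _ - _ = eval2 Q a b * (eval2 P (x t) (y t) - eval2 P a b) -
       eval2 P a b * (eval2 Q (x t) (y t) - eval2 Q a b)); last by rewrite /vel_x /vel_y; ring.
    apply: (le_trans (ler_normB _ _)); rewrite !normrM /K mulrDl -!mulrA.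
    by apply: lerD; apply: ler_pM => //; [exact: bQ|exact: hP|exact: bP|exact: hQ].
  + apply/eqP; rewrite -subr_eq0; apply/eqP.
    transitivity ((r ^+ 2 - x t ^+ 2 - y t ^+ 2) * (cos th ^+ 2 + sin th ^+ 2 - 1)).
      by rewrite /a /b; ring.
    by rewrite cos2Dsin2 subrr mulr0.
pose cB := 2 * K * l.
have cB0 : 0 <= cB by rewrite !mulr_ge0 // ltW.
have cI : continuous (fun r => RI 0 (2 * pi) (fun th => RI 0 T (ray_kernel x y (l ^+ 2) r th))).
  by apply: (@RI_cont _ _ (fun r th => RI 0 T (ray_kernel x y (l ^+ 2) r th))).
have ckq (r : R) : continuous (fun th => RI 0 T (ray_kernel x y (l ^+ 2) r th)).
  exact: (cont_curry (F := fun r th : R => RI 0 T (ray_kernel x y (l ^+ 2) r th)) (v := r) ck2).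
have caq (r : R) : continuous (fun th => along_field P Q (fun l => owind_x (l ^+ 4))
    (fun l => owind_y (l ^+ 4)) l r th).
  exact: (cont_curry (F := fun r th : R => along_field P Q (fun l => owind_x (l ^+ 4))
    (fun l => owind_y (l ^+ 4)) l r th) (v := r) ca).
apply: (@le_trans _ _ (RI ra rb (fun r => cB * RI 0 (2 * pi) (fun th =>
    RI 0 T (ray_kernel x y (l ^+ 2) r th))))).
  apply: RI_le; last 1 first.
  - move=> r hr.
    have ckr := ckq r; have car := caq r.
    rewrite -RIZ //; apply: RI_le; [by cont|by cont|move=> th _].
    exact: pt.
  - have can : continuous (fun z : R * R => `|along_field P Q (fun l => owind_x (l ^+ 4))
      (fun l => owind_y (l ^+ 4)) l z.1 z.2|) by cont.
    exact: (RI_cont (f := fun r th : R => `|along_field P Q (fun l => owind_x (l ^+ 4))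
      (fun l => owind_y (l ^+ 4)) l r th|) can p2).
  - by cont.
rewrite RIZ // (_ : 2 * K * Ci * l = cB * Ci); last by rewrite /cB; ring.
by rewrite ler_wpM2l //; apply: triple_kernel => //; exact: ltW.
Qed.
End OneOrbit.

(** * Two periodic orbits in an annulus without roots *)

Section TwoOrbits.
Context {R : realType}.

Lemma for_small_combine (A B : R -> R -> R) (c : R) :
  (forall d, 0 < d -> for_small (fun l => forall th, `|A l th| <= d)) ->
  (forall d, 0 < d -> for_small (fun l => forall th, `|B l th| <= d)) ->
  forall d, 0 < d -> for_small (fun l => forall th, `|c * A l th + B l th| <= d).
Proof.
move=> hA hB d d0; have c1 : 0 < `|c| + 1 by rewrite ltr_wpDl.
have dA : 0 < d / 2 / (`|c| + 1) by rewrite !divr_gt0.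
have dB : 0 < d / 2 by rewrite divr_gt0.
apply: for_small_sub (for_smallI (hA _ dA) (hB _ dB)) => l _ [h1 h2] th.
apply: (le_trans (ler_normD _ _)); rewrite normrM.
have e1 : (`|c| + 1) * `|A l th| <= d / 2 by rewrite mulrC -ler_pdivlMr.
have := h2 th; have := normr_ge0 (A l th); lra.
Qed.

Lemma RI2_combine (A1 A2 A : R -> R -> R) (c a b a' b' d : R) : a' <= b' ->
  continuous (fun z : R * R => A1 z.1 z.2) -> continuous (fun z : R * R => A2 z.1 z.2) ->
  (forall r th, A r th = c * A1 r th + A2 r th) ->
  RI a b (fun r => RI a' b' (fun th => `|A1 r th|)) <= d / 2 / (`|c| + 1) ->
  RI a b (fun r => RI a' b' (fun th => `|A2 r th|)) <= d / 2 ->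
  RI a b (fun r => RI a' b' (fun th => `|A r th|)) <= d.
Proof.
move=> ab cA1 cA2 eA h1 h2; have cc : 0 < `|c| + 1 by rewrite ltr_wpDl.
have cI (F : R -> R -> R) : continuous (fun z : R * R => F z.1 z.2) ->
    continuous (fun r => RI a' b' (fun th => `|F r th|)).
  move=> cF; have cN : continuous (fun z : R * R => `|F z.1 z.2|) by cont.
  exact: (RI_cont (f := fun r th : R => `|F r th|) cN ab).
have cA : continuous (fun z : R * R => A z.1 z.2).
  by rewrite (_ : (fun z : R * R => _) = (fun z => c * A1 z.1 z.2 + A2 z.1 z.2)); [cont|apply/funext].
have i1 := cI _ cA1; have i2 := cI _ cA2; have i3 := cI _ cA.
apply: (@le_trans _ _ (RI a b (fun r => `|c| * RI a' b' (fun th => `|A1 r th|) +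
    RI a' b' (fun th => `|A2 r th|)))).
  apply: RI_le; [by []|by cont|move=> r _].
  have j1 := cont_curry (F := A1) (v := r) cA1; have j2 := cont_curry (F := A2) (v := r) cA2.
  have j3 := cont_curry (F := A) (v := r) cA.
  rewrite -RIZ; last by cont.
  rewrite -RID; [|by cont|by cont].
  apply: RI_le; [by cont|by cont|move=> th _].
  by rewrite eA (le_trans (ler_normD _ _)) // normrM.
rewrite RID // ?RIZ //; last by cont.
have n1 : 0 <= RI a b (fun r => RI a' b' (fun th => `|A1 r th|)).
  by apply: RI_ge0 => r _; apply: RI_ge0 => th _.
have e1 : (`|c| + 1) * RI a b (fun r => RI a' b' (fun th => `|A1 r th|)) <= d / 2.
  by rewrite mulrC -ler_pdivlMr.
lra.
Qed.

Lemma along_field_cont (P Q : bipoly R) (bx by_ : R -> R -> R -> R) (l : R) :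
  continuous (fun z : R * R => bx l z.1 z.2) -> continuous (fun z : R * R => by_ l z.1 z.2) ->
  continuous (fun z : R * R => along_field P Q bx by_ l z.1 z.2).
Proof.
move=> c1 c2; have cP := eval2_cont (F := P); have cQ := eval2_cont (F := Q).
by rewrite /along_field; cont.
Qed.

Lemma orbit_inside (P Q : bipoly R) x y T (rb : R) : periodic_solution P Q x y T -> 0 < rb ->
  (forall t, x t ^+ 2 + y t ^+ 2 < rb ^+ 2) ->
  exists rho, [/\ 0 <= rho, rho < rb & forall t, 0 <= t <= T -> x t ^+ 2 + y t ^+ 2 <= rho ^+ 2].
Proof.
move=> per rb0 h; have cx := orbit_cx per; have cy := orbit_cy per.
have T0 := orbit_T_gt0 per.
have [m m0 hm] : exists2 m, 0 < m & forall t, 0 <= t <= T -> m <= rb ^+ 2 - (x t ^+ 2 + y t ^+ 2).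
  by apply: segment_min; [exact: ltW|cont|move=> t _; rewrite subr_gt0].
have p0 : 0 <= rb ^+ 2 - m.
  have := hm 0; rewrite lexx ltW // => /(_ isT).
  by have := sqr_ge0 (x 0); have := sqr_ge0 (y 0); lra.
exists (Num.sqrt (rb ^+ 2 - m)); split; first exact: sqrtr_ge0.
- by rewrite -(@ltr_pXn2r _ 2) ?nnegrE ?sqrtr_ge0 ?(ltW rb0) // sqr_sqrtr //; lra.
- by move=> t tT; rewrite sqr_sqrtr //; have := hm t tT; lra.
Qed.

Lemma near0_gt0 (f : R -> R) : continuous f -> 0 < f 0 ->
  exists2 s, 0 < s & forall t, `|t| <= s -> 0 < f t.
Proof.
move=> cf f0; have /cvgrPdist_lt/(_ (f 0) f0) := cf 0.
move=> /nbhs_ballP[r /= r0 hr]; exists (r / 2); first by rewrite divr_gt0.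
move=> t ht; have := hr t; rewrite /ball /= sub0r normrN => h.
have := h ltac:(lra); rewrite ltr_norml => /andP[_]; lra.
Qed.

Variables (P Q : bipoly R) (w : {poly R}) (k ra rb : R).
Hypotheses (k0 : 0 < k) (ra0 : 0 <= ra) (rab : ra < rb).
Hypothesis w_neq0 : forall r, ra <= r <= rb -> w.[r] != 0.
Hypothesis M_neg : forall r th, 0 < r -> 0 <= th <= 2 * pi -> dulacM P Q k w r th < 0.
Hypotheses (P0 : eval2 P 0 0 = 0) (Q0 : eval2 Q 0 0 = 0).
Variables (x1 y1 x2 y2 : R -> R) (T1 T2 : R).
Hypotheses (per1 : periodic_solution P Q x1 y1 T1) (per2 : periodic_solution P Q x2 y2 T2).
Hypothesis in1 : forall t, ra ^+ 2 < x1 t ^+ 2 + y1 t ^+ 2 < rb ^+ 2.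
Hypothesis in2 : forall t, ra ^+ 2 < x2 t ^+ 2 + y2 t ^+ 2 < rb ^+ 2.
Variable c1 : R.
Hypothesis sep : c1 = 0 \/ forall t s, ~ (x1 t = x2 s /\ y1 t = y2 s).
Hypothesis hole : ra = 0 \/ c1 * owind P Q x1 y1 T1 0 0 0 + owind P Q x2 y2 T2 0 0 0 = 0.

(* The weight of the Dulac argument; [hole] makes it vanish in the limit on the
   disc that the annulus surrounds, and [sep] keeps the jump across the second orbit from being
   cancelled by a jump across the first one. *)
Let N1 := owind P Q x1 y1 T1.
Let N2 := owind P Q x2 y2 T2.
Let beta l a b := c1 * N1 (l ^+ 4) a b + N2 (l ^+ 4) a b.
Let bx l a b := c1 * owind_x Q x1 y1 T1 (l ^+ 4) a b + owind_x Q x2 y2 T2 (l ^+ 4) a b.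
Let by_ l a b := c1 * owind_y P x1 y1 T1 (l ^+ 4) a b + owind_y P x2 y2 T2 (l ^+ 4) a b.

Let l4 (l : R) : 0 < l -> 0 < l ^+ 4. Proof. exact: exprn_gt0. Qed.

Let cont_w x y T (per : periodic_solution P Q x y T) e : 0 < e ->
  [/\ continuous (fun z : R * R => owind P Q x y T e z.1 z.2),
      continuous (fun z : R * R => owind_x Q x y T e z.1 z.2) &
      continuous (fun z : R * R => owind_y P x y T e z.1 z.2)].
Proof.
move=> e0; have T0 := orbit_T_gt0 per; have dx := orbit_dx per; have dy := orbit_dy per.
have cu := vel_x_cont per; have cv := vel_y_cont per.
split; first exact: (wind_cont T0 dx dy cu cv e0).
- exact: (wind_x_cont T0 dx dy cv e0).
- exact: (wind_y_cont T0 dx dy cu e0).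
Qed.

Let beta_cont l : 0 < l -> continuous (fun z : R * R => beta l z.1 z.2).
Proof.
move=> /l4 l0; have [h1 _ _] := cont_w per1 l0; have [h2 _ _] := cont_w per2 l0.
by rewrite /beta /N1 /N2; cont.
Qed.

Let bx_cont l : 0 < l -> continuous (fun z : R * R => bx l z.1 z.2).
Proof.
move=> /l4 l0; have [_ h1 _] := cont_w per1 l0; have [_ h2 _] := cont_w per2 l0.
by rewrite /bx; cont.
Qed.

Let by_cont l : 0 < l -> continuous (fun z : R * R => by_ l z.1 z.2).
Proof.
move=> /l4 l0; have [_ _ h1] := cont_w per1 l0; have [_ _ h2] := cont_w per2 l0.
by rewrite /by_; cont.
Qed.

Let beta_chain l (a b a' b' : R -> R) (s : R) : 0 < l ->
  (forall s : R, isd s a (a' s)) -> (forall s : R, isd s b (b' s)) ->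
  continuous a' -> continuous b' ->
  isd s (fun s => beta l (a s) (b s)) (bx l (a s) (b s) * a' s + by_ l (a s) (b s) * b' s).
Proof.
move=> /l4 l0 da db ca cb.
have h1 := owind_chain per1 s l0 da db ca cb.
have h2 := owind_chain per2 s l0 da db ca cb.
by rewrite /beta /N1 /N2 /bx /by_; isd; ring.
Qed.

Let rb0 : 0 < rb. Proof. exact: le_lt_trans ra0 rab. Qed.

Let beta_outer d : 0 < d -> for_small (fun l => forall th, `|beta l (rb * cos th) (rb * sin th)| <= d).
Proof.
have [rho1 [p1 q1 i1]] := orbit_inside per1 rb0 (fun t => (andP (in1 t)).2).
have [rho2 [p2 q2 i2]] := orbit_inside per2 rb0 (fun t => (andP (in2 t)).2).
move: d; apply: (@for_small_combine (fun l th => N1 (l ^+ 4) (rb * cos th) (rb * sin th))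
                  (fun l th => N2 (l ^+ 4) (rb * cos th) (rb * sin th)) c1).
- exact: (owind_outer per1 p1 q1 i1).
- exact: (owind_outer per2 p2 q2 i2).
Qed.

Let beta_inner : ra = 0 \/ forall d, 0 < d ->
  for_small (fun l => forall th, `|beta l (ra * cos th) (ra * sin th)| <= d).
Proof.
case: hole => [->|h0]; [by left|right].
have h1 := owind_inner per1 ra0 (fun t => (andP (in1 t)).1).
have h2 := owind_inner per2 ra0 (fun t => (andP (in2 t)).1).
move=> d d0; apply: for_small_sub (for_small_combine c1 h1 h2 d0) => l _ h th; apply: le_trans (h th).
rewrite le_eqVlt; apply/orP; left; apply/eqP; congr (`| _ |).
by rewrite /beta /N1 /N2 mulrBr; move: h0; lra.
Qed.

Let off0 x y T (per : periodic_solution P Q x y T) :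
  (forall t, ra ^+ 2 < x t ^+ 2 + y t ^+ 2 < rb ^+ 2) ->
  forall t, 0 < x t ^+ 2 + y t ^+ 2 <= rb ^+ 2.
Proof. by move=> h t; rewrite (orbit_neq0 per) //=; case/andP: (h t) => _ /ltW. Qed.

Let along_small d : 0 < d ->
  for_small (fun l => RI ra rb (fun r => RI 0 (2 * pi) (fun th => `|along_field P Q bx by_ l r th|)) <= d).
Proof.
move=> d0; have cc : 0 < `|c1| + 1 by rewrite ltr_wpDl.
have dA : 0 < d / 2 / (`|c1| + 1) by rewrite !divr_gt0.
have dB : 0 < d / 2 by rewrite divr_gt0.
have h1 := owind_along per1 ra0 rab (off0 per1 in1) dA.
have h2 := owind_along per2 ra0 rab (off0 per2 in2) dB.
apply: for_small_sub (for_smallI h1 h2) => l /andP[l0 _] [{}h1 {}h2].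
have [_ cx1 cy1] := cont_w per1 (l4 l0); have [_ cx2 cy2] := cont_w per2 (l4 l0).
pose A1 r th := along_field P Q (fun l => owind_x Q x1 y1 T1 (l ^+ 4))
                  (fun l => owind_y P x1 y1 T1 (l ^+ 4)) l r th.
pose A2 r th := along_field P Q (fun l => owind_x Q x2 y2 T2 (l ^+ 4))
                  (fun l => owind_y P x2 y2 T2 (l ^+ 4)) l r th.
have cA1 : continuous (fun z : R * R => A1 z.1 z.2) by exact: along_field_cont cx1 cy1.
have cA2 : continuous (fun z : R * R => A2 z.1 z.2) by exact: along_field_cont cx2 cy2.
have eA r th : along_field P Q bx by_ l r th = c1 * A1 r th + A2 r th.
  by rewrite /A1 /A2 /along_field /bx /by_; ring.
have p2 : 0 <= 2 * pi :> R by rewrite mulr_ge0 // pi_ge0.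
exact: (RI2_combine p2 cA1 cA2 eA h1 h2).
Qed.

Let dist_pos x y T (per : periodic_solution P Q x y T) (a b : R) :
  (forall t, ~ (x t = a /\ y t = b)) -> exists2 eta, 0 < eta & forall t, eta <= dist2 x y a b t.
Proof.
move=> h; have cd := dist2_cont_t (orbit_dx per) (orbit_dy per) (a := a) (b := b).
have [|m m0 hm] := segment_min (ltW (orbit_T_gt0 per)) cd.
  move=> t _; rewrite ltNge; apply/negP => /sum_sqr_le0[/eqP + /eqP].
  by rewrite !subr_eq0 => /eqP e1 /eqP e2; exact: (h t).
exists m => // t; have [s sT [ex ey]] := period_reduce per t.
by have := hm s sT; rewrite /dist2 ex ey.
Qed.

(** Close to the point of the second orbit at time T2 / 2 the multiple [c1] of
    the first winding number is constant in the limit, while the second winding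
    number takes two different values: the combination is 0 on at most one of
    the two sides. *)
Let large : exists r0 th0 c eta, [/\ ra < r0 < rb, 0 <= th0 <= 2 * pi, 0 < c, 0 < eta &
  for_small (fun l => forall a b : R,
    (a - r0 * cos th0) ^+ 2 + (b - r0 * sin th0) ^+ 2 < eta -> c <= `|beta l a b|)].
Proof.
pose t0 := T2 / 2; have T20 := orbit_T_gt0 per2.
have t0T : 0 < t0 < T2 by rewrite /t0; apply/andP; split; lra.
pose X := x2 t0; pose Y := y2 t0.
pose U := vel_x P x2 y2 t0; pose V := vel_y Q x2 y2 t0.
have sp : 0 < U ^+ 2 + V ^+ 2 := orbit_speed per2 t0.
(* Behaviour of the first winding number near (X, Y). *)
have [kap [K1 [d1 [K10 d10 hN1]]]] : exists kap K1 d1, [/\ 0 <= K1, 0 < d1 &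
    forall e a b, 0 < e -> (a - X) ^+ 2 + (b - Y) ^+ 2 < d1 ->
      `|c1 * N1 e a b - kap| <= K1 * e].
  case: sep => [->|hs].
    by exists 0, 0, 1; split=> // e a b _ _; rewrite !mul0r subrr normr0.
  have [eta eta0 heta] := dist_pos per1 (fun t => hs t t0).
  have [K [d [K0 d0 hK]]] := owind_local per1 eta0 heta.
  exists (c1 * N1 0 X Y), (`|c1| * K), d; split=> //; first by rewrite mulr_ge0.
  move=> e a b e0 hd; rewrite -mulrBr normrM -mulrA ler_wpM2l //.
  exact: hK.
pose px s := X - s * V; pose py s := Y + s * U.
have [s1 s10 hs1] : exists2 s, 0 < s & forall t, `|t| <= s -> 0 < px t ^+ 2 + py t ^+ 2 - ra ^+ 2.
  apply: (near0_gt0 (f := fun t => px t ^+ 2 + py t ^+ 2 - ra ^+ 2)); first by rewrite /px /py; cont.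
  by rewrite /px /py !mul0r subr0 addr0 subr_gt0; case/andP: (in2 t0).
have [s2 s20 hs2] : exists2 s, 0 < s & forall t, `|t| <= s -> 0 < rb ^+ 2 - (px t ^+ 2 + py t ^+ 2).
  apply: (near0_gt0 (f := fun t => rb ^+ 2 - (px t ^+ 2 + py t ^+ 2))); first by rewrite /px /py; cont.
  by rewrite /px /py !mul0r subr0 addr0 subr_gt0; case/andP: (in2 t0).
have [s3 s30 hs3] : exists2 s, 0 < s & forall t, `|t| <= s ->
    0 < d1 / 4 - ((px t - X) ^+ 2 + (py t - Y) ^+ 2).
  apply: (near0_gt0 (f := fun t => d1 / 4 - ((px t - X) ^+ 2 + (py t - Y) ^+ 2))).
    by rewrite /px /py; cont.
  by rewrite /px /py !mul0r subr0 addr0 !subrr expr0n addr0 subr0 divr_gt0.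
pose sm := Num.min s1 (Num.min s2 s3).
have sm0 : 0 < sm by rewrite !lt_min s10 s20 s30.
have [B B0 hB] := vel_bound per2.
have [xT yT] := orbit_closed per2.
have [s [c [eta [eps0 [/andP[s0 ssm] c0 eta0 /andP[eps00 eps01] [off jump]]]]]] :=
  wind_jump T20 B0 (orbit_dx per2) (orbit_dy per2) (vel_x_cont per2) (vel_y_cont per2) xT yT
    hB t0T sp (fun t tT ex ey => orbit_simple per2 tT ex ey) sm0.
rewrite -/X -/Y -/U -/V -/(px s) -/(px (- s)) -/(py s) -/(py (- s)) in off jump.
have offT z t : z = s \/ z = - s -> eta <= dist2 x2 y2 (px z) (py z) t.
  move=> hz; have [t' tT [ex ey]] := period_reduce per2 t.
  rewrite /dist2 -ex -ey -/(dist2 x2 y2 (px z) (py z) t'); have [off1 off2] := off t' tT.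
  by case: hz => ->.
have ssm1 : s <= s1 by rewrite (le_trans ssm) // ge_min lexx.
have ssm2 : s <= s2 by rewrite (le_trans ssm) // !ge_min lexx orbT.
have ssm3 : s <= s3 by rewrite (le_trans ssm) // !ge_min lexx !orbT.
have [Kp [dp [Kp0 dp0 hp]]] := owind_local per2 eta0 (fun t => offT s t (or_introl erefl)).
have [Km [dm [Km0 dm0 hm]]] := owind_local per2 eta0 (fun t => offT (- s) t (or_intror erefl)).
have jump0 : c / 2 <= N2 0 (px s) (py s) - N2 0 (px (- s)) (py (- s)).
  pose e := Num.min (eps0 / 2) (c / (2 * (Kp + Km + 1))).
  have D0 : 0 < 2 * (Kp + Km + 1) by lra.
  have e0 : 0 < e by rewrite lt_min !divr_gt0.
  have e1 : e < eps0 by rewrite gt_min; apply/orP; left; lra.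
  have e2 : e * (2 * (Kp + Km + 1)) <= c by rewrite -ler_pdivlMr // ge_min lexx orbT.
  have e3 : e ^+ 2 <= e by rewrite expr2 ler_piMr ?ltW // (lt_le_trans e1).
  have e20 : 0 < e ^+ 2 by rewrite exprn_gt0.
  have := jump e; rewrite e0 e1 => /(_ isT).
  have := hp (e ^+ 2) (px s) (py s) e20; rewrite !subrr expr0n addr0 => /(_ dp0).
  have := hm (e ^+ 2) (px (- s)) (py (- s)) e20; rewrite !subrr expr0n addr0 => /(_ dm0).
  rewrite -/(N2) -/(owind P Q x2 y2 T2 _ _ _) !ler_norml.
  rewrite /N2 /owind => /andP[m1 m2] /andP[m3 m4] m5.
  have := ler_wpM2l Kp0 e3; have := ler_wpM2l Km0 e3.
  lra.
pose b0 z := kap + N2 0 (px z) (py z).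
have [z [zs [K2 [d2 [K20 d20 h2 hb0]]]]] : exists z, (z = s \/ z = - s) /\ exists K2 d2,
   [/\ 0 <= K2, 0 < d2, (forall e a b, 0 < e -> (a - px z) ^+ 2 + (b - py z) ^+ 2 < d2 ->
       `|N2 e a b - N2 0 (px z) (py z)| <= K2 * e) & c / 4 <= `|b0 z|].
  have [hz|hz] := leP (c / 4) `|b0 s|.
    by exists s; split; [left|exists Kp, dp].
  exists (- s); split; [by right|exists Km, dm; split=> //].
  have h1 := ler_normB (b0 s) (b0 (- s)).
  have h3 : c / 2 <= `|b0 s - b0 (- s)|.
    by rewrite (le_trans _ (ler_norm _)) // /b0; lra.
  by lra.
have zn : `|z| = s by case: zs => ->; rewrite ?normrN gtr0_norm.
have [r0 [th0 [r00 hth ea eb er]]] := polar_repr (px z) (py z).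
pose dd := Num.min d2 (d1 / 4).
exists r0, th0, (c / 8), dd; rewrite -ea -eb; split=> //; last 3 first.
- by rewrite divr_gt0.
- by rewrite lt_min d20 divr_gt0.
- have K0 : 0 <= K1 + K2 by rewrite addr_ge0.
  have c8 : 0 < c / 8 by rewrite divr_gt0.
  apply: for_small_sub (for_small_linear K0 c8) => l /andP[l0 l1] hl a b.
  rewrite lt_min => /andP[hd2 hd1].
  have e40 := l4 l0.
  have l4l : l ^+ 4 <= l by rewrite exprS ler_piMr ?(ltW l0) // exprn_ile1 ?(ltW l0).
  have k2 := h2 _ _ _ e40 hd2.
  have k1 : `|c1 * N1 (l ^+ 4) a b - kap| <= K1 * l ^+ 4.
    apply: hN1 => //.
    have := hs3 z; rewrite zn => /(_ ssm3).
    have := sqr_ge0 (a - px z - (px z - X)); have := sqr_ge0 (b - py z - (py z - Y)).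
    lra.
  have k3 := ler_wpM2l K0 l4l.
  have k4 : `|beta l a b - b0 z| <= (K1 + K2) * l ^+ 4.
    rewrite (_ : beta l a b - b0 z = (c1 * N1 (l ^+ 4) a b - kap) +
       (N2 (l ^+ 4) a b - N2 0 (px z) (py z))); last by rewrite /beta /b0; ring.
    by rewrite (le_trans (ler_normD _ _)) // mulrDl lerD.
  have k5 := ler_normB (beta l a b) (beta l a b - b0 z).
  by rewrite opprB addrC subrK in k5; lra.
have h1 := hs1 z; have h3 := hs2 z; rewrite zn in h1 h3.
have {}h1 := h1 ssm1; have {}h3 := h3 ssm2; rewrite -er in h1 h3.
apply/andP; split.
- by rewrite -(@ltr_pXn2r _ 2) ?nnegrE //; lra.
- by rewrite -(@ltr_pXn2r _ 2) ?nnegrE ?(ltW rb0) //; lra.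
Qed.

(** Used for two disjoint orbits, the first of which winds around the origin;
    and, with [c1 = 0] and both orbits equal, for a single orbit when there is no
    hole or when the orbit does not wind around it. *)
Lemma annulus_contra : False.
Proof.
have [r0 [th0 [c [eta [r0ab hth c0 eta0 hl]]]]] := large.
exact: (dulac_core k0 ra0 rab w_neq0 M_neg beta_cont bx_cont by_cont beta_chain
  beta_outer beta_inner along_small r0ab hth c0 eta0 hl).
Qed.
End TwoOrbits.

(** * Counting the limit cycles *)

Section OrbitsAndRoots.
Context {R : realType}.
Variables (P Q : bipoly R) (w : {poly R}) (k : R).
Hypothesis k0 : 0 < k.
Hypothesis M_neg : forall r th, 0 < r -> 0 <= th <= 2 * pi -> dulacM P Q k w r th < 0.
Hypotheses (P0 : eval2 P 0 0 = 0) (Q0 : eval2 Q 0 0 = 0).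

Section Orbit.
Variables (x y : R -> R) (T : R).
Hypothesis per : periodic_solution P Q x y T.

Definition radius t := Num.sqrt (x t ^+ 2 + y t ^+ 2).

Lemma radius_gt0 t : 0 < radius t.
Proof. by rewrite sqrtr_gt0 (orbit_neq0 per). Qed.

Lemma radius_sqr t : radius t ^+ 2 = x t ^+ 2 + y t ^+ 2.
Proof. by rewrite sqr_sqrtr // addr_ge0 ?sqr_ge0. Qed.

Lemma radius_derive (t : R) : isd t radius
  ((x t * vel_x P x y t + y t * vel_y Q x y t) / radius t).
Proof.
have dx := orbit_dx per t; have dy := orbit_dy per t.
have dq : isd t (fun t => x t ^+ 2 + y t ^+ 2)
  (2 * (x t * vel_x P x y t + y t * vel_y Q x y t)) by isd; ring.
have q0 := orbit_neq0 per t P0 Q0.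
have ds := isd_comp (g := fun t => x t ^+ 2 + y t ^+ 2) (is_derive1_sqrt q0) dq.
apply: (isd_eq ds); rewrite -/(radius t); have := radius_gt0 t => r0.
by field; rewrite gt_eqF.
Qed.

Lemma radius_cont : continuous radius.
Proof. by apply: isd_cont => t; eexists; exact: radius_derive. Qed.

Let dv t := eval2 (divergence P Q) (x t) (y t).

(** Along the orbit, g = w(r) satisfies g' = M + k div g with M < 0, so
    g exp(- k int div) decreases. *)
Lemma weight_decr t1 : w.[radius (t1 + T)] * expR (- k * RI t1 (t1 + T) dv) < w.[radius t1].
Proof.
have T0 := orbit_T_gt0 per; have cx := orbit_cx per; have cy := orbit_cy per.
have cdiv := eval2_cont (F := divergence P Q).
have cdv : continuous dv by rewrite /dv; cont.
have [D [dD eD]] := RI_primitive (t1 - 1) cdv.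
pose g t := w.[radius t] * expR (- k * (D t - D t1)).
pose w' (r : R) : R := (deriv w).[r].
pose dg t := (w' (radius t) * ((x t * vel_x P x y t + y t * vel_y Q x y t) / radius t) -
    k * dv t * w.[radius t]) * expR (- k * (D t - D t1)).
have tt : t1 < t1 + T by lra.
have hg (t : R) : t1 <= t <= t1 + T -> isd t g (dg t).
  move=> /andP[h1 h2]; have dr := radius_derive t.
  have dDt : isd t D (dv t) by apply: dD; lra.
  have dw : isd t (fun t => w.[radius t])
     (w' (radius t) * ((x t * vel_x P x y t + y t * vel_y Q x y t) / radius t)).
    exact: (isd_comp (g := radius) (is_derive_poly w (radius t)) dr).
  have dk : isd t (fun t => - k * (D t - D t1)) (- k * dv t) by isd; ring.
  have de := isd_comp (g := fun t => - k * (D t - D t1)) (is_derive_expR _) dk.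
  by apply: (isd_eq (isdM dw de)); rewrite /dg; ring.
have dneg t : dg t < 0.
  rewrite /dg pmulr_llt0 ?expR_gt0 //.
  have [r [th [r0 hth ex ey er]]] := polar_repr (x t) (y t).
  have rr : radius t = r by rewrite /radius -er sqrtr_sqr ger0_norm.
  have rp : 0 < r by rewrite -rr radius_gt0.
  have := M_neg rp hth; rewrite /dulacM /polarR -ex -ey /dv eval2_divergence -/(vel_x P x y t) -/(vel_y Q x y t).
  rewrite rr /w' ex ey => h.
  rewrite [X in X - _](_ : _ = (vel_x P x y t * cos th + vel_y Q x y t * sin th) * (deriv w).[r]) //.
  by field; rewrite gt_eqF.
have hg' (t : R) : t \in `]t1, t1 + T[%R -> isd t g (dg t).
  by rewrite in_itv /= => /andP[h1 h2]; apply: hg; rewrite !ltW.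
have cg : {within `[t1, t1 + T], continuous g}.
  apply: derivable_within_continuous => t; rewrite in_itv /= => ht.
  by have [] := hg t ht.
have [c _ e] := MVT tt hg' cg.
have : g (t1 + T) < g t1.
  by rewrite -subr_lt0 e nmulr_rlt0 // subr_gt0.
by rewrite /g subrr mulr0 expR0 mulr1 -(eD t1 (t1 + T)) //; lra.
Qed.

Lemma radius_period t : radius (t + T) = radius t.
Proof. by case: per => _ [_ h] _; have [ex ey] := h t; rewrite /radius ex ey. Qed.

Lemma orbit_no_root t : w.[radius t] != 0.
Proof.
by apply/eqP => e; have := weight_decr t; rewrite radius_period e mul0r ltxx.
Qed.

Lemma orbit_hyperbolic : RI 0 T dv <> 0.
Proof.
by move=> e; have := weight_decr 0; rewrite radius_period add0r e mulr0 expR0 mulr1 ltxx.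
Qed.

(** The radius takes all the values between its extrema, and [w] vanishes at
    none of them by [orbit_no_root]. *)
Lemma radius_range : exists rmin rmax, [/\ exists t, radius t = rmin, rmin <= rmax,
  forall t, rmin <= radius t <= rmax & forall r, rmin <= r <= rmax -> w.[r] != 0].
Proof.
have T0 := ltW (orbit_T_gt0 per); have cr := radius_cont.
have cw : {within `[0, T], continuous radius} by exact: continuous_subspaceT.
have [tM _ hM] := EVT_max T0 cw.
have [tm _ hm] := EVT_min T0 cw.
have all_t t : radius tm <= radius t <= radius tM.
  have [s sT [ex ey]] := period_reduce per t.
  have -> : radius t = radius s by rewrite /radius ex ey.
  by rewrite hm ?hM // in_itv.
exists (radius tm), (radius tM); split=> //.
- by exists tm.
- by case/andP: (all_t tm).
move=> r /andP[r1 r2].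
have cs a b : {within `[a, b], continuous radius} by exact: continuous_subspaceT.
have mm : radius tm <= radius tM by case/andP: (all_t tm).
have [s es] : exists s, radius s = r.
  have [ab|/ltW ab] := leP tm tM.
  - have [|s _ es] := IVT (v := r) ab (cs tm tM); last by exists s.
    by rewrite ge_min le_max r1 r2 orbT.
  - have [|s _ es] := IVT (v := r) ab (cs tM tm); last by exists s.
    by rewrite ge_min le_max r1 r2 orbT.
by rewrite -es orbit_no_root.
Qed.
End Orbit.

Lemma nonroot_extend b : w.[b] != 0 -> exists2 b', b < b' & forall r, b <= r <= b' -> w.[r] != 0.
Proof.
move=> wb; have cw : continuous (fun r => `|w.[b + r]|) by cont.
have [|s s0 hs] := near0_gt0 cw; first by rewrite addr0 normr_gt0.
exists (b + s) => [|r /andP[r1 r2]]; first by rewrite ltrDl.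
have := hs (r - b); rewrite addrCA subrr addr0 normr_gt0; apply.
by rewrite ger0_norm; lra.
Qed.

Lemma max_of_finite (p : R -> Prop) (s : seq R) : (forall z, p z -> z \in s) -> (exists z, p z) ->
  exists z, p z /\ forall z', p z' -> z' <= z.
Proof.
elim: s p => [|a s IH] p ps [z pz]; first by have := ps z pz; rewrite in_nil.
have [[z1 [pz1 hz1]]|no] := pselect (exists z1, p z1 /\ z1 != a).
- have [||m [[pm ma] hm]] := IH (fun z => p z /\ z != a).
  + by move=> u [pu ua]; have := ps u pu; rewrite inE (negbTE ua).
  + by exists z1.
  have [[pa am]|na] := pselect (p a /\ m < a).
  + exists a; split=> // u pu; have [->|ua] := eqVneq u a; first exact: lexx.
    exact: (le_trans (hm u (conj pu ua)) (ltW am)).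
  + exists m; split=> // u pu; have [e|ua] := eqVneq u a; last exact: hm.
    by rewrite leNgt; apply/negP => lt; apply: na; rewrite -e.
- exists z; split=> // u pu.
  have e v : p v -> v = a by move=> pv; apply/eqP/negPn/negP => va; apply: no; exists v.
  by rewrite (e _ pu) (e _ pz).
Qed.

(** [zeta] is the largest root of [w] below the orbit; the interval without roots
    reaches up to the largest radius on the orbit, so that orbits with the same
    [zeta] lie in a common annulus without roots. *)
Definition inner_root (C : set (R * R)) (zeta : R) : Prop :=
  exists x y T, [/\ periodic_solution P Q x y T, C = orbit_of x y T,
    (0 <= zeta /\ root w zeta) &
    exists2 rmax, (forall t, zeta < radius x y t <= rmax) &
      forall r, zeta < r <= rmax -> w.[r] != 0].

Hypothesis w_finite : finite_set [set r : R | 0 <= r /\ root w r].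

(** If [w] had no root inside the orbit, it would have none on a disc that
    contains the orbit, against [annulus_contra] with [ra = 0]. *)
Lemma inner_root_exists C : periodic_orbit P Q C -> exists zeta, inner_root C zeta.
Proof.
move=> [x [y [T [per eC]]]].
have [rmin [rmax [[tm em] mm hr hw]]] := radius_range per.
have rmin0 : 0 < rmin by rewrite -em (radius_gt0 per).
have /finite_seqP[s es] := w_finite.
have ins z : 0 <= z -> root w z -> z \in s.
  move=> z0 rz; suff : [set` s] z by [].
  by rewrite -es.
have [ex|no] := pselect (exists z, 0 <= z /\ root w z /\ z < rmin).
- have [z [[z0 [rz zr]] hz]] := max_of_finite
    (p := fun z => 0 <= z /\ root w z /\ z < rmin) (fun z h => ins z h.1 h.2.1) ex.
  exists z, x, y, T; split=> //; exists rmax.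
    by move=> t; case/andP: (hr t) => h1 ->; rewrite (lt_le_trans zr).
  move=> r /andP[zr' rr]; have [rl|rg] := leP rmin r; first by apply: hw; rewrite rl.
  apply/negP => w0; have rz' : r <= z.
    by apply: hz; split; [rewrite (le_trans z0) // ltW|split].
  by rewrite leNgt zr' in rz'.
exfalso.
have wmax : w.[rmax] != 0 by apply: hw; rewrite mm lexx.
have [rb rrb hb] := nonroot_extend wmax.
have rb0 : 0 < rb by lra.
apply: (@annulus_contra R P Q w k 0 rb k0 (lexx _) rb0 _ M_neg P0 Q0 x y x y T T per per _ _ 0).
- move=> r /andP[r0 rb1]; have [h1|h1] := leP rmax r; first by apply: hb; rewrite h1.
  have [h2|h2] := leP rmin r; first by apply: hw; rewrite h2 ltW.
  by apply/negP => w0; apply: no; exists r.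
- move=> t; rewrite expr0n /= (orbit_neq0 per) //= -radius_sqr.
  have := hr t; have := radius_gt0 per t => r0 /andP[_ h].
  by rewrite ltr_pXn2r ?nnegrE //; lra.
- move=> t; rewrite expr0n /= (orbit_neq0 per) //= -radius_sqr.
  have := hr t; have := radius_gt0 per t => r0 /andP[_ h].
  by rewrite ltr_pXn2r ?nnegrE //; lra.
- by left.
- by left.
Qed.

(** If the first orbit does not wind around the origin, it contradicts
    [annulus_contra] alone; otherwise the second winding number minus a multiple
    of the first one vanishes at the origin, hence in the hole. *)
Lemma inner_root_inj C1 C2 zeta : inner_root C1 zeta -> inner_root C2 zeta -> C1 = C2.
Proof.
move=> [x1 [y1 [T1 [per1 e1 [z0 rz] [M1 h1 w1]]]]] [x2 [y2 [T2 [per2 e2 _ [M2 h2 w2]]]]].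
apply: contrapT => ne.
have [m1 [R1 [[t1 em1] _ hr1 _]]] := radius_range per1.
have [m2 [R2 [[t2 em2] _ hr2 _]]] := radius_range per2.
have zm1 : zeta < m1 by rewrite -em1; case/andP: (h1 t1).
have zm2 : zeta < m2 by rewrite -em2; case/andP: (h2 t2).
pose M := Num.max M1 M2; pose m := Num.min m1 m2.
have zm : zeta < m by rewrite lt_min zm1.
have wM r : zeta < r <= M -> w.[r] != 0.
  move=> /andP[zr]; rewrite le_max => /orP[rM|rM]; first by apply: w1; rewrite zr.
  by apply: w2; rewrite zr.
have mM : m <= M.
  rewrite ge_min !le_max; apply/orP; left; apply/orP; left.
  by rewrite -em1; case/andP: (h1 t1).
have wmax : w.[M] != 0 by apply: wM; rewrite lexx andbT (lt_le_trans zm).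
have [rb Mrb hb] := nonroot_extend wmax.
pose ra := (zeta + m) / 2.
have ra0 : 0 <= ra by rewrite divr_ge0 //; lra.
have rab : ra < rb by rewrite /ra; lra.
have wab r : ra <= r <= rb -> w.[r] != 0.
  move=> /andP[r1 r2]; have [h|h] := leP M r; first by apply: hb; rewrite h.
  by apply: wM; rewrite (ltW h) andbT; move: r1; rewrite /ra; lra.
have inside x y T (per : periodic_solution P Q x y T) mi Mi : (forall t, mi <= radius x y t) ->
    m <= mi -> (forall t, zeta < radius x y t <= Mi) -> Mi <= M ->
    forall t, ra ^+ 2 < x t ^+ 2 + y t ^+ 2 < rb ^+ 2.
  move=> hmi mmi hMi MMi t; rewrite -radius_sqr.
  have := hmi t; have /andP[_] := hMi t; have := radius_gt0 per t => r0 q1 q2.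
  have rb0 : 0 <= rb by rewrite (le_trans ra0) // ltW.
  by rewrite !ltr_pXn2r ?nnegrE ?(ltW r0) //; apply/andP; split; rewrite /ra; lra.
have in1 : forall t, ra ^+ 2 < x1 t ^+ 2 + y1 t ^+ 2 < rb ^+ 2.
  apply: (inside _ _ _ per1 m1 M1 _ _ h1).
  - by move=> t; case/andP: (hr1 t).
  - by rewrite ge_min lexx.
  - by rewrite le_max lexx.
have in2 : forall t, ra ^+ 2 < x2 t ^+ 2 + y2 t ^+ 2 < rb ^+ 2.
  apply: (inside _ _ _ per2 m2 M2 _ _ h2).
  - by move=> t; case/andP: (hr2 t).
  - by rewrite ge_min lexx orbT.
  - by rewrite le_max lexx orbT.
pose n1 := owind P Q x1 y1 T1 0 0 0; pose n2 := owind P Q x2 y2 T2 0 0 0.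
have [n10|n10] := eqVneq n1 0.
  apply: (@annulus_contra R P Q w k ra rb k0 ra0 rab wab M_neg P0 Q0 x1 y1 x1 y1 T1 T1 per1 per1
    in1 in1 0); first by left.
  by right; rewrite mul0r add0r.
apply: (@annulus_contra R P Q w k ra rb k0 ra0 rab wab M_neg P0 Q0 x1 y1 x2 y2 T1 T2 per1 per2
  in1 in2 (- n2 / n1)).
- right=> t s [ex ey]; apply: ne; rewrite e1 e2; exact: (orbits_meet per1 per2 ex ey).
- by right; rewrite -/n1 -/n2 divfK // addNr.
Qed.
End OrbitsAndRoots.

Theorem theorem1 (R : realType) (n d mplus : nat) (P Q : bipoly R)
    (p w : {poly R}) (k : R) (M : nat -> R -> R) (m : nat -> R)
    (hdeg : system_degree P Q = n)
    (hP0 : eval2 P 0 0 = 0) (hQ0 : eval2 Q 0 0 = 0)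
    (hp : is_radial_average P Q p)
    (hw : size w = d.+1)
    (hkw : dulac_pair p k w)
    (hM : forall r theta : R, 0 < r ->
       dulac_M P Q k w r theta = \sum_(i < n + d) M i theta * r ^+ i)
    (hm : forall (i : nat) (theta : R), (i < n + d)%N ->
       0 <= theta <= 2 * pi -> M i theta <= m i)
    (hmplus : [set r : R | 0 <= r /\ root w r] #= `I_mplus)
    (hPhi : forall r : R, 0 < r -> \sum_(i < n + d) m i * r ^+ i < 0) :
  [set C : set (R * R) | limit_cycle P Q C] #<= `I_mplus /\
  (forall C : set (R * R), limit_cycle P Q C -> hyperbolic P Q C).
Proof.
have k0 : 0 < k by case: hkw.
have M_neg r th : 0 < r -> 0 <= th <= 2 * pi -> dulacM P Q k w r th < 0.
  move=> r0 hth; rewrite -dulac_ME // hM //; apply: le_lt_trans (hPhi r r0).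
  by apply: ler_sum => i _; apply: ler_wpM2r; [rewrite exprn_ge0 // ltW|exact: hm].
have fin : finite_set [set r : R | 0 <= r /\ root w r] by exists mplus.
split; last first.
  by move=> C _ x y T per _; exact: (orbit_hyperbolic M_neg hP0 hQ0 per).
have /choice[f hf] : forall C : set (R * R), exists z, periodic_orbit P Q C -> inner_root P Q w C z.
  move=> C; have [pC|nC] := pselect (periodic_orbit P Q C); last by exists 0.
  by have [z hz] := inner_root_exists k0 M_neg hP0 hQ0 fin pC; exists z.
set A := [set C : set (R * R) | limit_cycle P Q C].
have inj : {in A &, injective f}.
  move=> C1 C2; rewrite !inE => -[p1 _] [p2 _] e; have i1 := hf C1 p1.
  have := hf C2 p2; rewrite -e; exact: (inner_root_inj k0 M_neg hP0 hQ0 i1).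
have /card_eqPle[_ h1] := inj_card_eq inj.
have /card_eqPle[h2 _] := hmplus.
apply: (card_le_trans h1); apply: card_le_trans h2; apply: subset_card_le.
by move=> _ [C [pC _] <-]; have [x [y [T [_ _ [z0 rz] _]]]] := hf C pC.
Qed.
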